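(* Let $b\in]0,1[$ and let $m\geq 1$ be an integer. Then there exists a family (a curve) of $m$-fold symmetric simply-connected $V$-states of the Euler equations in the unit disc $\mathbb{D}$ bifurcating from the trivial solution $\omega_0=\chi_{\mathbb{D}_b}$, where $\mathbb{D}_b=\{z\in\mathbb{C}: |z|<b\}$, at the angular velocity $$\Omega_m=\frac{m-1+b^{2m}}{2m}.$$
   Context: $\mathbb{D}$ is the open unit disc of $\mathbb{C}$ and $\mathbb{T}=\partial\mathbb{D}$. The 2D incompressible Euler equations in $\mathbb{D}$ in vorticity form are $\partial_t\omega+v\cdot\nabla\omega=0$, $v=\nabla^\perp\Psi$, $\Delta\Psi=\omega$ in $\mathbb{D}$, $\Psi=0$ on $\partial\mathbb{D}$. For a domain $D$ with $\overline D\subset\mathbb{D}$, the patch $\chi_D$ (or $D$ itself) is called a $V$-state (rotating patch) with angular velocity $\Omega\in\mathbb{R}$ if the solution with initial vorticity $\chi_D$ is $\chi_{D_t}$ with $D_t=e^{it\Omega}D$. For $D$ bounded by $C^1$ Jordan curves and symmetric with respect to the real axis, being a $V$-state is characterized by (and in this statement means) the boundary equation $$\operatorname{Re}\Big\{\Big(2\Omega\,\overline z+\frac1{2i\pi}\int_\Gamma\frac{\overline z-\overline\xi}{z-\xi}\,d\xi-\frac1{2i\pi}\int_\Gamma\frac{|\xi|^2}{1-z\xi}\,d\xi\Big)z'\Big\}=0\qquad\text{for all } z\in\Gamma=\partial D,$$ where $\Gamma$ is positively oriented and $z'$ is a tangent vector to $\Gamma$ at $z$. Discs centered at $0$ satisfy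 this for every $\Omega$ (trivial solutions). $D$ is $m$-fold symmetric if $e^{2i\pi/m}D=D$. Meaning of ''bifurcating from $\chi_{\mathbb{D}_b}$ at $\Omega_m$'': fix $\alpha\in]0,1[$. There are $a>0$ and continuous maps $s\in(-a,a)\mapsto\Omega(s)\in\mathbb{R}$ and $s\in(-a,a)\mapsto f_s\in C^{1+\alpha}(\mathbb{T})$ with $\Omega(0)=\Omega_m$, $f_0=0$, $f_s\neq0$ for $s\neq0$, each $f_s$ of the form $f_s(w)=\sum_{n\ge1}a_n(s)\overline w^{\,nm-1}$ with $a_n(s)\in\mathbb{R}$, such that $\phi_s(w)=bw+f_s(w)$ extends to a conformal map from $\{|w|>1\}$ onto the exterior of a simply-connected domain $D_s$ with $\overline{D_s}\subset\mathbb{D}$ and boundary $\phi_s(\mathbb{T})$, and $D_s$ is an $m$-fold symmetric $V$-state with angular velocity $\Omega(s)$. *)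

(* Defs.v *)
From Stdlib Require Import Reals.
From Coquelicot Require Import Coquelicot.
Open Scope R_scope.

Definition cis (t : R) : C := (cos t, sin t).

Definition closure (D : C -> Prop) (z : C) : Prop :=
  forall eps : posreal, exists y : C, D y /\ Cmod (y - z) < eps.

Definition boundary (D : C -> Prop) (z : C) : Prop :=
  closure D z /\ closure (fun y => ~ D y) z.

Definition connected (D : C -> Prop) : Prop :=
  forall U V : C -> Prop, open U -> open V ->
    (forall z, D z -> U z \/ V z) ->
    (exists z, D z /\ U z) -> (exists z, D z /\ V z) ->
    exists z, D z /\ U z /\ V z.

Definition is_domain (D : C -> Prop) : Prop :=
  (exists z, D z) /\ open D /\ connected D.

Definition unit_interval (t : R) : Prop := 0 <= t <= 1.

Definition unit_square (p : R * R) : Prop :=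
  unit_interval (fst p) /\ unit_interval (snd p).

Definition loop_in (D : C -> Prop) (g : R -> C) : Prop :=
  continuous_on unit_interval g /\
  (forall t, unit_interval t -> D (g t)) /\ g 0 = g 1.

(* The homotopy is through closed curves, with no fixed base point. *)
Definition null_homotopic_in (D : C -> Prop) (g : R -> C) : Prop :=
  exists (H : R * R -> C) (c : C),
    continuous_on unit_square H /\
    (forall p, unit_square p -> D (H p)) /\
    (forall u, unit_interval u -> H (0, u) = H (1, u)) /\
    (forall t, unit_interval t -> H (t, 0) = g t) /\
    (forall t, unit_interval t -> H (t, 1) = c).

Definition simply_connected (D : C -> Prop) : Prop :=
  connected D /\ forall g : R -> C, loop_in D g -> null_homotopic_in D g.

(* [g] is a regular 2 PI-periodic C^1 parametrization, with derivative [dg],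
   of the Jordan curve [G]. *)
Definition C1_Jordan_param (g dg : R -> C) (G : C -> Prop) : Prop :=
  (forall t, is_derive (V := C_R_NormedModule) g t (dg t)) /\
  (forall t, continuous dg t) /\
  (forall t, dg t <> 0%C) /\
  (forall t, g (t + 2 * PI) = g t) /\
  (forall t u, 0 <= t < 2 * PI -> 0 <= u < 2 * PI -> g t = g u -> t = u) /\
  (forall z, G z <-> exists t, z = g t).

Definition contour_int (g dg : R -> C) (F : C -> C) : C :=
  RInt (V := C_R_CompleteNormedModule)
    (fun t => (F (g t) * dg t)%C) 0 (2 * PI).

(* Index 1 around every point of the enclosed domain. *)
Definition positively_oriented (g dg : R -> C) (D : C -> Prop) : Prop :=
  forall z, D z ->
    (/ (2 * Ci * PI) * contour_int g dg (fun xi => / (xi - z)))%C = 1%C.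

(* Left-hand factor, at [z], of the tangent vector in the boundary equation.
   At [xi = z] the first integrand is [0 / 0], which is 0 here; this affects a
   single parameter value per period. *)
Definition boundary_field (Om : R) (g dg : R -> C) (z : C) : C :=
  (2 * Om * Cconj z
   + / (2 * Ci * PI)
       * contour_int g dg (fun xi => (Cconj z - Cconj xi) / (z - xi))
   - / (2 * Ci * PI)
       * contour_int g dg (fun xi => (Cmod xi ^ 2)%R / (1 - z * xi)))%C.

(* For domains that are symmetric with respect to the real axis and bounded by
   a single C^1 Jordan curve. The real part is real-homogeneous in the tangent
   vector, so testing it on [dg t] covers all tangent vectors at [g t]. *)
Definition V_state (Om : R) (D : C -> Prop) : Prop :=
  is_domain D /\
  (forall z, closure D z -> Cmod z < 1) /\
  (forall z, D z <-> D (Cconj z)) /\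
  exists g dg : R -> C,
    C1_Jordan_param g dg (boundary D) /\
    positively_oriented g dg D /\
    forall t, Re (boundary_field Om g dg (g t) * dg t)%C = 0.

Definition fold_symmetric (m : nat) (D : C -> Prop) : Prop :=
  forall z, D z <-> D (cis (2 * PI / INR m) * z)%C.

(* [phi], given on the unit circle, extends continuously to [|w| >= 1] by a
   conformal map of [|w| > 1] onto the complement of the closure of [D]. *)
Definition extends_conformally_onto_exterior
    (phi : C -> C) (D : C -> Prop) : Prop :=
  exists Phi : C -> C,
    (forall w, Cmod w = 1 -> Phi w = phi w) /\
    continuous_on (fun w : C => 1 <= Cmod w) Phi /\
    (forall w : C, 1 < Cmod w ->
       ex_derive (K := C_AbsRing) (V := C_NormedModule) Phi w) /\
    (forall w1 w2, 1 < Cmod w1 -> 1 < Cmod w2 -> Phi w1 = Phi w2 -> w1 = w2) /\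
    (forall z, ~ closure D z <-> exists w, 1 < Cmod w /\ z = Phi w).

(* Only the values of [f : C -> C] on the unit circle matter, and derivatives
   are taken in the angle: [circle_deriv f t] is [d/dt f(e^{it})], which is
   [i e^{it} f'(w)] at [w = e^{it}]. *)
Definition circle_deriv (f : C -> C) (t : R) : C :=
  (Derive (fun u => Re (f (cis u))) t, Derive (fun u => Im (f (cis u))) t).

(* [cis t <> cis u] is needed: [Rpower 0 alpha] is not 0. *)
Definition C1alpha_norm (alpha : R) (f : C -> C) : Rbar :=
  Rbar_plus
    (Rbar_plus
       (Lub_Rbar (fun x => exists t, x = Cmod (f (cis t))))
       (Lub_Rbar (fun x => exists t, x = Cmod (circle_deriv f t))))
    (Lub_Rbar (fun x => exists t u, cis t <> cis u /\
       x = Cmod (circle_deriv f t - circle_deriv f u)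
             / Rpower (Cmod (cis t - cis u)) alpha)).

Definition C1alpha (alpha : R) (f : C -> C) : Prop :=
  (forall t, ex_derive (V := C_R_NormedModule) (fun u => f (cis u)) t) /\
  is_finite (C1alpha_norm alpha f).

(* Main.v *)
Require Import Defs.
From Stdlib Require Import Reals.
From Coquelicot Require Import Coquelicot.
From Stdlib Require Import Lra Lia ZArith FunctionalExtensionality IndefiniteDescription.
From Stdlib Require List.
Open Scope list_scope.
Open Scope R_scope.

(* The equation is solved near the disc by hand-made Crandall-Rabinowitz. Put
   [phi(w) = b w + sum a_n w^{-(nm-1)}] and take [x n = N^2 a_n] (up to constants, [N = nm]) in l1.
   After cancelling [w - tau] in the Cauchy quotient, every term of the boundary equation is a product of
   absolutely convergent trigonometric series in two angles and Neumann series [1/(1-K)], averaged over one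
   angle; so the equation is strictly differentiable at [x = 0], with a quadratic remainder, from l1 to a
   weighted l1 of sine coefficients. Its linear part is diagonal with entries
   [b a_n (2 Om N - (N - 1) - b^{2N})], which at [Om_m] vanishes for [n = 1] only and is of order [n] for [n >= 2].
   Writing [x = s u] with [u_1 = 1] and dividing by [s], the unknowns [Om - Om_m] and [u_n], [n >= 2], are the
   fixed point of a contraction depending on [s] in a Lipschitz way.
   For the geometry, [phi] extends to a bi-Lipschitz homeomorphism of the plane, a small Lipschitz perturbation
   of [b w], and [D_s] is the image of the unit disc. *)

(** The obstacle is a lost derivative: [w phi'(w)] enters the equation and the inverse of the linear
    part must give it back. The spaces are chosen for this. The target weight [1 + kap N] is
    submultiplicative, so products and Neumann series stay in one algebra, and [om = N (1 + kap N)]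
    exceeds it by [N], the order of the diagonal entries. The parameter [kap] is there because [b w]
    has norm [b (1 + kap)], which must stay below 1 for the Neumann series of [1 / (1 - z xi)],
    however close [b] is to 1. Strict differentiability is required at the origin only, with modulus
    proportional to the radius. It is stable under products, inverses and averages, and it makes the
    remainder divided by [s] Lipschitz in [s] and in the unknown, so no derivative away from the
    origin occurs. Real coefficients make the equation odd in the angle and the symmetry leaves
    frequencies in [m Z], whence sine coefficients at multiples of [m]. With [y = b^(2m)] the
    diagonal entry is a negative multiple of [n (1 - y) - (1 - y^n)], the product of [1 - y] and the
    sum of [1 - y^j] over [j < n]. *)

Lemma Cext (z w : C) : Re z = Re w -> Im z = Im w -> z = w.
Proof. destruct z, w; unfold Re, Im; simpl; intros; subst; reflexivity. Qed.

Lemma Re_plus z w : Re (z + w)%C = Re z + Re w. Proof. reflexivity. Qed.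
Lemma Im_plus z w : Im (z + w)%C = Im z + Im w. Proof. reflexivity. Qed.
Lemma Re_opp z : Re (- z)%C = - Re z. Proof. reflexivity. Qed.
Lemma Im_opp z : Im (- z)%C = - Im z. Proof. reflexivity. Qed.
Lemma Re_minus z w : Re (z - w)%C = Re z - Re w. Proof. reflexivity. Qed.
Lemma Im_minus z w : Im (z - w)%C = Im z - Im w. Proof. reflexivity. Qed.
Lemma Re_mult z w : Re (z * w)%C = Re z * Re w - Im z * Im w. Proof. reflexivity. Qed.
Lemma Im_mult z w : Im (z * w)%C = Re z * Im w + Im z * Re w. Proof. reflexivity. Qed.
Lemma Re_RtoC (x : R) : Re x = x. Proof. reflexivity. Qed.
Lemma Im_RtoC (x : R) : Im x = 0. Proof. reflexivity. Qed.
Lemma Re_Ci : Re Ci = 0. Proof. reflexivity. Qed.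
Lemma Im_Ci : Im Ci = 1. Proof. reflexivity. Qed.
Lemma Re_cis t : Re (cis t) = cos t. Proof. reflexivity. Qed.
Lemma Im_cis t : Im (cis t) = sin t. Proof. reflexivity. Qed.

Hint Rewrite Re_plus Im_plus Re_opp Im_opp Re_minus Im_minus Re_mult Im_mult
  Re_RtoC Im_RtoC Re_Ci Im_Ci Re_cis Im_cis re_conj im_conj : reim.

Lemma im_le_Cmod z : Rabs (Im z) <= Cmod z.
Proof.
  eapply Rle_trans; [|apply Rmax_Cmod]. apply Rmax_r.
Qed.

Lemma Cmod_le_ReIm z : Cmod z <= Rabs (Re z) + Rabs (Im z).
Proof.
  replace z with (RtoC (Re z) + Ci * RtoC (Im z))%C
    by (apply Cext; autorewrite with reim; ring).
  eapply Rle_trans; [apply Cmod_triangle|].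
  rewrite Cmod_mult, Cmod_Ci, !Cmod_R. autorewrite with reim.
  replace (Re z + (0 * Im z - 1 * 0)) with (Re z) by ring.
  replace (0 + (0 * 0 + 1 * Im z)) with (Im z) by ring. lra.
Qed.

Lemma Cmod_minus_sym z w : Cmod (z - w) = Cmod (w - z).
Proof. rewrite <- Cmod_opp. f_equal. ring. Qed.

Lemma Cmod_minus_triangle z w : Cmod (z - w) <= Cmod z + Cmod w.
Proof. unfold Cminus. rewrite <- (Cmod_opp w). apply Cmod_triangle. Qed.

Lemma Cmod_minus_rev z w : Cmod z - Cmod w <= Cmod (z - w).
Proof.
  assert (H := Cmod_triangle (z - w) w).
  replace (z - w + w)%C with z in H by ring. lra.
Qed.

Lemma Cmod_dist_triangle x y z : Cmod (x - z) <= Cmod (x - y) + Cmod (y - z).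
Proof.
  replace (x - z)%C with ((x - y) + (y - z))%C by ring. apply Cmod_triangle.
Qed.

Lemma Cmod_RC (r : R) (z : C) : Cmod (r * z) = Rabs r * Cmod z.
Proof. now rewrite Cmod_mult, Cmod_R. Qed.

Lemma Cminus_eq_0 (z w : C) : Cmod (z - w) = 0 -> z = w.
Proof.
  intros H. apply Cmod_eq_0 in H. replace z with (z - w + w)%C by ring.
  rewrite H. ring.
Qed.

Lemma Cmod_le_eps_eq (z w : C) : (forall e, 0 < e -> Cmod (z - w) <= e) -> z = w.
Proof.
  intros H. apply Cminus_eq_0. apply Rle_antisym; [|apply Cmod_ge_0].
  apply le_epsilon. intros e He. rewrite Rplus_0_l. now apply H.
Qed.

(** * The unit circle parametrized by the angle *)

Lemma cis_0 : cis 0 = 1%C.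
Proof. unfold cis. rewrite cos_0, sin_0. reflexivity. Qed.

Lemma cis_plus s t : cis (s + t) = (cis s * cis t)%C.
Proof. apply Cext; autorewrite with reim; [apply cos_plus|rewrite sin_plus; ring]. Qed.

Lemma cis_opp t : cis (- t) = Cconj (cis t).
Proof. apply Cext; autorewrite with reim; [apply cos_neg|apply sin_neg]. Qed.

Lemma Cmod_cis t : Cmod (cis t) = 1.
Proof.
  assert (H : Cmod (cis t) ^ 2 = 1).
  { rewrite Cmod2_alt. autorewrite with reim.
    rewrite <- (sin2_cos2 t). unfold Rsqr. ring. }
  assert (H0 := Cmod_ge_0 (cis t)). nra.
Qed.

Lemma cis_neq_0 t : cis t <> 0%C.
Proof. apply Cmod_gt_0. rewrite Cmod_cis. lra. Qed.

Lemma cis_opp_mult t : (cis (- t) * cis t)%C = 1%C.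
Proof. rewrite <- cis_plus, Rplus_opp_l. apply cis_0. Qed.

Lemma Cinv_cis t : (/ cis t)%C = cis (- t).
Proof.
  rewrite <- (Cmult_1_l (/ cis t)), <- (cis_opp_mult t). field. apply cis_neq_0.
Qed.

Lemma cis_period t : cis (t + 2 * PI) = cis t.
Proof. unfold cis. now rewrite cos_plus, sin_plus, cos_2PI, sin_2PI, !Rmult_1_r, !Rmult_0_r, Rminus_0_r, Rplus_0_r. Qed.

Lemma cis_period_nat t n : cis (t + INR n * (2 * PI)) = cis t.
Proof.
  induction n; [simpl; f_equal; ring|].
  rewrite S_INR. replace (t + (INR n + 1) * (2 * PI)) with (t + INR n * (2 * PI) + 2 * PI) by ring.
  now rewrite cis_period.
Qed.

Lemma cis_period_Z t p : cis (t + IZR p * (2 * PI)) = cis t.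
Proof.
  destruct (Z_le_gt_dec 0 p) as [Hp|Hp].
  - rewrite <- (Z2Nat.id p Hp), <- INR_IZR_INZ. apply cis_period_nat.
  - rewrite <- (cis_period_nat _ (Z.to_nat (- p))). f_equal.
    rewrite INR_IZR_INZ, Z2Nat.id, opp_IZR by lia. ring.
Qed.

Lemma cis_IZR_2PI p : cis (IZR p * (2 * PI)) = 1%C.
Proof. rewrite <- (Rplus_0_l (IZR p * _)), cis_period_Z. apply cis_0. Qed.

Lemma cis_pow t n : (cis t ^ n)%C = cis (INR n * t).
Proof.
  induction n.
  - simpl. now rewrite Rmult_0_l, cis_0.
  - rewrite Cpow_S, IHn, <- cis_plus, S_INR. f_equal. ring.
Qed.

Lemma angle_mod t : exists t1, 0 <= t1 < 2 * PI /\ exists p, t = t1 + IZR p * (2 * PI).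
Proof.
  assert (Hpi := PI_RGT_0).
  destruct (archimed (t / (2 * PI))) as [H1 H2].
  set (p := (up (t / (2 * PI)) - 1)%Z).
  exists (t - IZR p * (2 * PI)). split; [|exists p; ring].
  unfold p. rewrite minus_IZR.
  assert (E : t = t / (2 * PI) * (2 * PI)) by (field; lra).
  set (u := t / (2 * PI)) in *. nra.
Qed.

Lemma cis_inj t u : 0 <= t < 2 * PI -> 0 <= u < 2 * PI -> cis t = cis u -> t = u.
Proof.
  intros Ht Hu E.
  assert (Hc : cos (t - u) = 1).
  { rewrite cos_minus. injection E as E1 E2. rewrite E1, E2.
    rewrite <- (sin2_cos2 u). unfold Rsqr. ring. }
  assert (Hs : sin ((t - u) / 2) = 0).
  { assert (H2 : cos (2 * ((t - u) / 2)) = 1) by (rewrite <- Hc; f_equal; field).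
    rewrite cos_2a_sin in H2. nra. }
  assert (Hpi := PI_RGT_0).
  destruct (Rtotal_order ((t - u) / 2) 0) as [H|[H|H]].
  - assert (0 < sin (- ((t - u) / 2))) by (apply sin_gt_0; lra).
    rewrite sin_neg in H0. lra.
  - lra.
  - assert (0 < sin ((t - u) / 2)) by (apply sin_gt_0; lra). lra.
Qed.

Lemma unit_circle_cis (w : C) : Cmod w = 1 -> exists t, w = cis t.
Proof.
  intros H.
  assert (H2 : Re w ^ 2 + Im w ^ 2 = 1) by (rewrite <- Cmod2_alt, H; ring).
  assert (Hr : -1 <= Re w <= 1) by nra.
  assert (Hs : sin (acos (Re w)) = sqrt (1 - (Re w)²)) by (apply sin_acos; lra).
  assert (Hq : 1 - (Re w)² = (Im w)²) by (unfold Rsqr; nra).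
  rewrite Hq, sqrt_Rsqr_abs in Hs.
  destruct (Rle_dec 0 (Im w)) as [Hi|Hi].
  - exists (acos (Re w)). apply Cext; autorewrite with reim.
    + now rewrite cos_acos.
    + now rewrite Hs, Rabs_pos_eq.
  - exists (- acos (Re w)). apply Cext; autorewrite with reim.
    + now rewrite cos_neg, cos_acos.
    + rewrite sin_neg, Hs, Rabs_left; lra.
Qed.

(** The chord has length [2 |sin (t / 2)|]. *)
Lemma Cmod_one_minus_cis (t : R) : Cmod (cis t - 1) <= Rabs t.
Proof.
  assert (H : Cmod (cis t - 1) ^ 2 = (2 * sin (t / 2)) ^ 2).
  { rewrite Cmod2_alt. autorewrite with reim.
    replace t with (2 * (t / 2)) at 1 2 by field.
    rewrite cos_2a_sin, sin_2a.
    assert (E := sin2_cos2 (t / 2)). unfold Rsqr in E.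
    set (x := sin (t / 2)) in *. set (y := cos (t / 2)) in *.
    transitivity (4 * x ^ 2 * (x * x + y * y)); [ring|rewrite E; ring]. }
  assert (Hs : Rabs (sin (t / 2)) <= Rabs (t / 2)).
  { assert (P : forall x, 0 <= x -> Rabs (sin x) <= x).
    { intros x Hx. apply Rabs_le. split.
      - destruct (Rle_dec x PI).
        + assert (0 <= sin x) by (apply sin_ge_0; lra). lra.
        + assert (B := SIN_bound x). assert (P3 := PI2_3_2). lra.
      - destruct (Req_dec x 0) as [->|]; [rewrite sin_0; lra|].
        left. apply sin_lt_x. lra. }
    destruct (Rle_dec 0 (t / 2)).
    - rewrite (Rabs_pos_eq (t / 2)) by lra. apply P; lra.
    - rewrite <- (Rabs_Ropp (sin _)), <- sin_neg, (Rabs_left (t / 2)) by lra. apply P; lra. }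
  apply Rsqr_incr_0_var; [|apply Rabs_pos].
  unfold Rsqr. replace (Cmod (cis t - 1) * Cmod (cis t - 1)) with (Cmod (cis t - 1) ^ 2) by ring.
  rewrite H. rewrite <- (pow2_abs (2 * sin (t / 2))), Rabs_mult, (Rabs_pos_eq 2) by lra.
  replace t with (2 * (t / 2)) at 2 3 by field. rewrite Rabs_mult, (Rabs_pos_eq 2) by lra.
  assert (0 <= Rabs (sin (t/2))) by apply Rabs_pos. nra.
Qed.

Lemma Cmod_cis_minus s t : Cmod (cis s - cis t) <= Rabs (s - t).
Proof.
  replace (cis s - cis t)%C with (cis t * (cis (s - t) - 1))%C.
  - rewrite Cmod_mult, Cmod_cis, Rmult_1_l. apply Cmod_one_minus_cis.
  - unfold Cminus. rewrite Cmult_plus_distr_l, <- cis_plus. replace (t + (s - t)) with s by ring. ring.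
Qed.

(** * Sums *)

Fixpoint rsum (u : nat -> R) (n : nat) : R :=
  match n with O => 0 | S k => rsum u k + u k end.

Fixpoint csum (u : nat -> C) (n : nat) : C :=
  match n with O => 0%C | S k => (csum u k + u k)%C end.

(** For nonnegative terms this says at once that the series converges and that its sum is at most
    [M], without naming a limit. *)
Definition sumle (u : nat -> R) (M : R) : Prop := forall K, rsum u K <= M.

Lemma rsum_le u v n : (forall i, (i < n)%nat -> u i <= v i) -> rsum u n <= rsum v n.
Proof.
  induction n; simpl; intros H; [lra|].
  assert (rsum u n <= rsum v n) by (apply IHn; intros; apply H; lia).
  assert (u n <= v n) by (apply H; lia). lra.
Qed.

Lemma rsum_ext u v n : (forall i, (i < n)%nat -> u i = v i) -> rsum u n = rsum v n.
Proof. intros H; apply Rle_antisym; apply rsum_le; intros; right; [|symmetry]; now apply H. Qed.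

Lemma rsum_pos u n : (forall i, 0 <= u i) -> 0 <= rsum u n.
Proof. intros H; induction n; simpl; [lra|]. assert (A := H n). lra. Qed.

Lemma rsum_plus u v n : rsum (fun i => u i + v i) n = rsum u n + rsum v n.
Proof. induction n; simpl; [lra|rewrite IHn; lra]. Qed.

Lemma rsum_scal c u n : rsum (fun i => c * u i) n = c * rsum u n.
Proof. induction n; simpl; [lra|rewrite IHn; lra]. Qed.

Lemma rsum_mono u n m : (forall i, 0 <= u i) -> (n <= m)%nat -> rsum u n <= rsum u m.
Proof.
  intros Hu H; induction H; [lra|]. simpl. assert (A := Hu m). lra.
Qed.

Lemma rsum_term u n i : (forall i, 0 <= u i) -> (i < n)%nat -> u i <= rsum u n.
Proof.
  intros Hu H. apply Rle_trans with (rsum u (S i)).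
  - simpl. assert (A := rsum_pos u i Hu). lra.
  - apply rsum_mono; auto.
Qed.

Lemma csum_Cmod u n : Cmod (csum u n) <= rsum (fun i => Cmod (u i)) n.
Proof.
  induction n; simpl; [rewrite Cmod_0; lra|].
  eapply Rle_trans; [apply Cmod_triangle|lra].
Qed.

Lemma csum_ext u v n : (forall i, (i < n)%nat -> u i = v i) -> csum u n = csum v n.
Proof. induction n; simpl; intros H; [easy|]. rewrite IHn, H; auto. Qed.

Lemma csum_scal c u n : csum (fun i => c * u i)%C n = (c * csum u n)%C.
Proof. induction n; simpl; [ring|rewrite IHn; ring]. Qed.

Lemma csum_conj u n : Cconj (csum u n) = csum (fun i => Cconj (u i)) n.
Proof. induction n; simpl; [apply Cext; simpl; ring|now rewrite Cplus_conj, IHn]. Qed.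

Lemma Re_csum u n : Re (csum u n) = rsum (fun i => Re (u i)) n.
Proof. induction n; simpl; [reflexivity|now rewrite <- IHn]. Qed.

Lemma Im_csum u n : Im (csum u n) = rsum (fun i => Im (u i)) n.
Proof. induction n; simpl; [reflexivity|now rewrite <- IHn]. Qed.

Lemma csum_telescope (u : nat -> C) n : csum (fun i => u (S i) - u i)%C n = (u n - u O)%C.
Proof. induction n; simpl; [ring|rewrite IHn; ring]. Qed.

Lemma sum_n_rsum u n : sum_n u n = rsum u (S n).
Proof.
  induction n; [rewrite sum_O; simpl; lra|].
  rewrite sum_Sn, IHn. reflexivity.
Qed.

Lemma sumle_ge_0 u M : sumle u M -> 0 <= M.
Proof. intros H. apply (H O). Qed.

Lemma sumle_weaken u M M' : sumle u M -> M <= M' -> sumle u M'.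
Proof. intros H H' K. assert (A := H K). lra. Qed.

Lemma sumle_mono u v M : (forall i, u i <= v i) -> sumle v M -> sumle u M.
Proof. intros H H' K. eapply Rle_trans; [apply rsum_le; intros; apply H|apply H']. Qed.

Lemma sumle_plus u v M M' : sumle u M -> sumle v M' -> sumle (fun i => u i + v i) (M + M').
Proof. intros H H' K. rewrite rsum_plus. assert (A := H K). assert (B := H' K). lra. Qed.

Lemma sumle_scal c u M : 0 <= c -> sumle u M -> sumle (fun i => c * u i) (c * M).
Proof. intros Hc H K. rewrite rsum_scal. apply Rmult_le_compat_l; auto. Qed.

Lemma sumle_term u M i : (forall i, 0 <= u i) -> sumle u M -> u i <= M.
Proof. intros Hu H. eapply Rle_trans; [apply (rsum_term u (S i) i Hu)|apply H]; lia. Qed.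

Lemma sumle_ex_series u M : (forall i, 0 <= u i) -> sumle u M -> ex_series u.
Proof.
  intros Hu H.
  destruct (ex_finite_lim_seq_incr (sum_n u) M) as [l Hl].
  - intros n. rewrite !sum_n_rsum. apply rsum_mono; auto.
  - intros n. rewrite sum_n_rsum. apply H.
  - exists l. exact Hl.
Qed.

Lemma sumle_Series u M : (forall i, 0 <= u i) -> sumle u M -> Series u <= M.
Proof.
  intros Hu H. assert (E := sumle_ex_series u M Hu H).
  apply Series_correct in E.
  apply (is_lim_seq_le (sum_n u) (fun _ => M) (Series u) M).
  - intros n. rewrite sum_n_rsum. apply H.
  - exact E.
  - apply is_lim_seq_const.
Qed.

Lemma ex_series_sumle u : (forall i, 0 <= u i) -> ex_series u -> sumle u (Series u).
Proof.
  intros Hu E K.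
  assert (E' := Series_correct _ E).
  apply Rle_trans with (rsum u (S K)); [apply rsum_mono; auto|].
  rewrite <- sum_n_rsum.
  apply (is_lim_seq_incr_compare (sum_n u)); [exact E'|].
  intros n. rewrite !sum_n_rsum. apply rsum_mono; auto.
Qed.

Definition cut (K n : nat) : R := if (n <? K)%nat then 0 else 1.

Lemma cut_bounds K n : 0 <= cut K n <= 1.
Proof. unfold cut. destruct (n <? K)%nat; lra. Qed.

Lemma rsum_cut u K n : rsum (fun i => cut K i * u i) n = rsum u n - rsum u (min n K).
Proof.
  induction n; simpl; [lra|]. rewrite IHn. unfold cut.
  destruct (Nat.ltb_spec n K).
  - rewrite !Nat.min_l by lia. destruct K; [lia|]. rewrite Nat.min_l by lia. simpl. lra.
  - destruct K; simpl; [rewrite Nat.min_r by lia; simpl; lra|].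
    rewrite !Nat.min_r by lia. simpl. lra.
Qed.

(** Small tails reduce statements about series to finite sums; below, the cut is always placed by
    this lemma. *)
Lemma sumle_tail u M eps : (forall i, 0 <= u i) -> sumle u M -> 0 < eps ->
  exists K, sumle (fun i => cut K i * u i) eps.
Proof.
  intros Hu H He.
  assert (E := sumle_ex_series u M Hu H).
  assert (Hs := ex_series_sumle u Hu E).
  assert (E' := Series_correct _ E).
  destruct (E' (ball (Series u) (mkposreal eps He))) as [N HN]; [now exists (mkposreal eps He)|].
  exists (S N). intros n. rewrite rsum_cut.
  destruct (Nat.le_gt_cases n (S N)) as [L|L].
  - rewrite Nat.min_l by lia. lra.
  - rewrite Nat.min_r by lia.
    assert (A := HN N (le_n N)). rewrite sum_n_rsum in A.
    unfold ball in A; simpl in A; unfold AbsRing_ball, abs, minus, plus, opp in A; simpl in A.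
    apply Rabs_def2 in A. assert (B := Hs n). change (rsum u N + u N) with (rsum u (S N)) in A. lra.
Qed.

(** [M] is any upper bound of the norm, so every estimate is a membership in a ball and no supremum
    is computed. *)
Definition l1 (x : nat -> R) (M : R) : Prop := sumle (fun i => Rabs (x i)) M.

Lemma l1_term x M i : l1 x M -> Rabs (x i) <= M.
Proof. intros H. apply (sumle_term (fun i => Rabs (x i))); auto. intros; apply Rabs_pos. Qed.

Lemma l1_weaken x M M' : l1 x M -> M <= M' -> l1 x M'.
Proof. apply sumle_weaken. Qed.

Lemma l1_ext x y M : (forall i, x i = y i) -> l1 x M -> l1 y M.
Proof. intros E. apply sumle_mono. intros i. rewrite E. lra. Qed.

Lemma l1_scal c x M : l1 x M -> l1 (fun i => c * x i) (Rabs c * M).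
Proof.
  intros H. eapply sumle_mono; [|apply sumle_scal; [apply Rabs_pos|apply H]].
  intros i. simpl. rewrite Rabs_mult. lra.
Qed.

Lemma l1_plus x y M M' : l1 x M -> l1 y M' -> l1 (fun i => x i + y i) (M + M').
Proof.
  intros H H'. eapply sumle_mono; [|apply sumle_plus; [apply H|apply H']].
  intros i. apply Rabs_triang.
Qed.

Lemma l1_minus x y M M' : l1 x M -> l1 y M' -> l1 (fun i => x i - y i) (M + M').
Proof.
  intros H H'. eapply sumle_mono; [|apply sumle_plus; [apply H|apply H']].
  intros i. unfold Rminus. rewrite <- (Rabs_Ropp (y i)). apply Rabs_triang.
Qed.

Lemma l1_0 M : 0 <= M -> l1 (fun _ => 0) M.
Proof.
  intros H K. replace (rsum _ K) with 0; [easy|].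
  induction K; simpl; [easy|]. rewrite <- IHK, Rabs_R0. ring.
Qed.

(** * Absolutely convergent complex series *)

Definition CSer (u : nat -> C) : C :=
  (Series (fun n => Re (u n)), Series (fun n => Im (u n))).

Definition Csumle (u : nat -> C) (M : R) : Prop := sumle (fun i => Cmod (u i)) M.

Lemma Csumle_ex_series u M : Csumle u M ->
  ex_series (fun n => Re (u n)) /\ ex_series (fun n => Im (u n)).
Proof.
  intros H. assert (E : ex_series (fun n => Cmod (u n))).
  { eapply sumle_ex_series; [|apply H]. intros; apply Cmod_ge_0. }
  split; eapply (ex_series_le (V := R_CompleteNormedModule)); try exact E; intros n.
  - apply re_le_Cmod.
  - apply im_le_Cmod.
Qed.

Lemma CSer_ext u v : (forall n, u n = v n) -> CSer u = CSer v.
Proof. intros H. unfold CSer. f_equal; apply Series_ext; intros; now rewrite H. Qed.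

Lemma CSer_plus u v M M' : Csumle u M -> Csumle v M' ->
  CSer (fun n => u n + v n)%C = (CSer u + CSer v)%C.
Proof.
  intros H H'. destruct (Csumle_ex_series _ _ H), (Csumle_ex_series _ _ H').
  apply Cext; unfold CSer, Re at 1, Im at 1; simpl; now rewrite <- Series_plus.
Qed.

Lemma CSer_scal c u M : Csumle u M -> CSer (fun n => c * u n)%C = (c * CSer u)%C.
Proof.
  intros H. destruct (Csumle_ex_series _ _ H) as [H1 H2].
  apply Cext; unfold CSer; autorewrite with reim; unfold Re at 1, Im at 1; simpl.
  - rewrite <- !Series_scal_l, <- Series_minus.
    + apply Series_ext; intros n. now autorewrite with reim.
    + now apply (ex_series_scal (V := R_NormedModule) (Re c)).
    + now apply (ex_series_scal (V := R_NormedModule) (Im c)).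
  - rewrite <- !Series_scal_l, <- Series_plus.
    + apply Series_ext; intros n. now autorewrite with reim.
    + now apply (ex_series_scal (V := R_NormedModule) (Re c)).
    + now apply (ex_series_scal (V := R_NormedModule) (Im c)).
Qed.

Lemma CSer_opp u : CSer (fun n => - u n)%C = (- CSer u)%C.
Proof. apply Cext; unfold CSer; autorewrite with reim; unfold Re at 1, Im at 1; simpl; now rewrite <- Series_opp. Qed.

Lemma CSer_conj u : Cconj (CSer u) = CSer (fun n => Cconj (u n)).
Proof.
  apply Cext; unfold CSer; autorewrite with reim; unfold Re at 1, Im at 1; simpl; [easy|].
  rewrite <- Series_opp. reflexivity.
Qed.

Lemma Csumle_minus u v M M' : Csumle u M -> Csumle v M' ->
  Csumle (fun n => u n - v n)%C (M + M').
Proof.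
  intros H H'. eapply sumle_mono; [|apply sumle_plus; [apply H|apply H']].
  intros i; apply Cmod_minus_triangle.
Qed.

Lemma Csumle_opp u M : Csumle u M -> Csumle (fun n => - u n)%C M.
Proof. apply sumle_mono. intros i. rewrite Cmod_opp. lra. Qed.

Lemma CSer_minus u v M M' : Csumle u M -> Csumle v M' ->
  CSer (fun n => u n - v n)%C = (CSer u - CSer v)%C.
Proof.
  intros H H'. unfold Cminus. rewrite <- CSer_opp.
  apply (CSer_plus u _ M M'); auto. now apply Csumle_opp.
Qed.

Lemma CSer_finite (u : nat -> C) n : (forall i, (n <= i)%nat -> u i = 0%C) -> CSer u = csum u n.
Proof.
  intros H.
  assert (P : forall v : nat -> R, (forall i, (n <= i)%nat -> v i = 0) -> Series v = rsum v n).
  { intros v Hv. apply is_series_unique.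
    apply (filterlim_ext_loc (fun _ => rsum v n)); [|apply filterlim_const].
    exists n. intros k Hk. rewrite sum_n_rsum. symmetry.
    assert (Q : forall k, (n <= k)%nat -> rsum v k = rsum v n).
    { intros j Hj; induction Hj; [easy|]. simpl. rewrite IHHj, Hv by lia. ring. }
    apply Q; lia. }
  apply Cext; unfold CSer; unfold Re at 1, Im at 1; simpl.
  - rewrite Re_csum. apply P. intros i Hi. now rewrite H.
  - rewrite Im_csum. apply P. intros i Hi. now rewrite H.
Qed.

Lemma Series_Rabs_le (u : nat -> R) M : l1 u M -> Rabs (Series u) <= M.
Proof.
  intros H. eapply Rle_trans; [apply Series_Rabs|apply sumle_Series; auto].
  - eapply sumle_ex_series; [|apply H]. intros; apply Rabs_pos.
  - intros; apply Rabs_pos.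
Qed.

(** Bounding real and imaginary parts separately would lose a factor. The loss is confined to a
    small tail, and the finite part obeys the triangle inequality. *)
Lemma CSer_Cmod u M : Csumle u M -> Cmod (CSer u) <= M.
Proof.
  intros H. apply le_epsilon. intros e He.
  destruct (sumle_tail _ _ (e / 2) (fun i => Cmod_ge_0 (u i)) H) as [K HK]; [lra|].
  assert (HT : Csumle (fun i => cut K i * u i)%C (e / 2)).
  { eapply sumle_mono; [|apply HK]. intros i; simpl.
    rewrite Cmod_RC, Rabs_pos_eq by apply cut_bounds. lra. }
  assert (E : CSer u = (csum u K + CSer (fun i => cut K i * u i)%C)%C).
  { assert (Q : Csumle (fun i => u i - cut K i * u i)%C (M + e / 2)) by exact (Csumle_minus u (fun i => cut K i * u i)%C _ _ H HT).
    rewrite <- (csum_ext (fun i => u i - cut K i * u i)%C u K).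
    - rewrite <- (CSer_finite (fun i => u i - cut K i * u i)%C K).
      + rewrite <- (CSer_plus _ _ _ _ Q HT). apply CSer_ext. intros; ring.
      + intros i Hi. unfold cut. destruct (Nat.ltb_spec i K); [lia|]. ring.
    - intros i Hi. unfold cut. destruct (Nat.ltb_spec i K); [|lia]. ring. }
  rewrite E. eapply Rle_trans; [apply Cmod_triangle|].
  assert (A := csum_Cmod u K). assert (B := H K).
  assert (D : Cmod (CSer (fun i => cut K i * u i)%C) <= Rabs (Re (CSer (fun i => cut K i * u i)%C)) + Rabs (Im (CSer (fun i => cut K i * u i)%C))) by apply Cmod_le_ReIm.
  assert (D1 : Rabs (Re (CSer (fun i => cut K i * u i)%C)) <= e / 2).
  { apply Series_Rabs_le. eapply sumle_mono; [|apply HT]. intros i; apply re_le_Cmod. }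
  assert (D2 : Rabs (Im (CSer (fun i => cut K i * u i)%C)) <= e / 2).
  { apply Series_Rabs_le. eapply sumle_mono; [|apply HT]. intros i; apply im_le_Cmod. }
  lra.
Qed.

Lemma CSer_is_series u M : Csumle u M -> is_series (V := C_R_NormedModule) u (CSer u).
Proof.
  intros H. destruct (Csumle_ex_series _ _ H) as [H1 H2].
  apply Series_correct in H1. apply Series_correct in H2.
  assert (E : forall n, sum_n (G := C_R_NormedModule) u n
      = (sum_n (fun n => Re (u n)) n, sum_n (fun n => Im (u n)) n)).
  { induction n; [rewrite !sum_O; now destruct (u O)|].
    rewrite !sum_Sn, IHn. reflexivity. }
  unfold is_series.
  eapply filterlim_ext; [intros n; symmetry; apply E|].
  intros P [eps HP].
  destruct (H1 (ball (Series (fun n => Re (u n))) eps)) as [N1 HN1]; [now exists eps|].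
  destruct (H2 (ball (Series (fun n => Im (u n))) eps)) as [N2 HN2]; [now exists eps|].
  exists (max N1 N2). intros n Hn. apply HP. split; [apply HN1|apply HN2]; lia.
Qed.

(** * Continuity of complex functions of an angle *)

Lemma continuous_C_eps (f : R -> C) t :
  continuous f t <->
  forall e, 0 < e -> exists d, 0 < d /\ forall u, Rabs (u - t) < d -> Cmod (f u - f t) < e.
Proof.
  split.
  - intros H e He.
    assert (He2 : 0 < e / 2) by lra.
    destruct (H (ball (f t) (mkposreal _ He2))) as [d Hd]; [now exists (mkposreal _ He2)|].
    exists d. split; [apply cond_pos|]. intros u Hu.
    destruct (Hd u Hu) as [H1 H2].
    unfold ball in H1, H2; simpl in H1, H2; unfold AbsRing_ball, abs, minus, plus, opp in H1, H2; simpl in H1, H2.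
    eapply Rle_lt_trans; [apply Cmod_le_ReIm|].
    rewrite Re_minus, Im_minus. unfold Re, Im, Rminus. lra.
  - intros H P [eps HP]. destruct (H eps (cond_pos eps)) as [d [Hd H']].
    exists (mkposreal d Hd). intros u Hu. apply HP.
    assert (A : Cmod (f u - f t) < eps) by (apply H'; exact Hu).
    split.
    + eapply Rle_lt_trans; [apply (re_le_Cmod (f u - f t))|exact A].
    + eapply Rle_lt_trans; [apply (im_le_Cmod (f u - f t))|exact A].
Qed.

Lemma continuous_Re (f : R -> C) t : continuous f t -> continuous (fun u => Re (f u)) t.
Proof. intros H. apply (continuous_comp f fst); [exact H|]. destruct (f t); apply continuous_fst. Qed.

Lemma continuous_Im (f : R -> C) t : continuous f t -> continuous (fun u => Im (f u)) t.
Proof. intros H. apply (continuous_comp f snd); [exact H|]. destruct (f t); apply continuous_snd. Qed.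

Lemma continuous_C_of_R (f : R -> C) t :
  continuous (fun u => Re (f u)) t -> continuous (fun u => Im (f u)) t -> continuous f t.
Proof.
  intros H1 H2 P [eps HP].
  destruct (H1 (ball (Re (f t)) eps)) as [d1 Hd1]; [now exists eps|].
  destruct (H2 (ball (Im (f t)) eps)) as [d2 Hd2]; [now exists eps|].
  exists (mkposreal (Rmin d1 d2) (Rmin_pos _ _ (cond_pos d1) (cond_pos d2))).
  intros u Hu. apply HP. split.
  - apply Hd1. eapply ball_le; [|exact Hu]. apply Rmin_l.
  - apply Hd2. eapply ball_le; [|exact Hu]. apply Rmin_r.
Qed.

Lemma continuous_C_plus (f g : R -> C) t : continuous f t -> continuous g t ->
  continuous (fun u => f u + g u)%C t.
Proof.
  intros. apply continuous_C_of_R.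
  - apply (continuous_plus (fun u => Re (f u)) (fun u => Re (g u))); now apply continuous_Re.
  - apply (continuous_plus (fun u => Im (f u)) (fun u => Im (g u))); now apply continuous_Im.
Qed.

Lemma continuous_C_mult (f g : R -> C) t : continuous f t -> continuous g t ->
  continuous (fun u => f u * g u)%C t.
Proof.
  intros Hf Hg. assert (A := continuous_Re _ _ Hf). assert (B := continuous_Im _ _ Hf).
  assert (A' := continuous_Re _ _ Hg). assert (B' := continuous_Im _ _ Hg).
  apply continuous_C_of_R.
  - apply (continuous_minus (fun u => Re (f u) * Re (g u)) (fun u => Im (f u) * Im (g u)));
      now apply (continuous_mult (K := R_AbsRing)).
  - apply (continuous_plus (fun u => Re (f u) * Im (g u)) (fun u => Im (f u) * Re (g u)));
      now apply (continuous_mult (K := R_AbsRing)).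
Qed.

Lemma continuous_cis t : continuous cis t.
Proof. apply continuous_C_of_R; [apply continuous_cos|apply continuous_sin]. Qed.

Lemma continuous_cis_affine a c t : continuous (fun u => cis (a * u + c)) t.
Proof.
  apply (continuous_comp (fun u => a * u + c) cis); [|apply continuous_cis].
  apply (continuous_plus (fun u => a * u)); [|apply continuous_const].
  apply (continuous_scal_r a (fun u : R => u)). apply continuous_id.
Qed.

(** * Integration of complex functions over a period *)

Definition CInt (f : R -> C) : C :=
  (RInt (fun t => Re (f t)) 0 (2 * PI), RInt (fun t => Im (f t)) 0 (2 * PI)).

Definition ccont (f : R -> C) : Prop := forall t, continuous f t.

Lemma ex_RInt_continuous_all (f : R -> R) a b : (forall t, continuous f t) -> ex_RInt f a b.
Proof. intros H. apply (ex_RInt_continuous (V := R_CompleteNormedModule)). intros; apply H. Qed.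

Lemma ccont_ex_RInt f : ccont f ->
  ex_RInt (fun t => Re (f t)) 0 (2 * PI) /\ ex_RInt (fun t => Im (f t)) 0 (2 * PI).
Proof.
  intros H; split; apply ex_RInt_continuous_all; intros t.
  - now apply continuous_Re.
  - now apply continuous_Im.
Qed.

Lemma is_RInt_CInt (f : R -> C) : ccont f ->
  is_RInt (V := C_R_NormedModule) f 0 (2 * PI) (CInt f).
Proof.
  intros H. destruct (ccont_ex_RInt f H) as [H1 H2].
  apply (is_RInt_fct_extend_pair (U := R_NormedModule) (V := R_NormedModule));
    apply (RInt_correct (V := R_CompleteNormedModule)); assumption.
Qed.

Lemma CInt_ext f g : (forall t, 0 <= t <= 2 * PI -> f t = g t) -> CInt f = CInt g.
Proof.
  intros H. unfold CInt. assert (P := PI_RGT_0).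
  f_equal; apply RInt_ext; intros t; rewrite Rmin_left, Rmax_right by lra;
    intros; now rewrite H by lra.
Qed.

Lemma CInt_plus f g : ccont f -> ccont g -> CInt (fun t => f t + g t)%C = (CInt f + CInt g)%C.
Proof.
  intros Hf Hg. destruct (ccont_ex_RInt f Hf), (ccont_ex_RInt g Hg).
  apply Cext; unfold CInt, Re at 1, Im at 1; simpl.
  - now apply (RInt_plus (V := R_CompleteNormedModule) (fun t => Re (f t)) (fun t => Re (g t))).
  - now apply (RInt_plus (V := R_CompleteNormedModule) (fun t => Im (f t)) (fun t => Im (g t))).
Qed.

Lemma RInt_scal_R (f : R -> R) c a b : ex_RInt f a b -> RInt (fun t => c * f t) a b = c * RInt f a b.
Proof. intros H. exact (RInt_scal (V := R_CompleteNormedModule) f a b c H). Qed.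

Lemma CInt_scal c f : ccont f -> CInt (fun t => c * f t)%C = (c * CInt f)%C.
Proof.
  intros Hf. destruct (ccont_ex_RInt f Hf) as [H1 H2].
  apply Cext; unfold CInt; autorewrite with reim; unfold Re at 1, Im at 1; simpl.
  - rewrite <- !RInt_scal_R by assumption.
    rewrite <- (RInt_minus (V := R_CompleteNormedModule)); [reflexivity| |].
    + apply (ex_RInt_scal (V := R_NormedModule) _ _ _ (Re c) H1).
    + apply (ex_RInt_scal (V := R_NormedModule) _ _ _ (Im c) H2).
  - rewrite <- !RInt_scal_R by assumption.
    rewrite <- (RInt_plus (V := R_CompleteNormedModule)); [reflexivity| |].
    + apply (ex_RInt_scal (V := R_NormedModule) _ _ _ (Re c) H2).
    + apply (ex_RInt_scal (V := R_NormedModule) _ _ _ (Im c) H1).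
Qed.

Lemma ccont_const c : ccont (fun _ => c).
Proof. intros t. apply continuous_const. Qed.

Lemma ccont_scal c f : ccont f -> ccont (fun t => c * f t)%C.
Proof. intros H t. apply continuous_C_mult; [apply continuous_const|apply H]. Qed.

Lemma ccont_minus f g : ccont f -> ccont g -> ccont (fun t => f t - g t)%C.
Proof.
  intros Hf Hg t. apply continuous_C_plus; [apply Hf|].
  apply (continuous_opp (V := C_R_NormedModule) g). apply Hg.
Qed.

Lemma CInt_minus f g : ccont f -> ccont g -> CInt (fun t => f t - g t)%C = (CInt f - CInt g)%C.
Proof.
  intros Hf Hg.
  replace (CInt f - CInt g)%C with (CInt f + (- (1)) * CInt g)%C by ring.
  rewrite <- CInt_scal by assumption.
  rewrite <- CInt_plus; [|assumption|now apply ccont_scal].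
  apply CInt_ext; intros; ring.
Qed.

Lemma CInt_const c : CInt (fun _ => c) = (2 * PI * c)%C.
Proof.
  apply Cext; unfold CInt; autorewrite with reim; unfold Re at 1, Im at 1; simpl;
    rewrite RInt_const; unfold scal; simpl; unfold mult; simpl; ring.
Qed.

Lemma CInt_Cmod f M : ccont f -> (forall t, Cmod (f t) <= M) -> Cmod (CInt f) <= 2 * PI * M.
Proof.
  intros Hf HM. assert (P := PI_RGT_0).
  replace (2 * PI * M) with (scal (2 * PI - 0) M) by (unfold scal; simpl; unfold mult; simpl; ring).
  rewrite Cmod_norm.
  apply (norm_RInt_le (V := C_R_NormedModule) f (fun _ => M) 0 (2 * PI)).
  - lra.
  - intros t _. rewrite <- Cmod_norm. apply HM.
  - now apply is_RInt_CInt.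
  - apply (is_RInt_const (V := R_NormedModule)).
Qed.

Lemma is_RInt_cis_integral a c : a <> 0 -> cis (a * (2 * PI)) = 1%C ->
  CInt (fun t => cis (a * t + c)) = 0%C.
Proof.
  intros Ha E.
  assert (H : forall t, is_derive (fun t => sin (a * t + c) / a) t (cos (a * t + c))).
  { intros t. auto_derive; [easy|]. field; lra. }
  assert (H' : forall t, is_derive (fun t => - cos (a * t + c) / a) t (sin (a * t + c))).
  { intros t. auto_derive; [easy|]. field; lra. }
  assert (E2 : cis (a * (2 * PI) + c) = cis c) by (rewrite cis_plus, E; ring).
  injection E2 as Ec Es.
  apply Cext; unfold CInt, Re at 1, Im at 1; simpl; unfold cis, Re, Im; simpl; apply is_RInt_unique.
  - replace 0 with (minus (sin (a * (2 * PI) + c) / a) (sin (a * 0 + c) / a)) at 2.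
    + apply (is_RInt_derive (V := R_CompleteNormedModule) (fun t => sin (a * t + c) / a)).
      * intros; apply H.
      * intros t _. apply (continuous_Re (fun t => cis (a * t + c))), continuous_cis_affine.
    + rewrite Es, Rmult_0_r, Rplus_0_l. unfold minus, plus, opp; simpl. ring.
  - replace 0 with (minus (- cos (a * (2 * PI) + c) / a) (- cos (a * 0 + c) / a)) at 2.
    + apply (is_RInt_derive (V := R_CompleteNormedModule) (fun t => - cos (a * t + c) / a)).
      * intros; apply H'.
      * intros t _. apply (continuous_Im (fun t => cis (a * t + c))), continuous_cis_affine.
    + rewrite Ec, Rmult_0_r, Rplus_0_l. unfold minus, plus, opp; simpl. ring.
Qed.

(** * Weighted absolutely convergent Fourier series in two angles *)

Definition mono (p q : Z) (s t : R) : C := cis (IZR p * s + IZR q * t).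

Definition term : Type := (R * (Z * Z))%type.

Fixpoint trig_sum (l : list term) (s t : R) : C :=
  match l with
  | nil => 0%C
  | (c, (p, q)) :: l' => (c * mono p q s t + trig_sum l' s t)%C
  end.

Lemma mono_mult p q p' q' s t :
  (mono p q s t * mono p' q' s t)%C = mono (p + p') (q + q') s t.
Proof. unfold mono. rewrite <- cis_plus, !plus_IZR. f_equal. ring. Qed.

Lemma mono_conj p q s t : Cconj (mono p q s t) = mono (- p) (- q) s t.
Proof. unfold mono. rewrite <- cis_opp, !opp_IZR. f_equal. ring. Qed.

Lemma mono_00 s t : mono 0 0 s t = 1%C.
Proof. unfold mono. rewrite !Rmult_0_l, Rplus_0_l. apply cis_0. Qed.

Lemma Cmod_mono p q s t : Cmod (mono p q s t) = 1.
Proof. apply Cmod_cis. Qed.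

Lemma trig_sum_app l l' s t : trig_sum (l ++ l') s t = (trig_sum l s t + trig_sum l' s t)%C.
Proof. induction l as [|[c [p q]] l IH]; simpl; [ring|rewrite IH; ring]. Qed.

Lemma ccont_mono_t p q s : ccont (fun t => mono p q s t).
Proof.
  intros t. apply (continuous_ext (fun t => cis (IZR q * t + IZR p * s))).
  - intros u. unfold mono. f_equal. ring.
  - apply continuous_cis_affine.
Qed.

Lemma ccont_mono_s p q t : ccont (fun s => mono p q s t).
Proof. intros s. unfold mono. apply continuous_cis_affine. Qed.

Lemma ccont_trig_sum_t l s : ccont (fun t => trig_sum l s t).
Proof.
  induction l as [|[c [p q]] l IH]; intros t; simpl; [apply continuous_const|].
  apply continuous_C_plus; [|apply IH]. apply ccont_scal, ccont_mono_t.
Qed.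

Lemma ccont_trig_sum_s l t : ccont (fun s => trig_sum l s t).
Proof.
  induction l as [|[c [p q]] l IH]; intros s; simpl; [apply continuous_const|].
  apply continuous_C_plus; [|apply IH]. apply (ccont_scal c (fun s => mono p q s t)), ccont_mono_s.
Qed.

(** The average over the second angle does not depend on [t]; the argument is kept so that the
    result is again a function of two angles. *)
Definition mean (F : R -> R -> C) (s t : R) : C := (/ (2 * PI) * CInt (F s))%C.

Lemma RtoC_2PI_neq_0 : (2 * PI)%C <> 0%C.
Proof.
  rewrite <- RtoC_mult. intros H. apply RtoC_inj in H. assert (P := PI_RGT_0). lra.
Qed.

Lemma mean_mono p q s t :
  mean (mono p q) s t = if Z.eqb q 0 then mono p 0 s t else 0%C.
Proof.
  unfold mean. assert (P := RtoC_2PI_neq_0).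
  destruct (Z.eqb_spec q 0) as [->|Hq].
  - rewrite (CInt_ext _ (fun _ => mono p 0 s t)).
    + rewrite CInt_const. field. intros E; apply P; rewrite E; ring.
    + intros u _. unfold mono. f_equal. ring.
  - rewrite (CInt_ext _ (fun t => cis (IZR q * t + IZR p * s))).
    + rewrite is_RInt_cis_integral; [ring| |apply cis_IZR_2PI].
      intros E. apply eq_IZR in E. contradiction.
    + intros u _. unfold mono. f_equal. ring.
Qed.

Section Wiener.
Context (m : nat) (kap : posreal).

(** The constant 1 makes the weight submultiplicative, see [wt_mult], and a small [kap] keeps the
    weight of a monomial of first order close to 1. *)
Definition wt (p q : Z) : R := 1 + kap * (IZR (Z.abs p) + IZR (Z.abs q)).

Fixpoint trig_norm (l : list term) : R :=
  match l with
  | nil => 0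
  | (c, (p, q)) :: l' => Rabs c * wt p q + trig_norm l'
  end.

Definition deg (sg d : Z) (l : list term) : Prop :=
  List.Forall (fun c : term => exists j, (fst (snd c) + sg * snd (snd c) = d + Z.of_nat m * j)%Z) l.

(* [W sg d F M]: [F] lies in the closed ball of radius [M] of the weighted
   Wiener algebra, with real coefficients and frequencies [p + sg q = d] mod [m].
   Approximation by trigonometric polynomials replaces double series. Rotating
   [w] by an [m]-th root of unity rotates [tau] in the same sense in the first integral
   of the boundary equation ([sg = 1]) and in the opposite sense in the second ([sg = -1]). *)
Definition W (sg d : Z) (F : R -> R -> C) (M : R) : Prop :=
  forall eps, 0 < eps -> exists l, deg sg d l /\ trig_norm l <= M /\
    forall s t, Cmod (F s t - trig_sum l s t) <= eps.

Lemma wt_ge_1 p q : 1 <= wt p q.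
Proof.
  unfold wt. assert (Hk := cond_pos kap). assert (0 <= IZR (Z.abs p)) by (apply IZR_le; lia).
  assert (0 <= IZR (Z.abs q)) by (apply IZR_le; lia).
  assert (0 <= kap * (IZR (Z.abs p) + IZR (Z.abs q))) by (apply Rmult_le_pos; lra). lra.
Qed.

Lemma wt_mult p q p' q' : wt (p + p') (q + q') <= wt p q * wt p' q'.
Proof.
  unfold wt. assert (Hk := cond_pos kap).
  assert (A : IZR (Z.abs (p + p')) <= IZR (Z.abs p) + IZR (Z.abs p')) by (rewrite <- plus_IZR; apply IZR_le; lia).
  assert (B : IZR (Z.abs (q + q')) <= IZR (Z.abs q) + IZR (Z.abs q')) by (rewrite <- plus_IZR; apply IZR_le; lia).
  assert (0 <= IZR (Z.abs p)) by (apply IZR_le; lia).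
  assert (0 <= IZR (Z.abs q)) by (apply IZR_le; lia).
  assert (0 <= IZR (Z.abs p')) by (apply IZR_le; lia).
  assert (0 <= IZR (Z.abs q')) by (apply IZR_le; lia).
  set (u := IZR (Z.abs p) + IZR (Z.abs q)) in *.
  set (v := IZR (Z.abs p') + IZR (Z.abs q')) in *.
  assert (0 <= u) by (unfold u; lra). assert (0 <= v) by (unfold v; lra).
  assert (C1 : IZR (Z.abs (p + p')) + IZR (Z.abs (q + q')) <= u + v) by (unfold u, v; lra).
  assert (0 <= (kap * u) * (kap * v)) by (apply Rmult_le_pos; apply Rmult_le_pos; lra).
  assert (kap * (IZR (Z.abs (p + p')) + IZR (Z.abs (q + q'))) <= kap * (u + v)) by (apply Rmult_le_compat_l; lra).
  nra.
Qed.

Lemma trig_norm_ge_0 l : 0 <= trig_norm l.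
Proof.
  induction l as [|[c [p q]] l IH]; simpl; [lra|].
  assert (A := wt_ge_1 p q). assert (0 <= Rabs c * wt p q) by (apply Rmult_le_pos; [apply Rabs_pos|lra]). lra.
Qed.

Lemma trig_sum_Cmod l s t : Cmod (trig_sum l s t) <= trig_norm l.
Proof.
  induction l as [|[c [p q]] l IH]; simpl; [rewrite Cmod_0; lra|].
  eapply Rle_trans; [apply Cmod_triangle|].
  rewrite Cmod_RC, Cmod_mono. assert (A := wt_ge_1 p q). assert (B := Rabs_pos c). nra.
Qed.

Lemma trig_norm_app l l' : trig_norm (l ++ l') = trig_norm l + trig_norm l'.
Proof. induction l as [|[c [p q]] l IH]; simpl; [lra|rewrite IH; lra]. Qed.

Lemma W_ext sg d F F' M : (forall s t, F s t = F' s t) -> W sg d F M -> W sg d F' M.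
Proof.
  intros E H eps He. destruct (H eps He) as [l [H1 [H2 H3]]].
  exists l. repeat split; auto. intros s t. rewrite <- E. apply H3.
Qed.

Lemma W_weaken sg d F M M' : W sg d F M -> M <= M' -> W sg d F M'.
Proof.
  intros H HM eps He. destruct (H eps He) as [l [H1 [H2 H3]]].
  exists l. repeat split; auto. lra.
Qed.

Lemma W_ge_0 sg d F M : W sg d F M -> 0 <= M.
Proof. intros H. destruct (H 1 Rlt_0_1) as [l [_ [H2 _]]]. assert (A := trig_norm_ge_0 l). lra. Qed.

Lemma W_Cmod sg d F M s t : W sg d F M -> Cmod (F s t) <= M.
Proof.
  intros H. apply le_epsilon. intros e He. destruct (H e He) as [l [_ [H2 H3]]].
  assert (A := H3 s t). assert (B := trig_sum_Cmod l s t).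
  assert (D := Cmod_minus_rev (F s t) (trig_sum l s t)). lra.
Qed.

(** A ball of [W] is closed under uniform limits because membership only asks for uniform
    approximation. This is how infinite sums and Neumann series enter. *)
Lemma W_lim sg d F M :
  (forall eps, 0 < eps -> exists F', W sg d F' M /\ forall s t, Cmod (F s t - F' s t) <= eps) ->
  W sg d F M.
Proof.
  intros H eps He. destruct (H (eps / 2)) as [F' [H1 H2]]; [lra|].
  destruct (H1 (eps / 2)) as [l [D [N E]]]; [lra|].
  exists l. repeat split; auto. intros s t.
  eapply Rle_trans; [apply (Cmod_dist_triangle _ (F' s t))|].
  assert (A := H2 s t). assert (B := E s t). lra.
Qed.

Lemma W_plus sg d F G M M' : W sg d F M -> W sg d G M' ->
  W sg d (fun s t => F s t + G s t)%C (M + M').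
Proof.
  intros HF HG eps He.
  destruct (HF (eps / 2)) as [l [D [N E]]]; [lra|].
  destruct (HG (eps / 2)) as [l' [D' [N' E']]]; [lra|].
  exists (l ++ l'). repeat split.
  - now apply List.Forall_app.
  - rewrite trig_norm_app. lra.
  - intros s t. rewrite trig_sum_app.
    replace (F s t + G s t - (trig_sum l s t + trig_sum l' s t))%C
      with ((F s t - trig_sum l s t) + (G s t - trig_sum l' s t))%C by ring.
    eapply Rle_trans; [apply Cmod_triangle|].
    assert (A := E s t). assert (B := E' s t). lra.
Qed.

Definition scale_term (c : R) (p q : Z) (x : term) : term :=
  (c * fst x, ((p + fst (snd x))%Z, (q + snd (snd x))%Z)).

Lemma trig_sum_scale c p q l s t :
  trig_sum (List.map (scale_term c p q) l) s t = (c * mono p q s t * trig_sum l s t)%C.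
Proof.
  induction l as [|[c' [p' q']] l IH]; simpl; [ring|].
  rewrite IH, <- mono_mult, RtoC_mult. ring.
Qed.

Lemma trig_norm_scale c p q l : trig_norm (List.map (scale_term c p q) l) <= Rabs c * wt p q * trig_norm l.
Proof.
  induction l as [|[c' [p' q']] l IH]; simpl; [lra|].
  rewrite Rabs_mult. assert (A := wt_mult p q p' q').
  assert (B : 0 <= Rabs c * Rabs c') by (apply Rmult_le_pos; apply Rabs_pos).
  assert (Rabs c * Rabs c' * wt (p + p') (q + q') <= Rabs c * Rabs c' * (wt p q * wt p' q'))
    by (apply Rmult_le_compat_l; lra).
  nra.
Qed.

Lemma deg_scale sg d e c p q l j : (p + sg * q = e + Z.of_nat m * j)%Z -> deg sg d l ->
  deg sg (e + d) (List.map (scale_term c p q) l).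
Proof.
  intros E H. unfold deg. apply List.Forall_map. revert H. apply List.Forall_impl.
  intros [c' [p' q']] [j' Hj]; simpl in *. exists (j + j')%Z.
  transitivity ((p + sg * q) + (p' + sg * q'))%Z; [ring|]. rewrite E, Hj. ring.
Qed.

Fixpoint mult_terms (l l' : list term) : list term :=
  match l with
  | nil => nil
  | (c, (p, q)) :: k => List.map (scale_term c p q) l' ++ mult_terms k l'
  end.

Lemma trig_sum_mult l l' s t : trig_sum (mult_terms l l') s t = (trig_sum l s t * trig_sum l' s t)%C.
Proof.
  induction l as [|[c [p q]] l IH]; simpl; [ring|].
  rewrite trig_sum_app, trig_sum_scale, IH. ring.
Qed.

Lemma trig_norm_mult l l' : trig_norm (mult_terms l l') <= trig_norm l * trig_norm l'.
Proof.
  induction l as [|[c [p q]] l IH]; simpl; [lra|].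
  rewrite trig_norm_app. assert (A := trig_norm_scale c p q l'). lra.
Qed.

Lemma deg_mult sg d e l l' : deg sg d l -> deg sg e l' -> deg sg (d + e) (mult_terms l l').
Proof.
  intros H H'. induction H as [|[c [p q]] l [j Hj] H IH]; simpl; [constructor|].
  apply List.Forall_app. split; [|exact IH]. eapply deg_scale; eauto.
Qed.

Lemma W_mult sg d e F G M M' : W sg d F M -> W sg e G M' ->
  W sg (d + e) (fun s t => F s t * G s t)%C (M * M').
Proof.
  intros HF HG.
  assert (P := W_ge_0 _ _ _ _ HF). assert (P' := W_ge_0 _ _ _ _ HG).
  intros eps He.
  set (h := eps / (M + M' + 1)).
  assert (Hh : 0 < h) by (apply Rdiv_lt_0_compat; lra).
  destruct (HF h Hh) as [l [D [N E]]].
  destruct (HG h Hh) as [l' [D' [N' E']]].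
  exists (mult_terms l l'). repeat split.
  - now apply deg_mult.
  - eapply Rle_trans; [apply trig_norm_mult|].
    apply Rmult_le_compat; auto using trig_norm_ge_0.
  - intros s t. rewrite trig_sum_mult.
    replace (F s t * G s t - trig_sum l s t * trig_sum l' s t)%C
      with ((F s t - trig_sum l s t) * G s t + trig_sum l s t * (G s t - trig_sum l' s t))%C by ring.
    eapply Rle_trans; [apply Cmod_triangle|]. rewrite !Cmod_mult.
    assert (A1 := E s t). assert (A2 := E' s t).
    assert (A3 := W_Cmod _ _ _ _ s t HG). assert (A4 := trig_sum_Cmod l s t).
    assert (B1 := Cmod_ge_0 (F s t - trig_sum l s t)). assert (B2 := Cmod_ge_0 (G s t - trig_sum l' s t)).
    assert (B3 := Cmod_ge_0 (G s t)). assert (B4 := Cmod_ge_0 (trig_sum l s t)).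
    assert (C1 : Cmod (F s t - trig_sum l s t) * Cmod (G s t) <= h * M') by (apply Rmult_le_compat; lra).
    assert (C2 : Cmod (trig_sum l s t) * Cmod (G s t - trig_sum l' s t) <= M * h) by (apply Rmult_le_compat; lra).
    assert (C3 : h * (M + M' + 1) = eps) by (unfold h; field; lra). nra.
Qed.

Lemma W_mono sg d p q c j M : (p + sg * q = d + Z.of_nat m * j)%Z ->
  Rabs c * wt p q <= M -> W sg d (fun s t => c * mono p q s t)%C M.
Proof.
  intros E HM eps He. exists ((c, (p, q)) :: nil). repeat split.
  - constructor; [|constructor]. now exists j.
  - simpl. lra.
  - intros s t. simpl. match goal with |- Cmod ?z <= _ => replace z with (RtoC 0) by ring end.
    rewrite Cmod_0. lra.
Qed.

Lemma W_const sg c : W sg 0 (fun _ _ => RtoC c) (Rabs c).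
Proof.
  apply (W_ext sg 0 (fun s t => c * mono 0 0 s t)%C).
  - intros; rewrite mono_00; ring.
  - apply (W_mono sg 0 0 0 c 0); [ring|]. unfold wt. simpl. lra.
Qed.

Lemma W_0 sg d M : 0 <= M -> W sg d (fun _ _ => 0%C) M.
Proof.
  intros HM eps He. exists nil. repeat split; simpl; auto.
  - constructor.
  - intros. replace (0 - 0)%C with (RtoC 0) by ring. rewrite Cmod_0. lra.
Qed.

Lemma W_scal sg d c F M : W sg d F M -> W sg d (fun s t => RtoC c * F s t)%C (Rabs c * M).
Proof.
  intros H. apply (W_mult sg 0 d (fun _ _ => RtoC c)); [apply W_const|exact H].
Qed.

Lemma W_opp sg d F M : W sg d F M -> W sg d (fun s t => - F s t)%C M.
Proof.
  intros H. apply (W_ext sg d (fun s t => (- (1))%R * F s t)%C).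
  - intros. rewrite RtoC_opp. ring.
  - eapply W_weaken; [apply W_scal, H|]. rewrite Rabs_Ropp, Rabs_R1. lra.
Qed.

Definition conj_term (x : term) : term := (fst x, (- fst (snd x), - snd (snd x)))%Z.

Lemma W_conj sg d F M : W sg d F M -> W sg (- d) (fun s t => Cconj (F s t)) M.
Proof.
  intros H eps He. destruct (H eps He) as [l [D [N E]]].
  exists (List.map conj_term l).
  assert (Ev : forall s t, trig_sum (List.map conj_term l) s t = Cconj (trig_sum l s t)).
  { intros s t. clear. induction l as [|[c [p q]] l IH]; simpl.
    - apply Cext; simpl; ring.
    - rewrite IH, Cplus_conj, Cmult_conj, mono_conj. f_equal. f_equal. apply Cext; simpl; ring. }
  repeat split.
  - unfold deg. apply List.Forall_map. revert D. apply List.Forall_impl.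
    intros [c [p q]] [j Hj]; simpl in *. exists (- j)%Z.
    transitivity (- (p + sg * q))%Z; [ring|]. rewrite Hj. ring.
  - replace (trig_norm (List.map conj_term l)) with (trig_norm l); [exact N|].
    clear. induction l as [|[c [p q]] l IH]; simpl; [easy|]. rewrite IH. unfold wt. now rewrite !Z.abs_opp.
  - intros s t. rewrite Ev, <- Cminus_conj, Cmod_conj. apply E.
Qed.

Lemma W_csum sg d (F : nat -> R -> R -> C) (M : nat -> R) n :
  (forall i, (i < n)%nat -> W sg d (F i) (M i)) ->
  W sg d (fun s t => csum (fun i => F i s t) n) (rsum M n).
Proof.
  induction n; intros H; simpl; [apply W_0; lra|].
  apply (W_plus sg d (fun s t => csum (fun i => F i s t) n)); auto.
Qed.

(** The partial sums stay in the ball of radius [C0 * M], and the tails are uniformly small since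
    [x] is summable. *)
Lemma W_CSer sg d (B : nat -> R -> R -> C) C0 x M :
  (forall n, W sg d (B n) C0) -> l1 x M ->
  W sg d (fun s t => CSer (fun n => x n * B n s t)%C) (C0 * M).
Proof.
  intros HB Hx. assert (HC := W_ge_0 _ _ _ _ (HB O)).
  assert (Hs : forall y M', l1 y M' -> forall s t, Csumle (fun n => y n * B n s t)%C (C0 * M')).
  { intros y M' Hy s t. eapply sumle_mono; [|apply sumle_scal; [exact HC|exact Hy]].
    intros i. simpl. rewrite Cmod_RC. assert (A := W_Cmod _ _ _ _ s t (HB i)).
    assert (D := Rabs_pos (y i)). nra. }
  apply W_lim. intros eps He.
  destruct (sumle_tail _ _ (eps / (C0 + 1)) (fun i => Rabs_pos (x i)) Hx) as [K HK].
  { apply Rdiv_lt_0_compat; lra. }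
  assert (HT : l1 (fun i => cut K i * x i) (eps / (C0 + 1))).
  { eapply sumle_mono; [|apply HK]. intros i; simpl.
    rewrite Rabs_mult, (Rabs_pos_eq (cut K i)) by apply cut_bounds. lra. }
  exists (fun s t => csum (fun n => x n * B n s t)%C K). split.
  - eapply W_weaken; [apply (W_csum sg d (fun n s t => x n * B n s t)%C (fun n => Rabs (x n) * C0)); intros; apply W_scal, HB|].
    rewrite (rsum_ext _ (fun i => C0 * Rabs (x i))) by (intros; ring).
    rewrite rsum_scal. apply Rmult_le_compat_l; auto.
  - intros s t.
    replace (CSer (fun n => x n * B n s t)%C - csum (fun n => x n * B n s t)%C K)%C
      with (CSer (fun n => (cut K n * x n)%R * B n s t)%C).
    + eapply Rle_trans; [apply CSer_Cmod, (Hs _ _ HT)|].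
      apply Rle_trans with ((C0 + 1) * (eps / (C0 + 1))); [|right; field; lra].
      apply Rmult_le_compat_r; [|lra]. left; apply Rdiv_lt_0_compat; lra.
    + rewrite <- (csum_ext (fun n => x n * B n s t - (cut K n * x n)%R * B n s t)%C).
      * rewrite <- CSer_finite.
        -- rewrite (CSer_minus _ _ _ _ (Hs _ _ Hx s t) (Hs _ _ HT s t)). ring.
        -- intros i Hi. unfold cut. destruct (Nat.ltb_spec i K); [lia|]. rewrite Rmult_1_l. ring.
      * intros i Hi. unfold cut. destruct (Nat.ltb_spec i K); [|lia]. rewrite Rmult_0_l. ring.
Qed.

Lemma Cinv_one_minus_neq (K : C) q : Cmod K <= q -> q < 1 -> (1 - K)%C <> 0%C.
Proof.
  intros H Hq E. assert (A := Cmod_minus_rev 1 K). rewrite E, Cmod_1, Cmod_0 in A. lra.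
Qed.

Lemma geom_csum (K : C) n : ((1 - K) * csum (fun i => K ^ i)%C n = 1 - K ^ n)%C.
Proof. induction n; simpl; [ring|]. rewrite Cmult_plus_distr_l, IHn. ring. Qed.

Lemma geom_rsum q n : 0 <= q < 1 -> rsum (fun i => q ^ i) n <= / (1 - q).
Proof.
  intros Hq.
  assert (E : (1 - q) * rsum (fun i => q ^ i) n = 1 - q ^ n) by (induction n; simpl; [ring|]; rewrite Rmult_plus_distr_l, IHn; ring).
  apply (Rmult_le_reg_l (1 - q)); [lra|]. rewrite E, Rinv_r by lra.
  assert (A := pow_le q n). lra.
Qed.

Lemma pow_small q eps : 0 <= q < 1 -> 0 < eps -> exists n, q ^ n <= eps.
Proof.
  intros Hq He. destruct (pow_lt_1_zero q) with (y := eps) as [N HN]; auto.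
  - rewrite Rabs_pos_eq; lra.
  - exists N. left. eapply Rle_lt_trans; [apply Rle_abs|apply HN; lia].
Qed.

Lemma W_pow sg F M n : W sg 0 F M -> W sg 0 (fun s t => F s t ^ n)%C (M ^ n).
Proof.
  intros H. induction n.
  - eapply W_weaken; [apply (W_const sg 1)|]. rewrite Rabs_R1. simpl. lra.
  - apply (W_mult sg 0 0 F (fun s t => F s t ^ n)%C); auto.
Qed.

Lemma W_inv sg K q : W sg 0 K q -> q < 1 -> W sg 0 (fun s t => / (1 - K s t))%C (/ (1 - q)).
Proof.
  intros H Hq. assert (P := W_ge_0 _ _ _ _ H).
  apply W_lim. intros eps He.
  (* The error of the partial geometric sum is [K^n / (1 - K)], of modulus at most
     [q^n / (1 - q)]. *)
  destruct (pow_small q (eps * (1 - q))) as [n Hn]; [lra|apply Rmult_lt_0_compat; lra|].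
  exists (fun s t => csum (fun i => K s t ^ i)%C n). split.
  - eapply W_weaken; [apply (W_csum sg 0 (fun i s t => K s t ^ i)%C (fun i => q ^ i)); intros; now apply W_pow|].
    now apply geom_rsum.
  - intros s t. assert (HK := W_Cmod _ _ _ _ s t H).
    assert (NZ := Cinv_one_minus_neq _ _ HK Hq).
    replace (/ (1 - K s t) - csum (fun i => K s t ^ i) n)%C with (K s t ^ n / (1 - K s t))%C.
    + rewrite Cmod_div, Cmod_pow by auto.
      assert (A : 1 - q <= Cmod (1 - K s t)).
      { assert (A := Cmod_minus_rev 1 (K s t)). rewrite Cmod_1 in A. lra. }
      assert (B : Cmod (K s t) ^ n <= q ^ n) by (apply pow_incr; split; [apply Cmod_ge_0|auto]).
      apply (Rmult_le_reg_r (Cmod (1 - K s t))); [lra|].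
      unfold Rdiv. rewrite Rmult_assoc, Rinv_l by lra. nra.
    + assert (G := geom_csum (K s t) n).
      replace (csum (fun i => K s t ^ i)%C n) with ((1 - K s t ^ n) / (1 - K s t))%C.
      * field; auto.
      * rewrite <- G. field; auto.
Qed.

Lemma ccont_unif_lim (f : R -> C) :
  (forall eps, 0 < eps -> exists g, ccont g /\ forall t, Cmod (f t - g t) <= eps) -> ccont f.
Proof.
  intros H t. apply continuous_C_eps. intros e He.
  destruct (H (e / 4)) as [g [Hg E]]; [lra|].
  destruct (proj1 (continuous_C_eps g t) (Hg t) (e / 4)) as [d [Hd Hd']]; [lra|].
  exists d. split; auto. intros u Hu.
  eapply Rle_lt_trans; [apply (Cmod_dist_triangle _ (g u))|].
  assert (A := Cmod_dist_triangle (g u) (g t) (f t)).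
  rewrite (Cmod_minus_sym (g t)) in A.
  assert (A1 := E u). assert (A2 := E t). assert (A3 := Hd' u Hu). lra.
Qed.

Lemma W_ccont_t sg d F M s : W sg d F M -> ccont (F s).
Proof.
  intros H. apply ccont_unif_lim. intros eps He. destruct (H eps He) as [l [_ [_ E]]].
  exists (fun t => trig_sum l s t). split; [apply ccont_trig_sum_t|]. intros; apply E.
Qed.

Lemma W_ccont_s sg d F M t : W sg d F M -> ccont (fun s => F s t).
Proof.
  intros H. apply ccont_unif_lim. intros eps He. destruct (H eps He) as [l [_ [_ E]]].
  exists (fun s => trig_sum l s t). split; [apply ccont_trig_sum_s|]. intros; apply E.
Qed.

Lemma mean_bound F M s t : ccont (F s) -> (forall u, Cmod (F s u) <= M) -> Cmod (mean F s t) <= M.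
Proof.
  intros Hc HM. unfold mean. assert (P := PI_RGT_0).
  assert (A := CInt_Cmod (F s) M Hc HM).
  rewrite <- RtoC_mult, <- RtoC_inv, Cmod_RC.
  rewrite Rabs_pos_eq by (left; apply Rinv_0_lt_compat; lra).
  apply (Rmult_le_reg_l (2 * PI)); [lra|].
  rewrite <- Rmult_assoc, Rinv_r by lra. lra. lra.
Qed.

Lemma mean_minus F G s t : ccont (F s) -> ccont (G s) ->
  mean (fun s t => F s t - G s t)%C s t = (mean F s t - mean G s t)%C.
Proof. intros. unfold mean. rewrite (CInt_minus (F s) (G s)) by assumption. ring. Qed.

Lemma mean_plus F G s t : ccont (F s) -> ccont (G s) ->
  mean (fun s t => F s t + G s t)%C s t = (mean F s t + mean G s t)%C.
Proof. intros. unfold mean. rewrite (CInt_plus (F s) (G s)) by assumption. ring. Qed.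

(* The scalar may depend on the outer angle [s]. *)
Lemma mean_scal c F s t : ccont (F s) ->
  mean (fun s t => c s * F s t)%C s t = (c s * mean F s t)%C.
Proof. intros. unfold mean. rewrite (CInt_scal (c s) (F s)) by assumption. ring. Qed.

Lemma mean_ext F G s t : (forall u, F s u = G s u) -> mean F s t = mean G s t.
Proof. intros H. unfold mean. f_equal. apply CInt_ext. intros; apply H. Qed.

Lemma mean_trig_sum l s t : mean (trig_sum l) s t = trig_sum (List.filter (fun c : term => Z.eqb (snd (snd c)) 0) l) s t.
Proof.
  induction l as [|[c [p q]] l IH].
  - simpl. unfold mean. simpl. rewrite CInt_const. ring.
  - change (trig_sum ((c, (p, q)) :: l)) with (fun s t => c * mono p q s t + trig_sum l s t)%C.
    rewrite (mean_plus (fun s t => c * mono p q s t)%C (trig_sum l)); [|apply ccont_scal, ccont_mono_t|apply ccont_trig_sum_t].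
    rewrite (mean_scal (fun _ => RtoC c) (mono p q)) by apply ccont_mono_t.
    rewrite mean_mono, IH. simpl.
    destruct (Z.eqb_spec q 0) as [->|]; simpl; ring.
Qed.

(** Only monomials with [q = 0] survive, and for them the degree does not involve [sg]. So the two
    integrals, built with opposite values of [sg], can be combined after averaging. *)
Lemma W_mean sg sg' d F M : W sg d F M -> W sg' d (mean F) M.
Proof.
  intros H eps He. destruct (H eps He) as [l [D [N E]]].
  exists (List.filter (fun c : term => Z.eqb (snd (snd c)) 0) l). repeat split.
  - unfold deg in *. rewrite List.Forall_forall in *. intros [c [p q]] Hx.
    apply List.filter_In in Hx. destruct Hx as [Hx Hq]. simpl in Hq. apply Z.eqb_eq in Hq. subst q.
    destruct (D _ Hx) as [j Hj]. exists j. simpl in *. lia.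
  - eapply Rle_trans; [|exact N]. clear. induction l as [|[c [p q]] l IH]; simpl; [lra|].
    assert (A := wt_ge_1 p q). assert (B := Rabs_pos c).
    destruct (Z.eqb q 0); simpl; nra.
  - intros s t. rewrite <- mean_trig_sum, <- mean_minus; [|eapply W_ccont_t; eauto|apply ccont_trig_sum_t].
    apply (mean_bound (fun s t => F s t - trig_sum l s t)%C).
    + apply ccont_minus; [eapply W_ccont_t; eauto|apply ccont_trig_sum_t].
    + intros; apply E.
Qed.

End Wiener.

(** * Strictly differentiable maps from l1 to the Wiener algebra *)

Section Differentiation.
Context (m : nat) (kap : posreal).
Local Notation W := (W m kap).

Lemma W_mult_deg sg d e d' F G M M' : (d + e = d')%Z -> W sg d F M -> W sg e G M' ->
  W sg d' (fun s t => F s t * G s t)%C (M * M').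
Proof. intros <-. apply W_mult. Qed.

Definition vmap : Type := (nat -> R) -> R -> R -> C.

Definition zeroseq : nat -> R := fun _ => 0.

(* Strict differentiability at the origin of [l1], with a quadratic modulus. *)
Definition SD (sg d : Z) (G G1 : vmap) : Prop :=
  exists r0 K, 0 < r0 /\ 0 <= K /\
    (forall x, l1 x r0 -> W sg d (G x) K) /\
    (forall x M, l1 x M -> W sg d (G1 x) (K * M)) /\
    (forall x y c M M', l1 x M -> l1 y M' -> forall s t,
       G1 (fun i => x i + c * y i) s t = (G1 x s t + c * G1 y s t)%C) /\
    (forall r x x' M, r <= r0 -> l1 x r -> l1 x' r -> l1 (fun i => x i - x' i) M ->
       W sg d (fun s t => G x s t - G x' s t - G1 (fun i => x i - x' i)%R s t)%C (K * r * M)).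

Definition bounded_linear (sg d : Z) (L : vmap) : Prop :=
  exists K, (forall x M, l1 x M -> W sg d (L x) (K * M)) /\
    (forall x y c M M', l1 x M -> l1 y M' -> forall s t,
       L (fun i => x i + c * y i) s t = (L x s t + c * L y s t)%C).

Lemma zeroseq_l1 M : 0 <= M -> l1 zeroseq M.
Proof. apply l1_0. Qed.

Lemma l1_ge_0 x M : l1 x M -> 0 <= M.
Proof. apply sumle_ge_0. Qed.

Lemma l1_minus_zeroseq x M : l1 x M -> l1 (fun i => x i - zeroseq i) M.
Proof. apply l1_ext. intros i. unfold zeroseq. ring. Qed.

Lemma bounded_linear_minus sg d L x y M M' s t : bounded_linear sg d L ->
  l1 x M -> l1 y M' -> L (fun i => x i - y i) s t = (L x s t - L y s t)%C.
Proof.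
  intros [K [_ H]] Hx Hy.
  replace (fun i => x i - y i) with (fun i => x i + (- (1)) * y i)
    by (apply functional_extensionality; intros; ring).
  rewrite (H x y _ M M') by assumption. rewrite RtoC_opp. ring.
Qed.

Lemma SD_linear_part sg d G G1 : SD sg d G G1 -> bounded_linear sg d G1.
Proof. intros [r0 [K [_ [_ [_ [H1 [H2 _]]]]]]]. now exists K. Qed.

Lemma SD_const sg d F M : W sg d F M -> SD sg d (fun _ => F) (fun _ _ _ => 0%C).
Proof.
  intros H. assert (P := W_ge_0 _ _ _ _ _ _ H). exists 1, M. repeat split; auto.
  - lra.
  - intros x N Hx. apply W_0. apply Rmult_le_pos; [auto|eapply l1_ge_0; eauto].
  - intros. ring.
  - intros r x x' N _ Hx _ HN. eapply (W_ext _ _ _ _ (fun _ _ => 0%C)); [intros; ring|].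
    apply W_0. apply l1_ge_0 in Hx. apply l1_ge_0 in HN. repeat apply Rmult_le_pos; auto.
Qed.

Lemma SD_linear sg d L : bounded_linear sg d L -> SD sg d L L.
Proof.
  intros HL. destruct (HL) as [K [H1 H2]].
  assert (P : 0 <= K * 1) by (eapply W_ge_0, (H1 zeroseq), zeroseq_l1; lra).
  exists 1, K. repeat split; auto; try lra.
  - intros x Hx. rewrite <- (Rmult_1_r K). auto.
  - intros r x x' N Hr Hx Hx' HN. apply (W_ext _ _ _ _ (fun _ _ => 0%C)).
    + intros s t. rewrite (bounded_linear_minus _ _ _ _ _ _ _ s t HL Hx Hx'). ring.
    + apply W_0. apply l1_ge_0 in Hx. apply l1_ge_0 in HN. repeat apply Rmult_le_pos; auto; lra.
Qed.

Lemma SD_ext sg d G G' G1 G1' : (forall x s t, G x s t = G' x s t) ->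
  (forall x s t, G1 x s t = G1' x s t) -> SD sg d G G1 -> SD sg d G' G1'.
Proof.
  intros E E1 [r0 [K [Hr [HK [H1 [H2 [H3 H4]]]]]]].
  exists r0, K. repeat split; auto.
  - intros x Hx. eapply W_ext; [apply E|auto].
  - intros x M Hx. eapply W_ext; [apply E1|auto].
  - intros. rewrite <- !E1. eapply H3; eauto.
  - intros r x x' M A1 A2 A3 A4. eapply W_ext; [|apply (H4 r x x' M A1 A2 A3 A4)].
    intros s t. simpl. now rewrite !E, E1.
Qed.

(** Gives two maps a common radius and constant, and adds the Lipschitz bounds that follow from the
    quadratic modulus. The radius is cut at 1 so that [K r M <= K M]. *)
Lemma SD_shrink sg d G G1 : SD sg d G G1 -> exists R0 K0, 0 < R0 /\ 0 <= K0 /\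
  forall r0 K, 0 < r0 <= R0 -> K0 <= K ->
    (forall x, l1 x r0 -> W sg d (G x) K) /\
    (forall x M, l1 x M -> W sg d (G1 x) (K * M)) /\
    (forall x y c M M', l1 x M -> l1 y M' -> forall s t,
       G1 (fun i => x i + c * y i) s t = (G1 x s t + c * G1 y s t)%C) /\
    (forall r x x' M, r <= r0 -> l1 x r -> l1 x' r -> l1 (fun i => x i - x' i) M ->
       W sg d (fun s t => G x s t - G x' s t - G1 (fun i => x i - x' i)%R s t)%C (K * r * M)) /\
    (forall r x x' M, r <= r0 -> l1 x r -> l1 x' r -> l1 (fun i => x i - x' i) M ->
       W sg d (fun s t => G x s t - G x' s t)%C (K * M)) /\
    (forall r x, r <= r0 -> l1 x r -> W sg d (fun s t => G x s t - G zeroseq s t)%C (K * r)).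
Proof.
  intros [r0 [K [Hr [HK [H1 [H2 [H3 H4]]]]]]].
  exists (Rmin r0 1), (K + K). split; [apply Rmin_pos; lra|]. split; [lra|].
  intros r1 K1 Hr1 HK1.
  assert (B1 : r1 <= r0) by (assert (Q := Rmin_l r0 1); lra).
  assert (B2 : r1 <= 1) by (assert (Q := Rmin_r r0 1); lra).
  assert (L : forall r x x' M, r <= r1 -> l1 x r -> l1 x' r -> l1 (fun i => x i - x' i) M ->
       W sg d (fun s t => G x s t - G x' s t)%C (K1 * M)).
  { intros r x x' M A1 A2 A3 A4. assert (P := l1_ge_0 _ _ A2). assert (P' := l1_ge_0 _ _ A4).
    apply (W_ext _ _ _ _ (fun s t => (G x s t - G x' s t - G1 (fun i => x i - x' i)%R s t) + G1 (fun i => x i - x' i)%R s t)%C).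
    - intros; ring.
    - eapply W_weaken; [apply W_plus; [apply (H4 r x x' M); auto; lra|apply (H2 _ _ A4)]|].
      assert (K * r <= K * 1) by (apply Rmult_le_compat_l; lra).
      assert (K * r * M <= K * M) by (apply Rmult_le_compat_r; lra).
      assert ((K + K) * M <= K1 * M) by (apply Rmult_le_compat_r; lra). lra. }
  repeat split; auto.
  - intros x Hx. eapply W_weaken; [apply H1; eapply l1_weaken; eauto; lra|lra].
  - intros x M Hx. eapply W_weaken; [apply (H2 _ _ Hx)|].
    apply Rmult_le_compat_r; [eapply l1_ge_0; eauto|lra].
  - intros r x x' M A1 A2 A3 A4. eapply W_weaken; [apply (H4 r x x' M); auto; lra|].
    apply Rmult_le_compat_r; [eapply l1_ge_0; eauto|]. apply Rmult_le_compat_r; [eapply l1_ge_0; eauto|lra].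
  - intros r x A1 A2. apply (L r); auto.
    + apply zeroseq_l1. eapply l1_ge_0; eauto.
    + now apply l1_minus_zeroseq.
Qed.

Lemma SD_plus sg d G G1 H H1 : SD sg d G G1 -> SD sg d H H1 ->
  SD sg d (fun x s t => G x s t + H x s t)%C (fun x s t => G1 x s t + H1 x s t)%C.
Proof.
  intros [r [K [Hr [HK [A1 [A2 [A3 A4]]]]]]] [r' [K' [Hr' [HK' [B1 [B2 [B3 B4]]]]]]].
  exists (Rmin r r'), (K + K'). assert (Q := Rmin_l r r'). assert (Q' := Rmin_r r r').
  repeat split; [apply Rmin_pos; lra|lra| | | |].
  - intros x Hx. apply W_plus; [apply A1|apply B1]; eapply l1_weaken; eauto.
  - intros x M Hx. rewrite Rmult_plus_distr_r. apply W_plus; auto.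
  - intros. rewrite (A3 x y c M M'), (B3 x y c M M') by assumption. ring.
  - intros q x x' M Hq Hx Hx' HM.
    eapply (W_ext _ _ _ _ (fun s t => (G x s t - G x' s t - G1 (fun i => x i - x' i)%R s t)
      + (H x s t - H x' s t - H1 (fun i => x i - x' i)%R s t))%C); [intros; ring|].
    rewrite !Rmult_plus_distr_r. apply W_plus; [apply A4|apply B4]; auto; lra.
Qed.

Lemma SD_scal sg d c G G1 : SD sg d G G1 ->
  SD sg d (fun x s t => RtoC c * G x s t)%C (fun x s t => RtoC c * G1 x s t)%C.
Proof.
  intros [r [K [Hr [HK [A1 [A2 [A3 A4]]]]]]].
  exists r, (Rabs c * K). repeat split; auto.
  - apply Rmult_le_pos; [apply Rabs_pos|auto].
  - intros x Hx. apply W_scal. auto.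
  - intros x M Hx. rewrite Rmult_assoc. apply W_scal. auto.
  - intros. rewrite (A3 x y c0 M M') by assumption. ring.
  - intros q x x' M Hq Hx Hx' HM.
    eapply (W_ext _ _ _ _ (fun s t => RtoC c * (G x s t - G x' s t - G1 (fun i => x i - x' i)%R s t))%C); [intros; ring|].
    rewrite 2!Rmult_assoc. apply W_scal. rewrite <- Rmult_assoc. now apply A4.
Qed.

Lemma SD_minus sg d G G1 H H1 : SD sg d G G1 -> SD sg d H H1 ->
  SD sg d (fun x s t => G x s t - H x s t)%C (fun x s t => G1 x s t - H1 x s t)%C.
Proof.
  intros HG HH. apply (SD_scal _ _ (- (1))) in HH.
  eapply SD_ext; [| |apply (SD_plus _ _ _ _ _ _ HG HH)]; intros; simpl; rewrite RtoC_opp; ring.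
Qed.

Lemma SD_conj sg d G G1 : SD sg d G G1 ->
  SD sg (- d) (fun x s t => Cconj (G x s t)) (fun x s t => Cconj (G1 x s t)).
Proof.
  intros [r [K [Hr [HK [A1 [A2 [A3 A4]]]]]]].
  exists r, K. repeat split; auto.
  - intros x Hx. apply W_conj. auto.
  - intros x M Hx. apply W_conj. auto.
  - intros. rewrite (A3 x y c M M'), Cplus_conj, Cmult_conj by assumption.
    f_equal. f_equal. apply Cext; simpl; ring.
  - intros q x x' M Hq Hx Hx' HM.
    eapply (W_ext _ _ _ _ (fun s t => Cconj (G x s t - G x' s t - G1 (fun i => x i - x' i)%R s t))%C).
    + intros; now rewrite !Cminus_conj.
    + apply W_conj. auto.
Qed.

Lemma SD_mean sg sg' d G G1 : SD sg d G G1 ->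
  SD sg' d (fun x => mean (G x)) (fun x => mean (G1 x)).
Proof.
  intros [r [K [Hr [HK [A1 [A2 [A3 A4]]]]]]].
  exists r, K. repeat split; auto.
  - intros x Hx. eapply W_mean. auto.
  - intros x M Hx. eapply W_mean. auto.
  - intros x y c M M' Hx Hy s t.
    assert (C1 : ccont (G1 x s)) by (eapply W_ccont_t; eauto).
    assert (C2 : ccont (G1 y s)) by (eapply W_ccont_t; eauto).
    rewrite <- (mean_scal (fun _ => RtoC c) (G1 y) s t C2).
    rewrite <- (mean_plus (G1 x) (fun s t => c * G1 y s t)%C); [|auto|now apply ccont_scal].
    apply mean_ext. intros u. eapply A3; eauto.
  - intros q x x' M Hq Hx Hx' HM.
    assert (C1 : forall s, ccont (G x s)) by (intros; eapply W_ccont_t, A1; eapply l1_weaken; eauto).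
    assert (C2 : forall s, ccont (G x' s)) by (intros; eapply W_ccont_t, A1; eapply l1_weaken; eauto).
    assert (C3 : forall s, ccont (G1 (fun i => x i - x' i)%R s)) by (intros; eapply W_ccont_t, A2; eauto).
    eapply W_ext; [|eapply W_mean; apply (A4 q x x' M); auto].
    intros s t. cbv beta.
    rewrite (mean_minus (fun s t => G x s t - G x' s t)%C (G1 (fun i => x i - x' i)%R)); auto.
    + rewrite (mean_minus (G x) (G x')); auto.
    + now apply ccont_minus.
Qed.

Lemma SD_mult sg d e d' G G1 H H1 : (d + e = d')%Z -> SD sg d G G1 -> SD sg e H H1 ->
  SD sg d' (fun x s t => G x s t * H x s t)%C
    (fun x s t => G1 x s t * H zeroseq s t + G zeroseq s t * H1 x s t)%C.
Proof.
  intros Ed HG HH.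
  destruct (SD_shrink _ _ _ _ HG) as [r [K [Hr [HK A]]]].
  destruct (SD_shrink _ _ _ _ HH) as [r' [K' [Hr' [HK' B]]]].
  set (R0 := Rmin r r'). set (L := K + K').
  assert (Q := Rmin_l r r'). assert (Q' := Rmin_r r r'). fold R0 in Q, Q'.
  assert (HR0 : 0 < R0) by (apply Rmin_pos; lra).
  destruct (A R0 L) as [A1 [A2 [A3 [A4 [A5 A6]]]]]; [lra|unfold L; lra|].
  destruct (B R0 L) as [B1 [B2 [B3 [B4 [B5 B6]]]]]; [lra|unfold L; lra|].
  assert (HL : 0 <= L) by (unfold L; lra).
  assert (Hz : l1 zeroseq R0) by (apply zeroseq_l1; lra).
  clear A B HG HH.
  assert (L2 : 0 <= L * L) by nra.
  exists R0, (4 * (L * L)). repeat split; auto; try lra.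
  - intros x Hx. eapply W_weaken; [apply (W_mult_deg sg d e); auto|lra].
  - intros x M Hx. assert (P := l1_ge_0 _ _ Hx).
    eapply W_weaken; [apply W_plus; apply (W_mult_deg sg d e); eauto|]. assert (0 <= L * L * M) by (apply Rmult_le_pos; auto). lra.
  - intros. rewrite (A3 x y c M M'), (B3 x y c M M') by assumption. ring.
  - intros q x x' M Hq Hx Hx' HM. assert (P := l1_ge_0 _ _ Hx). assert (P' := l1_ge_0 _ _ HM).
    (* Each of the four products is of order [q * M]: a difference of order [M] meets one of order
       [q], or a quadratic remainder meets a bounded factor. This is the constant [4 L^2]. *)
    eapply (W_ext _ _ _ _ (fun s t =>
        (G x s t - G x' s t) * (H x s t - H zeroseq s t)
      + (G x s t - G x' s t - G1 (fun i => x i - x' i)%R s t) * H zeroseq s t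
      + ((G x' s t - G zeroseq s t) * (H x s t - H x' s t)
      + G zeroseq s t * (H x s t - H x' s t - H1 (fun i => x i - x' i)%R s t)))%C); [intros; ring|].
    eapply W_weaken; [apply W_plus; apply W_plus; apply (W_mult_deg sg d e); try exact Ed|].
    + apply (A5 q x x' M); auto.
    + apply (B6 q x); auto.
    + apply (A4 q x x' M); auto.
    + apply B1; auto.
    + apply (A6 q x'); auto.
    + apply (B5 q x x' M); auto.
    + apply A1; auto.
    + apply (B4 q x x' M); auto.
    + right; ring.
Qed.

(** Invertibility in the algebra near the origin is a hypothesis, since the two denominators of the
    equation obtain it from different Neumann series. *)
Lemma SD_inv sg G G1 : SD sg 0 G G1 ->
  (exists r K, 0 < r /\ forall x, l1 x r ->
     W sg 0 (fun s t => / G x s t)%C K /\ forall s t, G x s t <> 0%C) ->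
  SD sg 0 (fun x s t => / G x s t)%C
    (fun x s t => - (/ G zeroseq s t * / G zeroseq s t) * G1 x s t)%C.
Proof.
  intros HG [r' [K' [Hr' HV]]].
  destruct (SD_shrink _ _ _ _ HG) as [r [K [Hr [HK A]]]].
  assert (HK' : 0 <= K').
  { destruct (HV zeroseq) as [P _]; [apply zeroseq_l1; lra|]. eapply W_ge_0; eauto. }
  set (R0 := Rmin r r'). set (L := K + K').
  assert (Q := Rmin_l r r'). assert (Q' := Rmin_r r r'). fold R0 in Q, Q'.
  assert (HR0 : 0 < R0) by (apply Rmin_pos; lra).
  destruct (A R0 L) as [A1 [A2 [A3 [A4 [A5 A6]]]]]; [lra|unfold L; lra|].
  assert (HL : 0 <= L) by (unfold L; lra).
  assert (Hz : l1 zeroseq R0) by (apply zeroseq_l1; lra).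
  assert (V : forall x, l1 x R0 -> W sg 0 (fun s t => / G x s t)%C L).
  { intros x Hx. eapply W_weaken; [apply HV; eapply l1_weaken; eauto|unfold L; lra]. }
  assert (NZ : forall x, l1 x R0 -> forall s t, G x s t <> 0%C).
  { intros x Hx. apply HV. eapply l1_weaken; eauto. }
  clear A HG HV.
  exists R0, (L + L * L * L + 2 * (L * L * L * L * L)).
  assert (L3 : 0 <= L * L * L) by (repeat apply Rmult_le_pos; auto).
  assert (L5 : 0 <= L * L * L * L * L) by (repeat apply Rmult_le_pos; auto).
  repeat split; auto; try lra.
  - intros x Hx. eapply W_weaken; [apply V; auto|lra].
  - intros x M Hx. assert (P := l1_ge_0 _ _ Hx).
    eapply W_weaken; [apply (W_mult_deg sg 0 0); eauto; apply W_opp; apply (W_mult_deg sg 0 0); auto|].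
    assert (0 <= L * M) by nra. assert (0 <= L * L * L * L * L * M) by nra.
    replace (L * L * (L * M)) with (L * L * L * M) by ring. nra.
  - intros. rewrite (A3 x y c M M') by assumption. ring.
  - intros q x x' M Hq Hx Hx' HM. assert (P := l1_ge_0 _ _ Hx). assert (P' := l1_ge_0 _ _ HM).
    assert (Hxr : l1 x R0) by (eapply l1_weaken; eauto).
    assert (Hxr' : l1 x' R0) by (eapply l1_weaken; eauto).
    (* With [G0] for [G zeroseq], the factor of [G1] is [1 / G0^2 - 1 / (G G')], split at
       [1 / (G0 G')] into two differences of order [q]. *)
    eapply (W_ext _ _ _ _ (fun s t =>
      - ((G x s t - G x' s t - G1 (fun i => x i - x' i)%R s t) * (/ G x s t * / G x' s t))
      + G1 (fun i => x i - x' i)%R s t *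
        ((G x s t - G zeroseq s t) * (/ G x s t * (/ G zeroseq s t * / G x' s t))
         + (G x' s t - G zeroseq s t) * (/ G zeroseq s t * (/ G x' s t * / G zeroseq s t))))%C).
    + intros s t. field. repeat split; apply NZ; auto.
    + eapply W_weaken.
      * apply W_plus; [apply W_opp; apply (W_mult_deg sg 0 0)|apply (W_mult_deg sg 0 0)]; auto.
        -- apply (A4 q x x' M); auto.
        -- apply (W_mult_deg sg 0 0); auto.
        -- apply (A2 _ M); auto.
        -- apply W_plus; apply (W_mult_deg sg 0 0); auto.
           ++ apply (A6 q x); auto.
           ++ apply (W_mult_deg sg 0 0); auto. apply (W_mult_deg sg 0 0); auto.
           ++ apply (A6 q x'); auto.
           ++ apply (W_mult_deg sg 0 0); auto. apply (W_mult_deg sg 0 0); auto.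
      * assert (0 <= q * M) by nra. assert (0 <= L * (q * M)) by nra.
        replace (L * q * M * (L * L) + L * M * (L * q * (L * (L * L)) + L * q * (L * (L * L))))
          with (L * L * L * (q * M) + 2 * (L * L * L * L * L) * (q * M)) by ring.
        replace ((L + L * L * L + 2 * (L * L * L * L * L)) * q * M)
          with (L * (q * M) + L * L * L * (q * M) + 2 * (L * L * L * L * L) * (q * M)) by ring.
        lra.
Qed.

Definition lin (B : nat -> R -> R -> C) : vmap := fun x s t => CSer (fun n => x n * B n s t)%C.

Lemma lin_bounded_linear sg d B K : (forall n, W sg d (B n) K) -> bounded_linear sg d (lin B).
Proof.
  intros HB. exists K. split.
  - intros x M Hx. now apply W_CSer.
  - intros x y c M M' Hx Hy s t. unfold lin.
    assert (Hs : forall y M', l1 y M' -> Csumle (fun n => y n * B n s t)%C (K * M')).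
    { intros z N Hz. eapply sumle_mono; [|apply sumle_scal; [eapply W_ge_0, (HB O)|exact Hz]].
      intros i. simpl. rewrite Cmod_RC. assert (A := W_Cmod _ _ _ _ _ _ s t (HB i)).
      assert (D := Rabs_pos (z i)). nra. }
    rewrite <- (CSer_scal c _ _ (Hs y _ Hy)).
    assert (Hcy : Csumle (fun n => c * (y n * B n s t))%C (K * (Rabs c * M'))).
    { eapply sumle_mono; [|apply (Hs _ _ (l1_scal c y M' Hy))]. intros i. cbv beta. rewrite RtoC_mult.
      right. f_equal. ring. }
    rewrite <- (CSer_plus _ _ _ _ (Hs x _ Hx) Hcy). apply CSer_ext. intros n.
    rewrite RtoC_plus, RtoC_mult. ring.
Qed.

Lemma SD_lin sg d B K : (forall n, W sg d (B n) K) -> SD sg d (lin B) (lin B).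
Proof. intros HB. eapply SD_linear, lin_bounded_linear, HB. Qed.

Definition unit_seq (n : nat) : nat -> R := fun i => if Nat.eqb i n then 1 else 0.

Lemma lin_unit B n s t : lin B (unit_seq n) s t = B n s t.
Proof.
  unfold lin. rewrite (CSer_finite _ (S n)).
  - simpl. rewrite (csum_ext _ (fun _ => RtoC 0)).
    + unfold unit_seq. rewrite Nat.eqb_refl.
      assert (E : forall k, csum (fun _ => RtoC 0) k = 0%C) by (induction k; simpl; [easy|rewrite IHk; ring]).
      rewrite E. ring.
    + intros i Hi. unfold unit_seq. destruct (Nat.eqb_spec i n); [lia|]. ring.
  - intros i Hi. unfold unit_seq. destruct (Nat.eqb_spec i n); [lia|]. ring.
Qed.

Lemma unit_seq_l1 n : l1 (unit_seq n) 1.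
Proof.
  intros K. assert (E : rsum (fun i => Rabs (unit_seq n i)) K = if (n <? K)%nat then 1 else 0).
  { induction K; simpl; [now destruct n|]. rewrite IHK. unfold unit_seq.
    destruct (Nat.ltb_spec n K), (Nat.ltb_spec n (S K)), (Nat.eqb_spec K n); try lia;
      rewrite ?Rabs_R0, ?Rabs_R1; ring. }
  rewrite E. destruct (n <? K)%nat; lra.
Qed.

Lemma lin_zeroseq B s t : lin B zeroseq s t = 0%C.
Proof.
  unfold lin. rewrite (CSer_finite _ O); [reflexivity|]. intros. unfold zeroseq. ring.
Qed.

(** Finite sequences are dense in l1, so a bounded linear functional is fixed by its values on unit
    vectors. The linearized equation then has to be computed on [unit_seq n] only. *)
Lemma functional_determined (ell : (nat -> R) -> R) K x M lam i :
  (forall x M, l1 x M -> Rabs (ell x) <= K * M) ->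
  (forall x y c M M', l1 x M -> l1 y M' ->
     ell (fun i => x i + c * y i) = ell x + c * ell y) ->
  (forall n, ell (unit_seq n) = if Nat.eqb n i then lam else 0) ->
  l1 x M -> ell x = lam * x i.
Proof.
  intros Hb Hl Hu Hx.
  assert (HK : 0 <= K).
  { assert (A := Hb _ _ (unit_seq_l1 O)). assert (B := Rabs_pos (ell (unit_seq 0))). lra. }
  set (tr := fun N i => if (i <? N)%nat then x i else 0).
  assert (Htr : forall N, l1 (tr N) M).
  { intros N. eapply sumle_mono; [|exact Hx]. intros j. unfold tr.
    destruct (j <? N)%nat; [lra|]. rewrite Rabs_R0. apply Rabs_pos. }
  assert (E0 : ell zeroseq = 0).
  { assert (A := Hb zeroseq 0 (zeroseq_l1 0 (Rle_refl 0))). rewrite Rmult_0_r in A.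
    assert (B := Rabs_pos (ell zeroseq)). apply Rabs_eq_0. lra. }
  assert (E : forall N, ell (tr N) = if (i <? N)%nat then lam * x i else 0).
  { induction N.
    - replace (tr O) with zeroseq; [simpl; exact E0|].
      apply functional_extensionality. intros j. unfold tr. now destruct (Nat.ltb_spec j 0); [lia|].
    - replace (tr (S N)) with (fun i => tr N i + x N * unit_seq N i).
      + rewrite (Hl _ _ _ _ _ (Htr N) (unit_seq_l1 N)), IHN, Hu.
        destruct (Nat.ltb_spec i N), (Nat.ltb_spec i (S N)), (Nat.eqb_spec N i); subst; try lia; ring.
      + apply functional_extensionality. intros j. unfold tr, unit_seq.
        destruct (Nat.ltb_spec j N), (Nat.ltb_spec j (S N)), (Nat.eqb_spec j N); subst; try lia; ring. }
  apply Rminus_diag_uniq. apply Rabs_eq_0. apply Rle_antisym; [|apply Rabs_pos].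
  apply le_epsilon. intros e He. rewrite Rplus_0_l.
  destruct (sumle_tail _ _ (e / (K + 1)) (fun i => Rabs_pos (x i)) Hx) as [N HN].
  { apply Rdiv_lt_0_compat; lra. }
  (* The truncation must also contain the index [i], the only one that [ell] sees. *)
  set (N' := max N (S i)).
  assert (HT : l1 (fun j => x j + (- (1)) * tr N' j) (e / (K + 1))).
  { eapply sumle_mono; [|exact HN]. intros j. simpl. unfold tr, cut.
    destruct (Nat.ltb_spec j N'), (Nat.ltb_spec j N); unfold N' in *; try lia.
    - replace (x j + - (1) * x j) with 0 by ring. rewrite Rabs_R0. lra.
    - replace (x j + - (1) * x j) with 0 by ring. rewrite Rabs_R0. assert (A := Rabs_pos (x j)). lra.
    - replace (x j + - (1) * 0) with (x j) by ring. lra. }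
  assert (F := Hb _ _ HT). rewrite (Hl _ _ _ _ _ Hx (Htr N')), E in F.
  destruct (Nat.ltb_spec i N'); [|unfold N' in *; lia].
  replace (ell x - lam * x i) with (ell x + - (1) * (lam * x i)) by ring.
  eapply Rle_trans; [exact F|].
  apply Rle_trans with ((K + 1) * (e / (K + 1))); [|right; field; lra].
  apply Rmult_le_compat_r; [|lra]. left; apply Rdiv_lt_0_compat; lra.
Qed.

End Differentiation.

(** Restates at type [R] an equation over a carrier that is merely convertible to it, so that [ring]
    applies. *)
Ltac eqR := match goal with |- @eq _ ?a ?b => change (@eq R a b) end.

(** * Contractions of l1 balls *)

Lemma is_lim_seq_rsum (u : nat -> nat -> R) (v : nat -> R) K :
  (forall i, is_lim_seq (fun k => u k i) (v i)) ->
  is_lim_seq (fun k => rsum (u k) K) (rsum v K).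
Proof.
  intros H. induction K; simpl; [apply is_lim_seq_const|].
  now apply (is_lim_seq_plus' (fun k => rsum (u k) K) (fun k => u k K)).
Qed.

Lemma l1_lim (u : nat -> nat -> R) (v : nat -> R) M :
  (forall i, is_lim_seq (fun k => u k i) (v i)) -> (forall k, l1 (u k) M) -> l1 v M.
Proof.
  intros H HM K.
  apply (is_lim_seq_le (fun k => rsum (fun i => Rabs (u k i)) K) (fun _ => M)
    (rsum (fun i => Rabs (v i)) K) M).
  - intros k. apply HM.
  - apply (is_lim_seq_rsum (fun k i => Rabs (u k i)) (fun i => Rabs (v i))).
    intros i. apply (is_lim_seq_abs _ (v i)), H.
  - apply is_lim_seq_const.
Qed.

Lemma half_pow_le M e : 0 <= M -> 0 < e -> exists n, M * (/ 2) ^ n <= e.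
Proof.
  intros HM He. destruct (pow_small (/ 2) (e / (M + 1))) as [n Hn]; [lra|apply Rdiv_lt_0_compat; lra|].
  exists n. apply Rle_trans with (M * (e / (M + 1))); [apply Rmult_le_compat_l; auto|].
  apply Rle_trans with ((M + 1) * (e / (M + 1))); [|right; field; lra].
  apply Rmult_le_compat_r; [|lra]. left; apply Rdiv_lt_0_compat; lra.
Qed.

Lemma geometric_step_limit (u : nat -> R) r :
  (forall n, Rabs (u (S n) - u n) <= r * (/ 2) ^ n) -> exists l : R, is_lim_seq u l.
Proof.
  intros H.
  assert (E : ex_series (fun n => u (S n) - u n)).
  { apply (ex_series_le (V := R_CompleteNormedModule) _ (fun n => r * (/ 2) ^ n)); [exact H|].
    apply (ex_series_scal (V := R_NormedModule) r (fun n => (/ 2) ^ n)).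
    apply ex_series_geom. rewrite Rabs_pos_eq; lra. }
  destruct E as [l Hl]. exists (u O + l).
  apply is_lim_seq_incr_1.
  apply (is_lim_seq_ext (fun n => u O + sum_n (fun n => u (S n) - u n) n)).
  - intros n. induction n; [rewrite sum_O; ring|].
    rewrite sum_Sn. unfold plus; simpl. unfold plus in IHn; simpl in IHn. lra.
  - apply (is_lim_seq_plus' (fun _ => u O)); [apply is_lim_seq_const|exact Hl].
Qed.

(** The bound is the sum of the geometric steps from [n] to [n + k - 1]. *)
Lemma l1_step_distance (u : nat -> nat -> R) r n k :
  (forall n, l1 (fun i => u (S n) i - u n i) (r * (/ 2) ^ n)) ->
  l1 (fun i => u (n + k)%nat i - u n i) (2 * r * (/ 2) ^ n - 2 * r * (/ 2) ^ (n + k)).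
Proof.
  intros H. induction k.
  - rewrite Nat.add_0_r. apply (l1_ext (fun _ => 0)); [intros; ring|]. apply l1_0. lra.
  - rewrite <- plus_n_Sm.
    apply (l1_ext (fun i => (u (S (n + k))%nat i - u (n + k)%nat i) + (u (n + k)%nat i - u n i))); [intros; ring|].
    eapply l1_weaken; [apply l1_plus; [apply H|apply IHk]|].
    simpl. right. field.
Qed.

(** The iterates from 0 converge in each coordinate, and [l1_lim] turns coordinatewise limits into
    l1 bounds, which takes the place of completeness. *)
Lemma l1_contraction (T : (nat -> R) -> nat -> R) r : 0 < r ->
  (forall v, l1 v r -> l1 (T v) r) ->
  (forall v v' M, l1 v r -> l1 v' r -> l1 (fun i => v i - v' i) M ->
     l1 (fun i => T v i - T v' i) (M * / 2)) ->
  exists v, l1 v r /\ forall i, T v i = v i.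
Proof.
  intros Hr HT HC.
  set (u := fun n => Nat.iter n T zeroseq).
  assert (Hu : forall n, l1 (u n) r).
  { induction n; [apply zeroseq_l1; lra|]. apply HT, IHn. }
  assert (Hd : forall n, l1 (fun i => u (S n) i - u n i) (r * (/ 2) ^ n)).
  { induction n.
    - rewrite Rmult_1_r. apply l1_minus_zeroseq, (Hu 1%nat).
    - simpl. rewrite (Rmult_comm (/ 2)), <- Rmult_assoc.
      apply (HC (u (S n)) (u n)); auto. }
  assert (Hl : forall i, exists l : R, is_lim_seq (fun n => u n i) l).
  { intros i. apply (geometric_step_limit _ r). intros n. apply (l1_term (fun i => u (S n) i - u n i)), Hd. }
  set (v := fun i => real (Lim_seq (fun n => u n i))).
  assert (Hv : forall i, is_lim_seq (fun n => u n i) (v i)).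
  { intros i. destruct (Hl i) as [l E]. unfold v. now rewrite (is_lim_seq_unique _ _ E). }
  assert (Hvr : l1 v r) by (eapply l1_lim; eauto).
  assert (Hvn : forall n, l1 (fun i => v i - u n i) (2 * r * (/ 2) ^ n)).
  { intros n. apply (l1_lim (fun k i => u (k + n)%nat i - u n i)).
    - intros i. apply (is_lim_seq_minus' (fun k => u (k + n)%nat i)); [|apply is_lim_seq_const].
      apply (is_lim_seq_incr_n (fun k => u k i)), Hv.
    - intros k. rewrite Nat.add_comm. eapply l1_weaken; [apply (l1_step_distance u r n k Hd)|].
      assert (0 <= 2 * r * (/ 2) ^ (n + k)) by (apply Rmult_le_pos; [lra|apply pow_le; lra]). lra. }
  exists v. split; auto. intros i.
  apply Rminus_diag_uniq, Rabs_eq_0, Rle_antisym; [|apply Rabs_pos].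
  apply le_epsilon. intros e He. rewrite Rplus_0_l.
  destruct (half_pow_le (2 * r) e) as [n Hn]; [lra|auto|].
  (* [T v] and [v] are both compared with [T (u n)], which is [u (S n)]. *)
  assert (A := l1_term _ _ i (HC v (u n) _ Hvr (Hu n) (Hvn n))).
  assert (B := l1_term _ _ i (Hvn (S n))). simpl in A, B.
  replace (T v i - v i) with ((T v i - T (u n) i) - (v i - T (u n) i)) by ring.
  eapply Rle_trans; [apply Rabs_triang|]. rewrite Rabs_Ropp. lra.
Qed.

Lemma l1_eps x M : (forall e, 0 < e -> l1 x (M + e)) -> l1 x M.
Proof. intros H K. apply le_epsilon. intros e He. now apply H. Qed.

(** The inequality [d <= d / 2 + del] cannot be solved for [d], because [l1] carries upper bounds
    only. It is iterated from the bound [2 r], and the limit gives [2 del]. *)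
Lemma l1_fixed_point_perturbation (T T' : (nat -> R) -> nat -> R) r v v' del :
  l1 v r -> l1 v' r -> (forall i, T v i = v i) -> (forall i, T' v' i = v' i) ->
  (forall M, l1 (fun i => v i - v' i) M -> l1 (fun i => T v i - T v' i) (M * / 2)) ->
  l1 (fun i => T v' i - T' v' i) del ->
  l1 (fun i => v i - v' i) (2 * del).
Proof.
  intros Hv Hv' Fv Fv' HC HD.
  assert (H : forall n, l1 (fun i => v i - v' i) (2 * del + 2 * r * (/ 2) ^ n)).
  { induction n.
    - eapply l1_weaken; [apply (l1_minus _ _ _ _ Hv Hv')|]. apply sumle_ge_0 in HD. simpl. lra.
    - apply (l1_ext (fun i => (T v i - T v' i) + (T v' i - T' v' i))).
      + intros i. rewrite Fv, Fv'. ring.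
      + eapply l1_weaken; [apply l1_plus; [apply (HC _ IHn)|apply HD]|]. simpl. lra. }
  apply l1_eps. intros e He. destruct (half_pow_le (2 * r) e) as [n Hn].
  - apply sumle_ge_0 in Hv. lra.
  - auto.
  - eapply l1_weaken; [apply (H n)|lra].
Qed.

(** * Sine coefficients *)

(** The final equation does not depend on the second angle, which is set to 0 here. *)
Definition fsin (N : nat) (G : R -> R -> C) : R :=
  / PI * RInt (fun s => Im (G s 0) * sin (INR N * s)) 0 (2 * PI).

Lemma continuous_sin_mult a s : continuous (fun s => sin (a * s)) s.
Proof.
  apply (continuous_ext (fun s => Im (cis (a * s + 0)))).
  - intros u. rewrite Rplus_0_r. reflexivity.
  - apply continuous_Im, continuous_cis_affine.
Qed.

Lemma ex_RInt_fsin (f : R -> C) a : ccont f ->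
  ex_RInt (fun s => Im (f s) * sin (a * s)) 0 (2 * PI).
Proof.
  intros H. apply ex_RInt_continuous_all. intros t.
  apply (continuous_mult (K := R_AbsRing)); [apply continuous_Im, H|apply continuous_sin_mult].
Qed.

Lemma fsin_plus N F G : ccont (fun s => F s 0) -> ccont (fun s => G s 0) ->
  fsin N (fun s t => F s t + G s t)%C = fsin N F + fsin N G.
Proof.
  intros HF HG. unfold fsin. rewrite <- Rmult_plus_distr_l. f_equal.
  symmetry. etransitivity; [symmetry; exact (RInt_plus (V := R_CompleteNormedModule)
    (fun s => Im (F s 0) * sin (INR N * s)) (fun s => Im (G s 0) * sin (INR N * s)) 0 (2 * PI)
    (ex_RInt_fsin (fun s => F s 0) _ HF) (ex_RInt_fsin (fun s => G s 0) _ HG))|].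
  apply RInt_ext. intros s _.
  change (Im (F s 0) * sin (INR N * s) + Im (G s 0) * sin (INR N * s)
    = (Im (F s 0) + Im (G s 0)) * sin (INR N * s)). ring.
Qed.

Lemma fsin_scal N c G : ccont (fun s => G s 0) ->
  fsin N (fun s t => RtoC c * G s t)%C = c * fsin N G.
Proof.
  intros HG. unfold fsin. rewrite <- Rmult_assoc, (Rmult_comm c), Rmult_assoc. f_equal.
  rewrite <- (RInt_scal_R _ c _ _ (ex_RInt_fsin (fun s => G s 0) _ HG)).
  apply RInt_ext. intros s _. rewrite Im_mult, Re_RtoC, Im_RtoC.
  change ((c * Im (G s 0) + 0 * Re (G s 0)) * sin (INR N * s)
    = c * (Im (G s 0) * sin (INR N * s))). ring.
Qed.

Lemma fsin_ext N F G : (forall s, F s 0 = G s 0) -> fsin N F = fsin N G.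
Proof. intros H. unfold fsin. f_equal. apply RInt_ext. intros. now rewrite H. Qed.

Lemma fsin_minus N F G : ccont (fun s => F s 0) -> ccont (fun s => G s 0) ->
  fsin N (fun s t => F s t - G s t)%C = fsin N F - fsin N G.
Proof.
  intros HF HG. transitivity (fsin N F + (- (1)) * fsin N G); [|ring].
  rewrite <- fsin_scal, <- (fsin_plus N F) by (auto; apply (ccont_scal _ (fun s => G s 0)), HG).
  apply fsin_ext. intros. rewrite RtoC_opp. ring.
Qed.

Lemma fsin_Rabs N G M : ccont (fun s => G s 0) -> (forall s, Cmod (G s 0) <= M) ->
  Rabs (fsin N G) <= 2 * M.
Proof.
  intros HG HM. assert (P := PI_RGT_0). unfold fsin.
  rewrite Rabs_mult, (Rabs_pos_eq (/ PI)) by (left; now apply Rinv_0_lt_compat).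
  apply (Rmult_le_reg_l PI); [auto|]. rewrite <- Rmult_assoc, Rinv_r, Rmult_1_l by lra.
  replace (PI * (2 * M)) with (scal (2 * PI - 0) M) by (unfold scal; simpl; unfold mult; simpl; ring).
  apply (norm_RInt_le (V := R_NormedModule) (fun s => Im (G s 0) * sin (INR N * s)) (fun _ => M) 0 (2 * PI)).
  - lra.
  - intros s _. unfold norm; simpl. unfold abs; simpl. rewrite Rabs_mult.
    assert (A := im_le_Cmod (G s 0)). assert (B := HM s).
    assert (D : Rabs (sin (INR N * s)) <= 1) by (apply Rabs_le, SIN_bound).
    assert (A0 := Rabs_pos (Im (G s 0))). assert (D0 := Rabs_pos (sin (INR N * s))). nra.
  - apply (RInt_correct (V := R_CompleteNormedModule)), (ex_RInt_fsin (fun s => G s 0)), HG.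
  - apply (is_RInt_const (V := R_NormedModule)).
Qed.

Lemma RInt_cos_freq (k : Z) : RInt (fun s => cos (IZR k * s)) 0 (2 * PI) = if Z.eqb k 0 then 2 * PI else 0.
Proof.
  destruct (Z.eqb_spec k 0) as [->|Hk].
  - rewrite (RInt_ext _ (fun _ => 1)).
    + rewrite RInt_const. unfold scal; simpl; unfold mult; simpl. ring.
    + intros. now rewrite Rmult_0_l, cos_0.
  - assert (E : CInt (fun t => cis (IZR k * t + 0)) = 0%C).
    { apply is_RInt_cis_integral; [|apply cis_IZR_2PI]. intros E. apply eq_IZR in E. contradiction. }
    apply (f_equal Re) in E. unfold CInt, Re at 1 in E; simpl in E.
    etransitivity; [|exact E]. apply RInt_ext. intros. now rewrite Rplus_0_r.
Qed.

Lemma ex_RInt_cos_freq a : ex_RInt (fun s => cos (a * s)) 0 (2 * PI).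
Proof.
  apply ex_RInt_continuous_all. intros t. apply (continuous_ext (fun s => Re (cis (a * s + 0)))).
  - intros u. rewrite Rplus_0_r. reflexivity.
  - apply continuous_Re, continuous_cis_affine.
Qed.

Lemma fsin_mono N p q : fsin N (mono p q) =
  (if Z.eqb p (Z.of_nat N) then 1 else 0) - (if Z.eqb p (- Z.of_nat N) then 1 else 0).
Proof.
  assert (P := PI_RGT_0). unfold fsin.
  assert (E : RInt (fun s => Im (mono p q s 0) * sin (INR N * s)) 0 (2 * PI)
    = / 2 * RInt (fun s => cos (IZR (p - Z.of_nat N) * s)) 0 (2 * PI)
      - / 2 * RInt (fun s => cos (IZR (p + Z.of_nat N) * s)) 0 (2 * PI)).
  { rewrite <- !RInt_scal_R by apply ex_RInt_cos_freq.
    rewrite <- (RInt_minus (V := R_CompleteNormedModule)).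
    - apply RInt_ext. intros s _. unfold mono, minus, plus, opp; simpl.
      rewrite Rmult_0_r, Rplus_0_r, minus_IZR, plus_IZR, <- INR_IZR_INZ.
      rewrite Rmult_minus_distr_r, Rmult_plus_distr_r, cos_minus, cos_plus. field.
    - apply (ex_RInt_scal (V := R_NormedModule) _ _ _ (/ 2)), ex_RInt_cos_freq.
    - apply (ex_RInt_scal (V := R_NormedModule) _ _ _ (/ 2)), ex_RInt_cos_freq. }
  rewrite E, !RInt_cos_freq.
  destruct (Z.eqb_spec (p - Z.of_nat N) 0), (Z.eqb_spec p (Z.of_nat N)); try lia;
  destruct (Z.eqb_spec (p + Z.of_nat N) 0), (Z.eqb_spec p (- Z.of_nat N)); try lia; field; lra.
Qed.

Section SineCoefficients.
Context (m : nat) (kap : posreal).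
Local Notation W := (W m kap).

(** Index [i] stands for [n = i + 1], so that exactly the positive multiples of [m] are listed. *)
Definition freq (i : nat) : nat := (S i * m)%nat.

Definition fwt (i : nat) : R := 1 + kap * INR (freq i).

Lemma fwt_ge_1 i : 1 <= fwt i.
Proof.
  unfold fwt. assert (0 <= kap * INR (freq i)); [|lra].
  apply Rmult_le_pos; [left; apply cond_pos|apply pos_INR].
Qed.

(** [freq] is strictly increasing, so at most one term is nonzero; the induction also records that
    none has occurred while [freq K <= a]. *)
Lemma rsum_indicator (a : nat) c K : (1 <= m)%nat -> 0 <= c ->
  rsum (fun i => if Nat.eqb (freq i) a then c else 0) K <= c.
Proof.
  intros Hm Hc.
  assert (H : rsum (fun i => if Nat.eqb (freq i) a then c else 0) K <= c /\
    ((freq K <= a)%nat -> rsum (fun i => if Nat.eqb (freq i) a then c else 0) K = 0)).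
  { induction K as [|K [IH1 IH2]]; simpl rsum; [split; [lra|reflexivity]|].
    assert (A : (freq K < freq (S K))%nat) by (unfold freq; nia).
    destruct (Nat.eqb_spec (freq K) a).
    - split; [rewrite IH2 by lia; lra|intros; lia].
    - split; [lra|]. intros. rewrite IH2 by lia. ring. }
  apply H.
Qed.

Lemma ccont_trig_sum_at_0 l : ccont (fun s => trig_sum l s 0).
Proof. apply ccont_trig_sum_s. Qed.

(** A monomial of frequencies [p, q] contributes at most to the index with [freq i = |p|], and there
    [fwt i <= wt p q]. *)
Lemma fsin_trig_sum l K : (1 <= m)%nat ->
  rsum (fun i => fwt i * Rabs (fsin (freq i) (trig_sum l))) K <= trig_norm kap l.
Proof.
  intros Hm. induction l as [|[c [p q]] l IH].
  - rewrite (rsum_ext _ (fun _ => 0 * 0)).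
    + rewrite rsum_scal. simpl. lra.
    + intros i _. rewrite (fsin_ext _ _ (fun _ _ => RtoC 0 * RtoC 0)%C).
      * rewrite (fsin_scal _ 0 (fun _ _ => RtoC 0)) by apply ccont_const. rewrite Rmult_0_l, Rabs_R0. ring.
      * intros. simpl. ring.
  - simpl trig_norm. set (g := fun i => if Nat.eqb (freq i) (Z.abs_nat p) then wt kap p q else 0).
    assert (Hw := wt_ge_1 kap p q).
    apply Rle_trans with (rsum (fun i => Rabs c * g i + fwt i * Rabs (fsin (freq i) (trig_sum l))) K).
    + apply rsum_le. intros i _.
      change (trig_sum ((c, (p, q)) :: l)) with (fun s t => c * mono p q s t + trig_sum l s t)%C.
      rewrite (fsin_plus _ (fun s t => c * mono p q s t)%C (trig_sum l));
        [|apply (ccont_scal _ (fun s => mono p q s 0)), ccont_mono_s|apply ccont_trig_sum_at_0].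
      rewrite fsin_scal, fsin_mono by apply ccont_mono_s.
      assert (F1 := fwt_ge_1 i). assert (Hc := Rabs_pos c).
      eapply Rle_trans; [apply Rmult_le_compat_l; [lra|apply Rabs_triang]|].
      rewrite Rmult_plus_distr_l. apply Rplus_le_compat_r.
      rewrite Rabs_mult. unfold g.
      destruct (Nat.eqb_spec (freq i) (Z.abs_nat p)) as [Ef|Ef].
      * assert (Fw : fwt i <= wt kap p q).
        { unfold fwt, wt. rewrite Ef. rewrite INR_IZR_INZ, Zabs2Nat.id_abs.
          assert (0 <= IZR (Z.abs q)) by (apply IZR_le; lia). assert (Hk := cond_pos kap). nra. }
        assert (B : Rabs ((if Z.eqb p (Z.of_nat (freq i)) then 1 else 0) - (if Z.eqb p (- Z.of_nat (freq i)) then 1 else 0)) <= 1).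
        { destruct (Z.eqb_spec p (Z.of_nat (freq i))), (Z.eqb_spec p (- Z.of_nat (freq i)));
            apply Rabs_le; lra. }
        assert (B0 := Rabs_pos ((if Z.eqb p (Z.of_nat (freq i)) then 1 else 0) - (if Z.eqb p (- Z.of_nat (freq i)) then 1 else 0))).
        set (b := Rabs (_ - _)) in *.
        assert (Rabs c * b <= Rabs c * 1) by (apply Rmult_le_compat_l; lra).
        assert (0 <= Rabs c * b) by (apply Rmult_le_pos; lra).
        apply Rle_trans with (wt kap p q * (Rabs c * 1)); [apply Rmult_le_compat; lra|lra].
      * destruct (Z.eqb_spec p (Z.of_nat (freq i))); [lia|].
        destruct (Z.eqb_spec p (- Z.of_nat (freq i))); [lia|].
        rewrite Rminus_0_r, Rabs_R0. lra.
    + rewrite rsum_plus, rsum_scal. apply Rplus_le_compat; auto.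
      apply Rmult_le_compat_l; [apply Rabs_pos|]. apply rsum_indicator; [auto|lra].
Qed.

Lemma fsin_sumle sg d F M : (1 <= m)%nat -> W sg d F M ->
  l1 (fun i => fwt i * fsin (freq i) F) M.
Proof.
  intros Hm H K. apply le_epsilon. intros e He.
  (* [K] is fixed before the approximation is chosen: an error [h] in [F] changes each coefficient
     by at most [2 h], hence the weighted partial sum by at most [h * S0]. *)
  set (S0 := rsum (fun i => fwt i * 2) K).
  assert (HS : 0 <= S0).
  { apply rsum_pos. intros i. assert (A := fwt_ge_1 i). lra. }
  destruct (H (e / (S0 + 1))) as [l [_ [N E]]]; [apply Rdiv_lt_0_compat; lra|].
  assert (HF : ccont (fun s => F s 0)) by (eapply W_ccont_s; eauto).
  apply Rle_trans with (rsum (fun i => fwt i * Rabs (fsin (freq i) (trig_sum l)) + e / (S0 + 1) * (fwt i * 2)) K).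
  - apply rsum_le. intros i _. assert (F1 := fwt_ge_1 i).
    rewrite Rabs_mult, (Rabs_pos_eq (fwt i)) by lra.
    assert (A : Rabs (fsin (freq i) (fun s t => F s t - trig_sum l s t)%C) <= 2 * (e / (S0 + 1))).
    { apply fsin_Rabs.
      - apply (ccont_minus (fun s => F s 0)); [auto|apply ccont_trig_sum_at_0].
      - intros; apply E. }
    rewrite fsin_minus in A by (auto; apply ccont_trig_sum_at_0).
    assert (B := Rabs_triang_inv (fsin (freq i) F) (fsin (freq i) (trig_sum l))).
    assert (fwt i * (Rabs (fsin (freq i) F) - Rabs (fsin (freq i) (trig_sum l))) <= fwt i * (2 * (e / (S0 + 1))))
      by (apply Rmult_le_compat_l; lra). lra.
  - rewrite rsum_plus, rsum_scal. apply Rplus_le_compat.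
    + eapply Rle_trans; [now apply fsin_trig_sum|auto].
    + fold S0. apply Rle_trans with (e / (S0 + 1) * (S0 + 1)); [|right; field; lra].
      apply Rmult_le_compat_l; [|lra]. left; apply Rdiv_lt_0_compat; lra.
Qed.

Lemma mono_period p q s t k : mono p q (s + IZR k * (2 * PI)) t = mono p q s t.
Proof.
  unfold mono. rewrite <- (cis_period_Z (IZR p * s + IZR q * t) (p * k)). f_equal.
  rewrite mult_IZR. ring.
Qed.

Lemma W_period sg d F M s t k : W sg d F M -> F (s + IZR k * (2 * PI)) t = F s t.
Proof.
  intros H. apply Cmod_le_eps_eq. intros e He.
  destruct (H (e / 2)) as [l [_ [_ E]]]; [lra|].
  eapply Rle_trans; [apply (Cmod_dist_triangle _ (trig_sum l s t))|].
  assert (P : trig_sum l (s + IZR k * (2 * PI)) t = trig_sum l s t).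
  { clear. induction l as [|[c [p q]] l IH]; simpl; [easy|]. now rewrite IH, mono_period. }
  assert (A := E (s + IZR k * (2 * PI)) t). rewrite P in A.
  assert (B := E s t). rewrite (Cmod_minus_sym (F s t)) in B. lra.
Qed.

Lemma RInt_sq_eq_0 (h : R -> R) : (forall s, continuous h s) ->
  RInt (fun s => h s * h s) 0 (2 * PI) = 0 -> forall s, 0 <= s <= 2 * PI -> h s = 0.
Proof.
  intros Hc H0 s0 Hs0. assert (P := PI_RGT_0).
  destruct (Req_dec (h s0) 0) as [|Hne]; [easy|exfalso].
  assert (Hq : forall s, continuous (fun s => h s * h s) s)
    by (intros; apply (continuous_mult (K := R_AbsRing)); apply Hc).
  assert (Hex : forall a b, ex_RInt (fun s => h s * h s) a b) by (intros; now apply ex_RInt_continuous_all).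
  assert (Hpos : 0 < h s0 * h s0) by nra.
  destruct (Hq s0 (fun y => 0 < y)) as [d Hd].
  { exists (mkposreal _ Hpos). intros y Hy. unfold ball in Hy; simpl in Hy.
    unfold AbsRing_ball, abs, minus, plus, opp in Hy; simpl in Hy. apply Rabs_def2 in Hy. lra. }
  set (a := Rmax 0 (s0 - d)). set (b := Rmin (2 * PI) (s0 + d)).
  assert (Dp := cond_pos d).
  assert (Ha : 0 <= a /\ s0 - d <= a) by (split; [apply Rmax_l|apply Rmax_r]).
  assert (Hb : b <= 2 * PI /\ b <= s0 + d) by (split; [apply Rmin_l|apply Rmin_r]).
  assert (Hab : a < b).
  { unfold a, b. apply Rmax_case; apply Rmin_case; lra. }
  assert (I1 : 0 <= RInt (fun s => h s * h s) 0 a).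
  { apply RInt_ge_0; auto; [lra|]. intros; nra. }
  assert (I3 : 0 <= RInt (fun s => h s * h s) b (2 * PI)).
  { apply RInt_ge_0; auto; [lra|]. intros; nra. }
  assert (I2 : 0 < RInt (fun s => h s * h s) a b).
  { apply RInt_gt_0; auto. intros x Hx. apply Hd. unfold ball; simpl.
    unfold AbsRing_ball, abs, minus, plus, opp; simpl. apply Rabs_def1; lra. }
  rewrite <- (RInt_Chasles (V := R_CompleteNormedModule) _ 0 a (2 * PI)) in H0 by auto.
  rewrite <- (RInt_Chasles (V := R_CompleteNormedModule) _ a b (2 * PI)) in H0 by auto.
  unfold plus in H0; simpl in H0. lra.
Qed.

(* With [sg = 0] only frequencies in [m Z] of the first angle occur. *)
Lemma fsin_eq_0_Im G M : (1 <= m)%nat -> W 0 0 G M ->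
  (forall i, fsin (freq i) G = 0) -> forall s, Im (G s 0) = 0.
Proof.
  intros Hm HG H0.
  assert (Hc : ccont (fun s => G s 0)) by (eapply W_ccont_s; eauto).
  assert (HM := W_ge_0 _ _ _ _ _ _ HG). assert (P := PI_RGT_0).
  assert (Hex : forall a, ex_RInt (fun s => Im (G s 0) * sin (a * s)) 0 (2 * PI)) by (intros; now apply (ex_RInt_fsin (fun s => G s 0))).
  assert (Hp : forall n, RInt (fun s => Im (G s 0) * sin (INR (n * m) * s)) 0 (2 * PI) = 0).
  { intros [|n].
    - rewrite (RInt_ext _ (fun _ => 0)); [rewrite RInt_const; unfold scal; simpl; unfold mult; simpl; ring|].
      intros. simpl. rewrite Rmult_0_l, sin_0. ring.
    - assert (A := H0 n). unfold fsin, freq in A.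
      apply (Rmult_eq_reg_l (/ PI)); [rewrite A; ring|]. apply Rinv_neq_0_compat. lra. }
  (* Oddness of the sine covers the negative multiples of [m]. *)
  assert (Hpz : forall j : Z, RInt (fun s => Im (G s 0) * sin (IZR (Z.of_nat m * j) * s)) 0 (2 * PI) = 0).
  { intros j. destruct (Z_le_gt_dec 0 j) as [Hj|Hj].
    - etransitivity; [|exact (Hp (Z.to_nat j))]. apply RInt_ext. intros.
      rewrite (INR_IZR_INZ (Z.to_nat j * m)), Nat2Z.inj_mul, Z2Nat.id by lia. now rewrite Z.mul_comm.
    - apply (Rmult_eq_reg_l (- (1))); [|lra]. rewrite <- RInt_scal_R by apply Hex.
      rewrite Rmult_0_r. etransitivity; [|exact (Hp (Z.to_nat (- j)))]. apply RInt_ext. intros x _.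
      rewrite (INR_IZR_INZ (Z.to_nat (- j) * m)), Nat2Z.inj_mul, Z2Nat.id by lia.
      replace (- j * Z.of_nat m)%Z with (- (Z.of_nat m * j))%Z by ring.
      rewrite opp_IZR, <- (Ropp_mult_distr_l _ x), sin_neg. eqR. ring. }
  assert (Hev : forall l, deg m 0 0 l ->
    ex_RInt (fun s => Im (G s 0) * Im (trig_sum l s 0)) 0 (2 * PI) /\
    RInt (fun s => Im (G s 0) * Im (trig_sum l s 0)) 0 (2 * PI) = 0).
  { intros l D. split.
    { apply ex_RInt_continuous_all. intros t. apply (continuous_mult (K := R_AbsRing)); apply continuous_Im; [apply Hc|apply ccont_trig_sum_at_0]. }
    induction D as [|[c [p q]] l [j Hj] D IH].
    - simpl. rewrite (RInt_ext _ (fun _ => 0)); [rewrite RInt_const; unfold scal; simpl; unfold mult; simpl; ring|].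
      intros. rewrite Rmult_0_r. easy.
    - simpl in Hj. assert (Ep : p = (Z.of_nat m * j)%Z) by lia.
      rewrite (RInt_ext _ (fun s => plus (c * (Im (G s 0) * sin (IZR (Z.of_nat m * j) * s))) (Im (G s 0) * Im (trig_sum l s 0)))).
      + rewrite (RInt_plus (V := R_CompleteNormedModule)).
        * rewrite RInt_scal_R by apply Hex. rewrite Hpz, IH. unfold plus; simpl. ring.
        * apply (ex_RInt_scal (V := R_NormedModule) _ _ _ c), Hex.
        * apply ex_RInt_continuous_all. intros t. apply (continuous_mult (K := R_AbsRing)); apply continuous_Im; [apply Hc|apply ccont_trig_sum_at_0].
      + intros s _.
        change (Im (G s 0) * Im (c * mono p q s 0 + trig_sum l s 0)%C
          = c * (Im (G s 0) * sin (IZR (Z.of_nat m * j) * s)) + Im (G s 0) * Im (trig_sum l s 0)).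
        rewrite Im_plus, Im_mult, Re_RtoC, Im_RtoC.
        unfold mono. rewrite Rmult_0_r, Rplus_0_r, Im_cis, Ep. ring. }
  (* [Im G] is orthogonal to the imaginary part of every approximating polynomial [P], so the
     integral of its square equals that of [Im G * Im (G - P)], which is arbitrarily small. *)
  assert (Hsq : RInt (fun s => Im (G s 0) * Im (G s 0)) 0 (2 * PI) = 0).
  { assert (Hge : 0 <= RInt (fun s => Im (G s 0) * Im (G s 0)) 0 (2 * PI)).
    { apply RInt_ge_0; [lra| |intros; nra]. apply ex_RInt_continuous_all. intros t.
      apply (continuous_mult (K := R_AbsRing)); apply continuous_Im, Hc. }
    apply Rle_antisym; [|exact Hge].
    apply le_epsilon. intros e He. rewrite Rplus_0_l.
    destruct (HG (e / (2 * PI * (M + 1)))) as [l [D [_ E]]].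
    { apply Rdiv_lt_0_compat; [lra|]. apply Rmult_lt_0_compat; lra. }
    destruct (Hev l D) as [Hl1 Hl2].
    assert (Hex2 : ex_RInt (fun s => Im (G s 0) * Im (G s 0)) 0 (2 * PI)).
    { apply ex_RInt_continuous_all. intros t. apply (continuous_mult (K := R_AbsRing)); apply continuous_Im, Hc. }
    replace (RInt (fun s => Im (G s 0) * Im (G s 0)) 0 (2 * PI))
      with (RInt (fun s => minus (Im (G s 0) * Im (G s 0)) (Im (G s 0) * Im (trig_sum l s 0))) 0 (2 * PI)).
    2:{ rewrite (RInt_minus (V := R_CompleteNormedModule)) by auto. rewrite Hl2. unfold minus, plus, opp; simpl. ring. }
    apply Rle_trans with (RInt (fun _ => M * (e / (2 * PI * (M + 1)))) 0 (2 * PI)).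
    - apply RInt_le; [lra| |apply ex_RInt_const|].
      + apply (ex_RInt_minus (V := R_NormedModule)); auto.
      + intros s _. unfold minus, plus, opp; simpl.
        replace (Im (G s 0) * Im (G s 0) + - (Im (G s 0) * Im (trig_sum l s 0)))
          with (Im (G s 0) * Im (G s 0 - trig_sum l s 0)%C) by (rewrite Im_minus; ring).
        eapply Rle_trans; [apply Rle_abs|]. rewrite Rabs_mult.
        apply Rmult_le_compat; try apply Rabs_pos.
        * eapply Rle_trans; [apply im_le_Cmod|eapply W_Cmod; eauto].
        * eapply Rle_trans; [apply im_le_Cmod|apply E].
    - rewrite RInt_const. unfold scal; simpl; unfold mult; simpl.
      apply Rle_trans with (2 * PI * ((M + 1) * (e / (2 * PI * (M + 1))))); [|right; field; lra].
      assert (0 < e / (2 * PI * (M + 1))) by (apply Rdiv_lt_0_compat; [lra|]; apply Rmult_lt_0_compat; lra).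
      rewrite Rminus_0_r. apply Rmult_le_compat_l; [lra|]. apply Rmult_le_compat_r; lra. }
  intros s. destruct (angle_mod s) as [s1 [Hs1 [k ->]]].
  rewrite (W_period _ _ _ _ _ _ _ HG).
  apply (RInt_sq_eq_0 (fun s => Im (G s 0))); auto; [|lra].
  intros; apply continuous_Im, Hc.
Qed.

End SineCoefficients.

(** * The boundary equation as a strictly differentiable map *)

Section Equation.
Context (m : nat) (kap : posreal) (b : R).
Context (hm : (1 <= m)%nat) (hb : 0 < b) (hbk : b * (1 + kap) < 1).
Local Notation W := (W m kap).
Local Notation SD := (SD m kap).

(* The unknown [x] in [l1] encodes [a_{i+1} = x i / om i]; [om i] is of order [(i+1)^2], which makes
   the curve [C^{1+alpha}] and pays for the derivative lost in the equation. *)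
Definition om (i : nat) : R := INR (freq m i) * fwt m kap i.

Definition kz (i : nat) : Z := (Z.of_nat (freq m i) - 1)%Z.

Lemma freq_ge_1 i : (1 <= freq m i)%nat.
Proof. unfold freq. nia. Qed.

Lemma kz_ge_0 i : (0 <= kz i)%Z.
Proof. unfold kz. assert (A := freq_ge_1 i). lia. Qed.

Lemma om_pos i : 0 < om i.
Proof.
  unfold om. assert (A := fwt_ge_1 m kap i). assert (B := freq_ge_1 i).
  apply le_INR in B. simpl in B. nra.
Qed.

Lemma kz_freq i : (- kz i = 1 + Z.of_nat m * (- Z.of_nat (S i)))%Z.
Proof. unfold kz, freq. rewrite Nat2Z.inj_mul. ring. Qed.

Lemma wt_kz_l i : wt kap (- kz i) 0 <= fwt m kap i.
Proof.
  unfold wt, fwt. assert (A := kz_ge_0 i). rewrite Z.abs_opp, Z.abs_eq, Rplus_0_r by auto.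
  unfold kz. rewrite minus_IZR, <- INR_IZR_INZ. assert (Hk := cond_pos kap). simpl. lra.
Qed.

Lemma wt_kz_r i : wt kap 0 (- kz i) <= fwt m kap i.
Proof. eapply Rle_trans; [|apply (wt_kz_l i)]. unfold wt. simpl. lra. Qed.

Lemma om_inv_fwt i : / om i * fwt m kap i <= 1.
Proof.
  unfold om. assert (A := fwt_ge_1 m kap i). assert (B := freq_ge_1 i). apply le_INR in B. simpl in B.
  rewrite Rinv_mult, Rmult_assoc, Rinv_l, Rmult_1_r by lra.
  rewrite <- Rinv_1. apply Rinv_le_contravar; lra.
Qed.

Lemma om_inv_kz_fwt i : IZR (kz i) / om i * fwt m kap i <= 1.
Proof.
  unfold om. assert (A := fwt_ge_1 m kap i). assert (B := freq_ge_1 i). apply le_INR in B. simpl in B.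
  replace (IZR (kz i) / (INR (freq m i) * fwt m kap i) * fwt m kap i) with (IZR (kz i) * / INR (freq m i)) by (field; lra).
  apply (Rmult_le_reg_r (INR (freq m i))); [lra|]. rewrite Rmult_assoc, Rinv_l by lra.
  unfold kz. rewrite minus_IZR, <- INR_IZR_INZ. lra.
Qed.

(** [lin Bf] and [lin Bft] are [f(w)] and [f(tau)]; [lin BP] and [lin BPt] are [- w f'(w)] and
    [- tau f'(tau)], whence the minus signs in [Pw] and [Pt]. For [m = 1] the exponent [kz 0] is 0
    and the first mode is a translation. *)
Definition Bf (i : nat) (s t : R) : C := (RtoC (/ om i) * mono (- kz i) 0 s t)%C.
Definition Bft (i : nat) (s t : R) : C := (RtoC (/ om i) * mono 0 (- kz i) s t)%C.
Definition BP (i : nat) (s t : R) : C := (RtoC (IZR (kz i) / om i) * mono (- kz i) 0 s t)%C.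
Definition BPt (i : nat) (s t : R) : C := (RtoC (IZR (kz i) / om i) * mono 0 (- kz i) s t)%C.
(* [f(w) - f(tau) = - (w - tau) lin BD], which removes the singularity of the Cauchy quotient. *)
Definition BD (i : nat) (s t : R) : C :=
  csum (fun j => RtoC (/ om i) * mono (- Z.of_nat (S j)) (Z.of_nat j - kz i) s t)%C (Z.to_nat (kz i)).

Lemma W_block sg d c p q i j : (p + sg * q = d + Z.of_nat m * j)%Z -> 0 <= c ->
  wt kap p q <= fwt m kap i -> c * fwt m kap i <= 1 -> W sg d (fun s t => RtoC c * mono p q s t)%C 1.
Proof.
  intros E Hc Hw H1. eapply W_mono; [exact E|]. rewrite Rabs_pos_eq by auto.
  eapply Rle_trans; [apply Rmult_le_compat_l; eauto|auto].
Qed.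

Lemma om_inv_pos i : 0 <= / om i.
Proof. left. apply Rinv_0_lt_compat, om_pos. Qed.

Lemma kz_om_pos i : 0 <= IZR (kz i) / om i.
Proof. apply Rmult_le_pos; [apply IZR_le, kz_ge_0|apply om_inv_pos]. Qed.

Lemma W_Bf sg i : W sg 1 (Bf i) 1.
Proof.
  apply (W_block sg 1 _ _ _ i (- Z.of_nat (S i))); auto using om_inv_pos, wt_kz_l, om_inv_fwt.
  rewrite kz_freq. ring.
Qed.

Lemma W_Bft sg i : W sg sg (Bft i) 1.
Proof.
  apply (W_block sg sg _ _ _ i (- (sg * Z.of_nat (S i)))); auto using om_inv_pos, wt_kz_r, om_inv_fwt.
  rewrite kz_freq. ring.
Qed.

Lemma W_BP sg i : W sg 1 (BP i) 1.
Proof.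
  apply (W_block sg 1 _ _ _ i (- Z.of_nat (S i))); auto using kz_om_pos, wt_kz_l, om_inv_kz_fwt.
  rewrite kz_freq. ring.
Qed.

Lemma W_BPt sg i : W sg sg (BPt i) 1.
Proof.
  apply (W_block sg sg _ _ _ i (- (sg * Z.of_nat (S i)))); auto using kz_om_pos, wt_kz_r, om_inv_kz_fwt.
  rewrite kz_freq. ring.
Qed.

Lemma rsum_const c n : rsum (fun _ => c) n = INR n * c.
Proof. induction n; [simpl; ring|]. rewrite S_INR. simpl rsum. rewrite IHn. ring. Qed.

(** The sum has [kz i] terms, each of weight exactly [fwt i], because
    [(j + 1) + (kz i - j) = freq i]. The factor [freq i] in [om] absorbs their number. *)
Lemma W_BD i : W 1 0 (BD i) 1.
Proof.
  assert (Hk := kz_ge_0 i).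
  eapply W_weaken.
  - apply (W_csum _ _ 1 0 (fun j s t => RtoC (/ om i) * mono (- Z.of_nat (S j)) (Z.of_nat j - kz i) s t)%C
      (fun _ => / om i * fwt m kap i)).
    intros j Hj. eapply W_mono.
    + instantiate (1 := (- Z.of_nat (S i))%Z). assert (A := kz_freq i). lia.
    + rewrite Rabs_pos_eq by apply om_inv_pos. apply Rmult_le_compat_l; [apply om_inv_pos|].
      unfold wt, fwt. apply Rplus_le_compat_l. apply Rmult_le_compat_l; [left; apply cond_pos|].
      rewrite <- plus_IZR, INR_IZR_INZ. apply IZR_le. unfold kz in *. lia.
  - rewrite rsum_const, INR_IZR_INZ, Z2Nat.id by auto.
    rewrite <- Rmult_assoc. apply om_inv_kz_fwt.
Qed.

(* With [w = e^{is}], [tau = e^{it}]: [phi] and [phit] are the conformal map at [w] and [tau],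
   [Pw] and [Pt] are [w phi'(w)] and [tau phi'(tau)], so that the tangent vector is [i Pw]. *)
Definition phi : vmap := fun x s t => (b * mono 1 0 s t + lin Bf x s t)%C.
Definition phit : vmap := fun x s t => (b * mono 0 1 s t + lin Bft x s t)%C.
Definition Pw : vmap := fun x s t => (b * mono 1 0 s t - lin BP x s t)%C.
Definition Pt : vmap := fun x s t => (b * mono 0 1 s t - lin BPt x s t)%C.

Lemma W_bmono_l sg : W sg 1 (fun s t => b * mono 1 0 s t)%C (b * (1 + kap)).
Proof. apply (W_mono _ _ sg 1 1 0 b 0); [ring|]. rewrite Rabs_pos_eq by lra. unfold wt. simpl. lra. Qed.

Lemma W_bmono_r sg : W sg sg (fun s t => b * mono 0 1 s t)%C (b * (1 + kap)).
Proof. apply (W_mono _ _ sg sg 0 1 b 0); [ring|]. rewrite Rabs_pos_eq by lra. unfold wt. simpl. lra. Qed.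

Lemma SD_phi sg : SD sg 1 phi (lin Bf).
Proof.
  eapply SD_ext; [| |apply SD_plus; [eapply SD_const, W_bmono_l|eapply SD_lin, W_Bf]]; intros; [reflexivity|simpl; ring].
Qed.

Lemma SD_phit sg : SD sg sg phit (lin Bft).
Proof.
  eapply SD_ext; [| |apply SD_plus; [eapply SD_const, W_bmono_r|eapply SD_lin, W_Bft]]; intros; [reflexivity|simpl; ring].
Qed.

Lemma SD_Pw sg : SD sg 1 Pw (fun x s t => - lin BP x s t)%C.
Proof.
  eapply SD_ext; [| |apply SD_minus; [eapply SD_const, W_bmono_l|eapply SD_lin, W_BP]]; intros; [reflexivity|simpl; ring].
Qed.

Lemma SD_Pt sg : SD sg sg Pt (fun x s t => - lin BPt x s t)%C.
Proof.
  eapply SD_ext; [| |apply SD_minus; [eapply SD_const, W_bmono_r|eapply SD_lin, W_BPt]]; intros; [reflexivity|simpl; ring].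
Qed.

Lemma SD_bD : SD 1 0 (fun x s t => b - lin BD x s t)%C (fun x s t => - lin BD x s t)%C.
Proof.
  eapply SD_ext; [| |apply SD_minus; [eapply SD_const, (W_const _ _ 1 b)|eapply SD_lin, W_BD]]; intros; [reflexivity|simpl; ring].
Qed.

(** Within radius [b / 2] the perturbation has at most half the size of [b], so the Neumann series
    has ratio [1 / 2]. *)
Lemma bD_inv x : l1 x (b / 2) ->
  W 1 0 (fun s t => / (b - lin BD x s t))%C (/ b * / (1 - / 2)) /\ forall s t, (b - lin BD x s t)%C <> 0%C.
Proof.
  intros Hx.
  assert (HD : W 1 0 (fun s t => RtoC (/ b) * lin BD x s t)%C (/ 2)).
  { eapply W_weaken; [apply W_scal, (W_CSer _ _ 1 0 BD 1 x (b / 2)); [apply W_BD|auto]|].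
    rewrite Rabs_pos_eq by (left; now apply Rinv_0_lt_compat). right. field. lra. }
  assert (Hb : RtoC b <> 0%C) by (intros E; apply RtoC_inj in E; lra).
  assert (NZ : forall s t, (1 - RtoC (/ b) * lin BD x s t)%C <> 0%C).
  { intros s t. apply (Cinv_one_minus_neq _ (/ 2)); [exact (W_Cmod _ _ _ _ _ _ s t HD)|lra]. }
  assert (E : forall s t, (b - lin BD x s t = b * (1 - RtoC (/ b) * lin BD x s t))%C).
  { intros. rewrite RtoC_inv by lra. field. auto. }
  split.
  - apply (W_ext _ _ _ _ (fun s t => RtoC (/ b) * / (1 - RtoC (/ b) * lin BD x s t))%C).
    + intros s t. specialize (NZ s t). rewrite E. rewrite RtoC_inv in * by lra. field.
      split; auto. intros F. apply NZ. transitivity ((b - lin BD x s t) / b)%C; [field; auto|].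
      rewrite F. field. auto.
    + eapply W_weaken; [apply W_scal, W_inv; [apply HD|lra]|].
      rewrite Rabs_pos_eq by (left; now apply Rinv_0_lt_compat). lra.
  - intros s t. rewrite E. intros F. apply (f_equal (fun z => / b * z)%C) in F.
    apply (NZ s t). transitivity (/ b * (b * (1 - RtoC (/ b) * lin BD x s t)))%C; [field; auto|]. rewrite F. ring.
Qed.

Lemma SD_bD_inv : SD 1 0 (fun x s t => / (b - lin BD x s t))%C
  (fun x s t => / b * / b * lin BD x s t)%C.
Proof.
  eapply SD_ext; [| |apply SD_inv; [apply SD_bD|]].
  - reflexivity.
  - intros x s t. cbv beta. rewrite !lin_zeroseq. unfold Cminus. rewrite Copp_0, Cplus_0_r. ring.
  - exists (b / 2), (/ b * / (1 - / 2)). split; [lra|]. apply bD_inv.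
Qed.

(* [(conj z - conj xi) / (z - xi) dxi = i integrand1 dt], by cancelling [w - tau]. *)
Definition integrand1 : vmap := fun x s t =>
  (- mono (- 1) (- 1) s t * ((b - Cconj (lin BD x s t)) * / (b - lin BD x s t)) * Pt x s t)%C.

(** On the disc the quotient in the middle of [integrand1] is 1 and [Pt] is [b tau], so the
    variation of the quotient loses its denominator [b] to [Pt]. *)
Definition dintegrand1 : vmap := fun x s t =>
  (mono (- 1) (- 1) s t * ((Cconj (lin BD x s t) - lin BD x s t) * mono 0 1 s t + lin BPt x s t))%C.

Lemma Cconj_R (r : R) : Cconj r = r.
Proof. apply Cext; simpl; ring. Qed.

Lemma RtoC_b_neq_0 : RtoC b <> 0%C.
Proof. intros E; apply RtoC_inj in E; lra. Qed.

Lemma phi_0 s t : phi zeroseq s t = (b * mono 1 0 s t)%C.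
Proof. unfold phi. rewrite lin_zeroseq. ring. Qed.
Lemma phit_0 s t : phit zeroseq s t = (b * mono 0 1 s t)%C.
Proof. unfold phit. rewrite lin_zeroseq. ring. Qed.
Lemma Pw_0 s t : Pw zeroseq s t = (b * mono 1 0 s t)%C.
Proof. unfold Pw. rewrite lin_zeroseq. ring. Qed.
Lemma Pt_0 s t : Pt zeroseq s t = (b * mono 0 1 s t)%C.
Proof. unfold Pt. rewrite lin_zeroseq. ring. Qed.

Lemma SD_integrand1 : SD 1 (- 1) integrand1 dintegrand1.
Proof.
  assert (H1 := SD_conj _ _ _ _ _ _ SD_bD).
  assert (H2 := SD_mult _ _ 1 (- 0) 0 0 _ _ _ _ eq_refl H1 SD_bD_inv).
  assert (H3 : W 1 (- 2) (fun s t => - mono (- 1) (- 1) s t)%C (wt kap (-1) (-1))).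
  { apply (W_ext _ _ _ _ (fun s t => RtoC (- (1)) * mono (-1) (-1) s t)%C); [intros; rewrite RtoC_opp; ring|].
    eapply (W_mono _ _ 1 (-2) (-1) (-1) (- (1)) 0); [ring|]. rewrite Rabs_Ropp, Rabs_R1. lra. }
  assert (H4 := SD_mult _ _ 1 (- 2) 0 (- 2) _ _ _ _ eq_refl (SD_const _ _ _ _ _ _ H3) H2).
  assert (H5 := SD_mult _ _ 1 (- 2) 1 (- 1) _ _ _ _ eq_refl H4 (SD_Pt 1)).
  eapply SD_ext; [| |exact H5].
  - intros x s t. unfold integrand1. cbv beta. rewrite Cminus_conj, Cconj_R. reflexivity.
  - intros x s t. unfold dintegrand1. cbv beta. rewrite !lin_zeroseq, Pt_0.
    replace (b - 0)%C with (RtoC b) by ring. rewrite Copp_conj, Cconj_R.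
    field. apply RtoC_b_neq_0.
Qed.

Definition I1 : vmap := fun x => mean (integrand1 x).
Definition dI1 : vmap := fun x => mean (dintegrand1 x).

(** As for [integrand1], the factor [i] of [d xi = i Pt dt] is left out. *)
Definition integrand2 : vmap := fun x s t =>
  (phit x s t * Cconj (phit x s t) * / (1 - phi x s t * phit x s t) * Pt x s t)%C.

(* [1 / (1 - b^2 w tau)], the value of [1 / (1 - z xi)] on the disc of radius [b]. *)
Definition kernel2 (s t : R) : C := (/ (1 - RtoC (b * b) * mono 1 1 s t))%C.

Definition dintegrand2 : vmap := fun x s t =>
  ((lin Bft x s t * (b * mono 0 (-1) s t) + b * mono 0 1 s t * Cconj (lin Bft x s t))
     * kernel2 s t * (b * mono 0 1 s t)
   + b * b * (kernel2 s t * kernel2 s t)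
     * (lin Bf x s t * (b * mono 0 1 s t) + b * mono 1 0 s t * lin Bft x s t) * (b * mono 0 1 s t)
   - b * b * kernel2 s t * lin BPt x s t)%C.

Lemma phi_phit_W x r : l1 x r ->
  W (-1) 0 (fun s t => phi x s t * phit x s t)%C ((b * (1 + kap) + r) * (b * (1 + kap) + r)).
Proof.
  intros Hx. apply (W_mult_deg _ _ (-1) 1 (-1)); [reflexivity| |].
  - apply W_plus; [apply W_bmono_l|]. rewrite <- (Rmult_1_l r). apply W_CSer; auto. apply W_Bf.
  - apply W_plus; [apply W_bmono_r|]. rewrite <- (Rmult_1_l r). apply W_CSer; auto. apply W_Bft.
Qed.

(** Half of the room left by [hbk]: for [x] in this ball [phi] has norm at most
    [b (1 + kap) + margin < 1], and so has its product with [phit]. *)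
Definition margin : R := (1 - b * (1 + kap)) / 2.

Lemma margin_pos : 0 < margin.
Proof. unfold margin. lra. Qed.

Lemma bk_pos : 0 < b * (1 + kap).
Proof. assert (Hk := cond_pos kap). apply Rmult_lt_0_compat; lra. Qed.

Lemma phi_phit_inv x : l1 x margin ->
  W (-1) 0 (fun s t => / (1 - phi x s t * phit x s t))%C
    (/ (1 - (b * (1 + kap) + margin) * (b * (1 + kap) + margin))) /\
  forall s t, (1 - phi x s t * phit x s t)%C <> 0%C.
Proof.
  intros Hx. assert (H := phi_phit_W x _ Hx).
  assert (Q : (b * (1 + kap) + margin) * (b * (1 + kap) + margin) < 1).
  { assert (A := bk_pos). unfold margin. nra. }
  split.
  - apply (W_inv _ _ (-1) (fun s t => phi x s t * phit x s t)%C); auto.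
  - intros s t. eapply Cinv_one_minus_neq; [eapply W_Cmod in H; apply H|auto].
Qed.

Lemma mono_conj_01 s t : Cconj (mono 0 1 s t) = mono 0 (-1) s t.
Proof. apply (mono_conj 0 1). Qed.

Lemma phi_phit_0 s t : (phi zeroseq s t * phit zeroseq s t)%C = (RtoC (b * b) * mono 1 1 s t)%C.
Proof.
  rewrite phi_0, phit_0, RtoC_mult.
  replace (mono 1 1 s t) with (mono 1 0 s t * mono 0 1 s t)%C by apply mono_mult. ring.
Qed.

Lemma SD_integrand2 : SD (-1) (- 1) integrand2 dintegrand2.
Proof.
  assert (H1 := SD_mult _ _ (-1) (-1) (- -1) 0 _ _ _ _ eq_refl (SD_phit (-1)) (SD_conj _ _ _ _ _ _ (SD_phit (-1)))).
  assert (H2 := SD_mult _ _ (-1) 1 (-1) 0 _ _ _ _ eq_refl (SD_phi (-1)) (SD_phit (-1))).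
  assert (H3 := SD_minus _ _ _ _ _ _ _ _ (SD_const _ _ _ _ _ _ (W_const m kap (-1) 1)) H2).
  assert (H4 := SD_inv _ _ _ _ _ H3). cbv beta in H4.
  assert (H5 : exists r K, 0 < r /\ forall x, l1 x r ->
     W (-1) 0 (fun s t => / (1 - phi x s t * phit x s t))%C K /\
     forall s t, (1 - phi x s t * phit x s t)%C <> 0%C).
  { exists margin. eexists. split; [apply margin_pos|]. apply phi_phit_inv. }
  specialize (H4 H5). clear H5.
  assert (H6 := SD_mult _ _ (-1) 0 0 0 _ _ _ _ eq_refl H1 H4).
  assert (H7 := SD_mult _ _ (-1) 0 (-1) (-1) _ _ _ _ eq_refl H6 (SD_Pt (-1))).
  eapply SD_ext; [| |exact H7].
  - intros x s t. reflexivity.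
  - intros x s t. unfold dintegrand2. cbv beta.
    rewrite phi_phit_0. fold (kernel2 s t). rewrite Pt_0, phi_0, phit_0, Cmult_conj, Cconj_R, mono_conj_01.
    replace (b * mono 0 1 s t * (b * mono 0 (-1) s t))%C with (b * b)%C.
    + ring.
    + transitivity (b * b * (mono 0 1 s t * mono 0 (-1) s t))%C; [|ring].
      rewrite mono_mult. simpl Z.add. rewrite mono_00. ring.
Qed.

Definition I2 : vmap := fun x => mean (integrand2 x).
Definition dI2 : vmap := fun x => mean (dintegrand2 x).

(* The boundary equation reads [Im (GI + 2 Om GO) = 0]. *)
Definition GI : vmap := fun x s t => ((I1 x s t - I2 x s t) * Pw x s t)%C.
Definition GO : vmap := fun x s t => (Cconj (phi x s t) * Pw x s t)%C.

(** * The linearized equation *)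

(* [kernel2 = 1 + b^2 w tau kernel2] turns the moments of [kernel2] and of its square into
   one-step recursions; boundedness kills the moments of positive index. *)
Lemma recursion_bounded_zero (a : nat -> C) (z : C) M : Cmod z < 1 ->
  (forall q, Cmod (a q) <= M) -> (forall q, a q = z * a (S q))%C -> forall q, a q = 0%C.
Proof.
  intros Hz HM Hr q. apply Cmod_le_eps_eq. intros e He.
  replace (a q - 0)%C with (a q) by ring.
  assert (H0 := Cmod_ge_0 z). assert (HM0 : 0 <= M) by (eapply Rle_trans; [apply Cmod_ge_0|apply (HM O)]).
  assert (H : forall n q, Cmod (a q) <= Cmod z ^ n * M).
  { induction n; intros p; [simpl; rewrite Rmult_1_l; apply HM|].
    rewrite Hr, Cmod_mult. simpl. rewrite Rmult_assoc. apply Rmult_le_compat_l; auto. }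
  destruct (pow_small (Cmod z) (e / (M + 1))) as [n Hn]; [lra|apply Rdiv_lt_0_compat; lra|].
  eapply Rle_trans; [apply (H n)|].
  apply Rle_trans with (e / (M + 1) * (M + 1)); [|right; field; lra].
  apply Rmult_le_compat; auto; [apply pow_le; auto|lra].
Qed.

Lemma kernel2_W : W (-1) 0 kernel2 (/ (1 - (b * (1 + kap) + margin) * (b * (1 + kap) + margin))).
Proof.
  eapply W_ext; [|apply (phi_phit_inv zeroseq), zeroseq_l1; left; apply margin_pos].
  intros s t. unfold kernel2. now rewrite phi_phit_0.
Qed.

Lemma b_lt_1 : b < 1.
Proof. assert (Hk := cond_pos kap). nra. Qed.

Lemma kernel2_neq_0 s t : (1 - RtoC (b * b) * mono 1 1 s t)%C <> 0%C.
Proof.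
  assert (B := b_lt_1).
  apply (Cinv_one_minus_neq _ (b * b)); [|nra].
  rewrite Cmod_RC, Cmod_mono, Rabs_pos_eq by nra. lra.
Qed.

Lemma kernel2_eq s t : kernel2 s t = (1 + RtoC (b * b) * mono 1 1 s t * kernel2 s t)%C.
Proof. unfold kernel2. field. apply kernel2_neq_0. Qed.

Definition kernel_moment (q : Z) (s : R) : C := mean (fun s t => mono 0 q s t * kernel2 s t)%C s 0.
Definition kernel_sq_moment (q : Z) (s : R) : C := mean (fun s t => mono 0 q s t * (kernel2 s t * kernel2 s t))%C s 0.

Lemma ccont_kernel2 s : ccont (kernel2 s).
Proof. eapply W_ccont_t, kernel2_W. Qed.

Lemma ccont_mult f g : ccont f -> ccont g -> ccont (fun t => f t * g t)%C.
Proof. intros Hf Hg t. apply continuous_C_mult; auto. Qed.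

Definition zb (s : R) : C := (RtoC (b * b) * cis s)%C.

Lemma mono_split p q s t : mono p q s t = (mono p 0 s t * mono 0 q s t)%C.
Proof. rewrite mono_mult. f_equal; ring. Qed.

Lemma mono_10 s t : mono 1 0 s t = cis s.
Proof. unfold mono. f_equal. ring. Qed.

Lemma mean_rec (q : Z) (F G : R -> R -> C) s : ccont (F s) -> ccont (G s) ->
  (forall t, F s t = (G s t + RtoC (b * b) * mono 1 1 s t * F s t)%C) ->
  mean (fun s t => mono 0 q s t * F s t)%C s 0 =
  (mean (fun s t => mono 0 q s t * G s t)%C s 0 + zb s * mean (fun s t => mono 0 (q + 1) s t * F s t)%C s 0)%C.
Proof.
  intros HF HG H.
  rewrite <- (mean_scal zb (fun s t => mono 0 (q + 1) s t * F s t)%C) by (apply ccont_mult; [apply ccont_mono_t|auto]).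
  rewrite <- (mean_plus (fun s t => mono 0 q s t * G s t)%C).
  - apply mean_ext. intros u. rewrite H at 1. unfold zb.
    rewrite (mono_split 1 1), mono_10.
    replace (mono 0 (q + 1) s u) with (mono 0 q s u * mono 0 1 s u)%C by apply mono_mult. ring.
  - apply ccont_mult; [apply ccont_mono_t|auto].
  - apply ccont_scal, ccont_mult; [apply ccont_mono_t|auto].
Qed.

Lemma Cmod_zb s : Cmod (zb s) < 1.
Proof. unfold zb. assert (B := b_lt_1). rewrite Cmod_RC, Cmod_cis, Rabs_pos_eq; nra. Qed.

Lemma kernel_moment_rec q s : kernel_moment q s = ((if Z.eqb q 0 then 1 else 0)%R + zb s * kernel_moment (q + 1) s)%C.
Proof.
  unfold kernel_moment. rewrite (mean_rec q kernel2 (fun _ _ => 1%C)).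
  - f_equal. rewrite (mean_ext _ (mono 0 q)) by (intros; ring).
    rewrite mean_mono. destruct (Z.eqb q 0); [apply mono_00|reflexivity].
  - apply ccont_kernel2.
  - apply ccont_const.
  - intros t. apply kernel2_eq.
Qed.

Lemma kernel_sq_moment_rec q s : kernel_sq_moment q s = (kernel_moment q s + zb s * kernel_sq_moment (q + 1) s)%C.
Proof.
  unfold kernel_sq_moment, kernel_moment. rewrite (mean_rec q (fun s t => kernel2 s t * kernel2 s t)%C kernel2).
  - reflexivity.
  - apply ccont_mult; apply ccont_kernel2.
  - apply ccont_kernel2.
  - intros t. rewrite kernel2_eq at 1. ring.
Qed.

Lemma mean_mono_bound F M q s : W (-1) 0 F M -> Cmod (mean (fun s t => mono 0 q s t * F s t)%C s 0) <= M.
Proof.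
  intros H. apply mean_bound.
  - apply ccont_mult; [apply ccont_mono_t|eapply W_ccont_t; eauto].
  - intros u. rewrite Cmod_mult, Cmod_mono, Rmult_1_l. eapply W_Cmod; eauto.
Qed.

Lemma kernel_moment_pos q s : (1 <= q)%Z -> kernel_moment q s = 0%C.
Proof.
  intros Hq. assert (A := recursion_bounded_zero (fun n => kernel_moment (1 + Z.of_nat n) s) (zb s) _ (Cmod_zb s)
    (fun n => mean_mono_bound _ _ _ s kernel2_W)).
  replace q with (1 + Z.of_nat (Z.to_nat (q - 1)))%Z by lia.
  apply A. intros p. rewrite kernel_moment_rec. destruct (Z.eqb_spec (1 + Z.of_nat p) 0); [lia|].
  replace (1 + Z.of_nat p + 1)%Z with (1 + Z.of_nat (S p))%Z by lia. ring.
Qed.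

(** This is the coefficient of [tau^k] in the geometric series [1 / (1 - zb tau)]. *)
Lemma kernel_moment_neg k s : kernel_moment (- Z.of_nat k) s = (zb s ^ k)%C.
Proof.
  induction k.
  - simpl. rewrite kernel_moment_rec. simpl. rewrite kernel_moment_pos by lia. ring.
  - rewrite kernel_moment_rec. destruct (Z.eqb_spec (- Z.of_nat (S k)) 0); [lia|].
    replace (- Z.of_nat (S k) + 1)%Z with (- Z.of_nat k)%Z by lia.
    rewrite IHk, Cpow_S. ring.
Qed.

Lemma kernel_sq_moment_pos q s : (1 <= q)%Z -> kernel_sq_moment q s = 0%C.
Proof.
  intros Hq. assert (A := recursion_bounded_zero (fun n => kernel_sq_moment (1 + Z.of_nat n) s) (zb s) _ (Cmod_zb s)
    (fun n => mean_mono_bound _ _ _ s (W_mult_deg _ _ _ _ _ _ _ _ _ _ eq_refl kernel2_W kernel2_W))).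
  replace q with (1 + Z.of_nat (Z.to_nat (q - 1)))%Z by lia.
  apply A. intros p. rewrite kernel_sq_moment_rec, kernel_moment_pos by lia.
  replace (1 + Z.of_nat p + 1)%Z with (1 + Z.of_nat (S p))%Z by lia. ring.
Qed.

(** The coefficient of [tau^(k-1)] in [1 / (1 - zb tau)^2] is [k zb^(k-1)]; the extra factor [zb]
    avoids the exponent [k - 1] at [k = 0]. *)
Lemma kernel_sq_moment_neg k s : (zb s * kernel_sq_moment (1 - Z.of_nat k) s)%C = (INR k * zb s ^ k)%C.
Proof.
  induction k.
  - rewrite kernel_sq_moment_pos by lia. simpl. ring.
  - replace (1 - Z.of_nat (S k))%Z with (- Z.of_nat k)%Z by lia.
    rewrite kernel_sq_moment_rec, kernel_moment_neg. replace (- Z.of_nat k + 1)%Z with (1 - Z.of_nat k)%Z by lia.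
    rewrite IHk, S_INR, RtoC_plus, Cpow_S. ring.
Qed.

Lemma mean_csum (F : nat -> R -> R -> C) n s t : (forall j, ccont (F j s)) ->
  mean (fun s t => csum (fun j => F j s t) n) s t = csum (fun j => mean (F j) s t) n.
Proof.
  intros H. assert (Hc : forall n, ccont (fun t => csum (fun j => F j s t) n)).
  { clear n. induction n; intros u; simpl; [apply continuous_const|].
    apply continuous_C_plus; [apply IHn|apply H]. }
  induction n; simpl.
  - unfold mean. rewrite CInt_const. ring.
  - rewrite (mean_plus (fun s t => csum (fun j => F j s t) n) (F n)); auto. now rewrite IHn.
Qed.

Lemma mean_scal_mono (c : R) p q s t : mean (fun s t => c * mono p q s t)%C s t =
  (c * (if Z.eqb q 0 then mono p 0 s t else 0))%C.
Proof.
  rewrite (mean_scal (fun _ => RtoC c) (mono p q)) by apply ccont_mono_t. now rewrite mean_mono.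
Qed.

Lemma csum_0 n : csum (fun _ => RtoC 0) n = 0%C.
Proof. induction n; simpl; [easy|rewrite IHn; ring]. Qed.

(** Every monomial of the expanded derivative has a nonzero frequency in [tau]: [kz n - j > 0] in
    [A1], [j - kz n < 0] in [A2] for [j < kz n], and [-1 - kz n < 0] in [A3]. All of them average to
    0. *)
Lemma dI1_unit n s t : dI1 (unit_seq n) s t = 0%C.
Proof.
  unfold dI1. assert (Hk := kz_ge_0 n).
  set (A1 := (fun j s t => RtoC (/ om n) * mono (Z.of_nat j) (kz n - Z.of_nat j) s t)%C).
  set (A2 := (fun j s t => RtoC (/ om n) * mono (- Z.of_nat j - 2) (Z.of_nat j - kz n) s t)%C).
  set (A3 := (fun s t => RtoC (IZR (kz n) / om n) * mono (-1) (-1 - kz n) s t)%C).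
  rewrite (mean_ext _ (fun s t => csum (fun j => A1 j s t) (Z.to_nat (kz n))
     - csum (fun j => A2 j s t) (Z.to_nat (kz n)) + A3 s t)%C).
  - assert (C1 : forall j, ccont (A1 j s)) by (intros; apply ccont_scal, ccont_mono_t).
    assert (C2 : forall j, ccont (A2 j s)) by (intros; apply ccont_scal, ccont_mono_t).
    assert (C3 : ccont (A3 s)) by (apply ccont_scal, ccont_mono_t).
    assert (CC : forall F : nat -> R -> R -> C, (forall j, ccont (F j s)) -> ccont (fun t => csum (fun j => F j s t) (Z.to_nat (kz n)))).
    { intros F HF. generalize (Z.to_nat (kz n)). induction n0; intros u; simpl; [apply continuous_const|].
      apply continuous_C_plus; [apply IHn0|apply HF]. }
    rewrite (mean_plus (fun s t => csum (fun j => A1 j s t) (Z.to_nat (kz n)) - csum (fun j => A2 j s t) (Z.to_nat (kz n)))%C A3); auto.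
    2: { apply ccont_minus; auto. }
    rewrite (mean_minus (fun s t => csum (fun j => A1 j s t) (Z.to_nat (kz n))) (fun s t => csum (fun j => A2 j s t) (Z.to_nat (kz n)))); auto.
    rewrite !mean_csum by auto.
    rewrite (csum_ext (fun j => mean (A1 j) s t) (fun _ => RtoC 0)), (csum_ext (fun j => mean (A2 j) s t) (fun _ => RtoC 0)), csum_0.
    + unfold A3. rewrite mean_scal_mono. destruct (Z.eqb_spec (-1 - kz n) 0); [lia|]. ring.
    + intros j Hj. unfold A2. rewrite mean_scal_mono. destruct (Z.eqb_spec (Z.of_nat j - kz n) 0); [lia|]. ring.
    + intros j Hj. unfold A1. rewrite mean_scal_mono. destruct (Z.eqb_spec (kz n - Z.of_nat j) 0); [lia|]. ring.
  - intros u. unfold dintegrand1. rewrite !lin_unit. unfold BD, BPt.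
    rewrite csum_conj.
    transitivity (csum (fun j => (mono (-1) (-1) s u * mono 0 1 s u) * Cconj (RtoC (/ om n) * mono (- Z.of_nat (S j)) (Z.of_nat j - kz n) s u)) (Z.to_nat (kz n))
      - csum (fun j => (mono (-1) (-1) s u * mono 0 1 s u) * (RtoC (/ om n) * mono (- Z.of_nat (S j)) (Z.of_nat j - kz n) s u)) (Z.to_nat (kz n))
      + RtoC (IZR (kz n) / om n) * (mono (-1) (-1) s u * mono 0 (- kz n) s u))%C.
    + rewrite !csum_scal. ring.
    + rewrite !mono_mult. unfold A3. f_equal. f_equal.
      * apply csum_ext. intros j _. unfold A1. rewrite Cmult_conj, Cconj_R, mono_conj.
        transitivity (RtoC (/ om n) * (mono (-1 + 0) (-1 + 1) s u * mono (- - Z.of_nat (S j)) (- (Z.of_nat j - kz n)) s u))%C; [ring|].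
        rewrite mono_mult. f_equal. f_equal; lia.
      * apply csum_ext. intros j _. unfold A2.
        transitivity (RtoC (/ om n) * (mono (-1 + 0) (-1 + 1) s u * mono (- Z.of_nat (S j)) (Z.of_nat j - kz n) s u))%C; [ring|].
        rewrite mono_mult. f_equal. f_equal; lia.
Qed.

(** [T1] and [T2] come from varying [|xi|^2], [T3] and [T4] from varying the kernel in [z] and in
    [xi], [T5] from varying [d xi]. The moments in [T2] and [T3] have positive index and vanish,
    [T4] cancels [T5], and [T1] remains. *)
Lemma dI2_unit n s t : dI2 (unit_seq n) s t = (RtoC (/ om n * (b * b)) * zb s ^ Z.to_nat (kz n))%C.
Proof.
  unfold dI2. assert (Hk := kz_ge_0 n). set (k := Z.to_nat (kz n)).
  assert (Ek : kz n = Z.of_nat k) by (unfold k; lia).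
  set (c := / om n).
  set (T1 := (fun s t => RtoC (c * (b * b)) * (mono 0 (- Z.of_nat k) s t * kernel2 s t))%C).
  set (T2 := (fun s t => RtoC (c * (b * b)) * (mono 0 (Z.of_nat k + 2) s t * kernel2 s t))%C).
  set (T3 := (fun s t => (RtoC (c * (b * b) * (b * b)) * mono (- Z.of_nat k) 0 s 0) * (mono 0 2 s t * (kernel2 s t * kernel2 s t)))%C).
  set (T4 := (fun s t => (RtoC (c * (b * b)) * zb s) * (mono 0 (1 - Z.of_nat k) s t * (kernel2 s t * kernel2 s t)))%C).
  set (T5 := (fun s t => RtoC (INR k * (c * (b * b))) * (mono 0 (- Z.of_nat k) s t * kernel2 s t))%C).
  assert (CK : ccont (kernel2 s)) by apply ccont_kernel2.
  assert (CM : forall q, ccont (fun t => mono 0 q s t * kernel2 s t)%C) by (intros; apply ccont_mult; auto; apply ccont_mono_t).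
  assert (CM2 : forall q, ccont (fun t => mono 0 q s t * (kernel2 s t * kernel2 s t))%C)
    by (intros; apply ccont_mult; [apply ccont_mono_t|apply ccont_mult; auto]).
  assert (C1 : ccont (T1 s)) by (apply ccont_scal, CM).
  assert (C2 : ccont (T2 s)) by (apply ccont_scal, CM).
  assert (C3 : ccont (T3 s)) by (apply ccont_scal, CM2).
  assert (C4 : ccont (T4 s)) by (apply ccont_scal, CM2).
  assert (C5 : ccont (T5 s)) by (apply ccont_scal, CM).
  assert (CP : forall F G : R -> R -> C, ccont (F s) -> ccont (G s) -> ccont (fun t => F s t + G s t)%C).
  { intros F G HF HG u. apply continuous_C_plus; auto. }
  rewrite (mean_ext _ (fun s t => ((T1 s t + T2 s t) + (T3 s t + T4 s t)) - T5 s t)%C).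
  - rewrite (mean_minus (fun s t => ((T1 s t + T2 s t) + (T3 s t + T4 s t)))%C T5); auto.
    2: { apply (CP (fun s t => T1 s t + T2 s t)%C (fun s t => T3 s t + T4 s t)%C); apply CP; auto. }
    rewrite (mean_plus (fun s t => (T1 s t + T2 s t))%C (fun s t => T3 s t + T4 s t)%C); [|now apply CP|now apply CP].
    rewrite (mean_plus T1 T2), (mean_plus T3 T4) by auto.
    unfold T1, T2, T3, T4, T5.
    rewrite (mean_scal (fun _ => RtoC (c * (b * b))) (fun s t => mono 0 (- Z.of_nat k) s t * kernel2 s t)%C) by auto.
    rewrite (mean_scal (fun _ => RtoC (c * (b * b))) (fun s t => mono 0 (Z.of_nat k + 2) s t * kernel2 s t)%C) by auto.
    rewrite (mean_scal (fun s => RtoC (c * (b * b) * (b * b)) * mono (- Z.of_nat k) 0 s 0)%C (fun s t => mono 0 2 s t * (kernel2 s t * kernel2 s t))%C) by auto.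
    rewrite (mean_scal (fun s => RtoC (c * (b * b)) * zb s)%C (fun s t => mono 0 (1 - Z.of_nat k) s t * (kernel2 s t * kernel2 s t))%C) by auto.
    rewrite (mean_scal (fun _ => RtoC (INR k * (c * (b * b)))) (fun s t => mono 0 (- Z.of_nat k) s t * kernel2 s t)%C) by auto.
    change (mean (fun s t => mono 0 (- Z.of_nat k) s t * kernel2 s t)%C s t) with (kernel_moment (- Z.of_nat k) s).
    change (mean (fun s t => mono 0 (Z.of_nat k + 2) s t * kernel2 s t)%C s t) with (kernel_moment (Z.of_nat k + 2) s).
    change (mean (fun s t => mono 0 2 s t * (kernel2 s t * kernel2 s t))%C s t) with (kernel_sq_moment 2 s).
    change (mean (fun s t => mono 0 (1 - Z.of_nat k) s t * (kernel2 s t * kernel2 s t))%C s t) with (kernel_sq_moment (1 - Z.of_nat k) s).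
    rewrite kernel_moment_neg, kernel_moment_pos, kernel_sq_moment_pos by lia.
    transitivity (RtoC (c * (b * b)) * zb s ^ k + RtoC (c * (b * b)) * (zb s * kernel_sq_moment (1 - Z.of_nat k) s) - RtoC (INR k * (c * (b * b))) * zb s ^ k)%C; [ring|].
    rewrite kernel_sq_moment_neg, (RtoC_mult (INR k)). ring.
  - intros u. unfold dintegrand2. rewrite !lin_unit. unfold Bf, Bft, BPt. fold c. rewrite Ek.
    rewrite Cmult_conj, Cconj_R, mono_conj, <- INR_IZR_INZ.
    replace (INR k / om n) with (INR k * c) by reflexivity.
    assert (Mm : (mono 0 1 s u * mono 0 (-1) s u)%C = 1%C) by (rewrite mono_mult; apply mono_00).
    unfold T1, T2, T3, T4, T5, zb. rewrite <- (mono_10 s u).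
    replace (mono (- Z.of_nat k) 0 s 0) with (mono (- Z.of_nat k) 0 s u) by (unfold mono; f_equal; ring).
    replace (- - Z.of_nat k)%Z with (Z.of_nat k) by ring.
    replace (mono 0 (Z.of_nat k + 2) s u) with (mono 0 (Z.of_nat k) s u * (mono 0 1 s u * mono 0 1 s u))%C
      by (rewrite !mono_mult; f_equal).
    replace (mono 0 2 s u) with (mono 0 1 s u * mono 0 1 s u)%C by (rewrite !mono_mult; f_equal).
    replace (mono 0 (1 - Z.of_nat k) s u) with (mono 0 1 s u * mono 0 (- Z.of_nat k) s u)%C by (rewrite !mono_mult; f_equal).
    replace (- 0)%Z with 0%Z by ring.
    rewrite !RtoC_mult.
    transitivity (RtoC c * mono 0 (- Z.of_nat k) s u * b * b * kernel2 s u * (mono 0 1 s u * mono 0 (-1) s u)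
      + b * mono 0 1 s u * (c * mono 0 (Z.of_nat k) s u) * kernel2 s u * (b * mono 0 1 s u)
      + b * b * (kernel2 s u * kernel2 s u)
     * (c * mono (- Z.of_nat k) 0 s u * (b * mono 0 1 s u) + b * mono 1 0 s u * (c * mono 0 (- Z.of_nat k) s u)) * (b * mono 0 1 s u)
   - b * b * kernel2 s u * (INR k * c * mono 0 (- Z.of_nat k) s u))%C; [ring|].
    rewrite Mm. ring.
Qed.

End Equation.

(** * Bifurcation from a simple eigenvalue in l1 *)

Lemma l1_weighted (fw d y : nat -> R) c M : (forall i, Rabs (d i) <= c * fw i) -> (forall i, 0 <= fw i) ->
  0 <= c -> l1 (fun i => fw i * y i) M -> l1 (fun i => d i * y i) (c * M).
Proof.
  intros Hd Hf Hc H. eapply sumle_mono; [|apply sumle_scal; [apply Hc|apply H]].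
  intros i. simpl. rewrite !Rabs_mult, (Rabs_pos_eq (fw i)) by auto.
  rewrite <- Rmult_assoc. apply Rmult_le_compat_r; [apply Rabs_pos|auto].
Qed.

Section Branch.
(** The system to solve is [lamI i x_i + rI i x + 2 Om (lamO i x_i + rO i x) = 0] for all [i]. The
    remainders are quadratically small in the weighted norm, [h0] makes index 0 the kernel at [Om0],
    [hlamO0] is transversality, and [hLc] lets the inverse consume the weight. *)
Context (fw lamI lamO : nat -> R) (rI rO : nat -> (nat -> R) -> R).
Context (Om0 c K r0 : R).
Context (hfw : forall i, 1 <= fw i) (hc : 0 < c) (hK : 0 <= K) (hr0 : 0 < r0).
Context (hI0 : forall i, rI i zeroseq = 0) (hO0 : forall i, rO i zeroseq = 0).
Context (hI : forall r x x' M, r <= r0 -> l1 x r -> l1 x' r -> l1 (fun i => x i - x' i) M ->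
  l1 (fun i => fw i * (rI i x - rI i x')) (K * r * M)).
Context (hO : forall r x x' M, r <= r0 -> l1 x r -> l1 x' r -> l1 (fun i => x i - x' i) M ->
  l1 (fun i => fw i * (rO i x - rO i x')) (K * r * M)).
Context (h0 : lamI O + 2 * Om0 * lamO O = 0).
Context (hlamO0 : lamO O <> 0) (hlamO0c : Rabs (/ (2 * lamO O)) <= c).
Context (hlamO : forall i, fw i * Rabs (lamO i) <= c).
Context (hL : forall i, lamI (S i) + 2 * Om0 * lamO (S i) <> 0).
Context (hLc : forall i, Rabs (/ (lamI (S i) + 2 * Om0 * lamO (S i))) <= c * fw (S i)).

(** Slot 0 of [v] stores [Om - Om0], so in the direction of [x] it is replaced by the normalized
    coefficient 1. *)
Definition tail1 (v : nat -> R) : nat -> R := fun i => match i with O => 1 | S _ => v i end.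

(* The remainder divided by [s]; at [s = 0] this is [0 * / 0 = 0] since [rem i zeroseq = 0]. *)
Definition rho (rem : nat -> (nat -> R) -> R) (s : R) (v : nat -> R) (i : nat) : R :=
  rem i (fun j => s * tail1 v j) / s.

Lemma tail1_l1 v r : l1 v r -> l1 (tail1 v) (1 + r).
Proof.
  intros H. eapply sumle_mono; [|apply (sumle_plus _ _ _ _ (unit_seq_l1 O) H)].
  intros [|i]; simpl; unfold unit_seq; simpl.
  - rewrite Rabs_R1. assert (A := Rabs_pos (v O)). lra.
  - rewrite Rabs_R0. lra.
Qed.

Lemma tail1_diff v v' M : l1 (fun i => v i - v' i) M -> l1 (fun i => tail1 v i - tail1 v' i) M.
Proof.
  intros H. eapply sumle_mono; [|exact H]. intros [|i]; simpl; [|lra].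
  rewrite Rminus_diag, Rabs_R0. apply Rabs_pos.
Qed.

Lemma scaled_tail1_l1 s v : l1 v 1 -> l1 (fun j => s * tail1 v j) (2 * Rabs s).
Proof.
  intros H. eapply l1_weaken; [apply l1_scal, tail1_l1, H|lra].
Qed.

Lemma scaled_0 (u : nat -> R) : (fun j => 0 * u j) = zeroseq.
Proof. apply functional_extensionality. intros. unfold zeroseq. ring. Qed.

Section Rho.
Context (rem : nat -> (nat -> R) -> R).
Context (hrem0 : forall i, rem i zeroseq = 0).
Context (hrem : forall r x x' M, r <= r0 -> l1 x r -> l1 x' r -> l1 (fun i => x i - x' i) M ->
  l1 (fun i => fw i * (rem i x - rem i x')) (K * r * M)).

Lemma rho_0 v i : rho rem 0 v i = 0.
Proof. unfold rho. rewrite scaled_0, hrem0. unfold Rdiv. ring. Qed.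

Lemma rho_diff s v v' M : 2 * Rabs s <= r0 -> l1 v 1 -> l1 v' 1 -> l1 (fun i => v i - v' i) M ->
  l1 (fun i => fw i * (rho rem s v i - rho rem s v' i)) (2 * K * Rabs s * M).
Proof.
  intros Hs Hv Hv' HM. assert (P := l1_ge_0 _ _ HM).
  destruct (Req_dec s 0) as [->|Hne].
  - apply (l1_ext (fun _ => 0)); [intros i; rewrite !rho_0; ring|]. rewrite Rabs_R0.
    apply l1_0. right; ring.
  - assert (Hp := Rabs_pos_lt s Hne).
    apply (l1_ext (fun i => / s * (fw i * (rem i (fun j => s * tail1 v j) - rem i (fun j => s * tail1 v' j))))).
    + intros i. unfold rho. field. auto.
    + eapply l1_weaken; [apply l1_scal; apply (hrem (2 * Rabs s) _ _ (Rabs s * M)); auto using scaled_tail1_l1|].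
      * apply (l1_ext (fun j => s * (tail1 v j - tail1 v' j))); [intros; ring|]. apply l1_scal, tail1_diff, HM.
      * rewrite Rabs_inv. right. field. lra.
Qed.

Lemma rho_bound s v : 2 * Rabs s <= r0 -> l1 v 1 ->
  l1 (fun i => fw i * rho rem s v i) (4 * K * Rabs s).
Proof.
  intros Hs Hv. destruct (Req_dec s 0) as [->|Hne].
  - apply (l1_ext (fun _ => 0)); [intros i; rewrite rho_0; ring|]. rewrite Rabs_R0. apply l1_0. lra.
  - assert (Hp := Rabs_pos_lt s Hne).
    apply (l1_ext (fun i => / s * (fw i * (rem i (fun j => s * tail1 v j) - rem i zeroseq)))).
    + intros i. unfold rho. rewrite hrem0. field. auto.
    + eapply l1_weaken; [apply l1_scal; apply (hrem (2 * Rabs s) _ _ (2 * Rabs s)); auto using scaled_tail1_l1|].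
      * apply zeroseq_l1. lra.
      * apply l1_minus_zeroseq, scaled_tail1_l1, Hv.
      * rewrite Rabs_inv. right. field. lra.
Qed.

(** The difference is [(rem (s u) - rem (s' u)) / s] plus [(s' - s) / s] times [rho] at [s']. With
    [|s'| <= |s|] one radius [2 |s|] serves both arguments and cancels the division, and
    [|s'| / |s| <= 1] controls the second term. *)
Lemma rho_lipschitz_ordered s s' v : Rabs s' <= Rabs s -> 2 * Rabs s <= r0 -> l1 v 1 ->
  l1 (fun i => fw i * (rho rem s v i - rho rem s' v i)) (8 * K * Rabs (s - s')).
Proof.
  intros Hss Hs Hv. assert (P0 := Rabs_pos (s - s')).
  destruct (Req_dec s' 0) as [->|Hne'].
  - apply (l1_ext (fun i => fw i * rho rem s v i)); [intros; rewrite rho_0; ring|].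
    eapply l1_weaken; [apply rho_bound; auto|]. rewrite Rminus_0_r. assert (A := Rabs_pos s). nra.
  - assert (Hp' := Rabs_pos_lt s' Hne').
    assert (Hne : s <> 0) by (intros ->; rewrite Rabs_R0 in Hss; lra).
    assert (Hp := Rabs_pos_lt s Hne).
    apply (l1_ext (fun i => / s * (fw i * (rem i (fun j => s * tail1 v j) - rem i (fun j => s' * tail1 v j)))
       + ((s' - s) / s) * (fw i * rho rem s' v i))).
    + intros i. unfold rho. field. auto.
    + eapply l1_weaken.
      * apply l1_plus; apply l1_scal.
        -- apply (hrem (2 * Rabs s) _ _ (2 * Rabs (s - s'))); auto using scaled_tail1_l1.
           ++ eapply l1_weaken; [apply scaled_tail1_l1, Hv|lra].
           ++ apply (l1_ext (fun j => (s - s') * tail1 v j)); [intros; ring|]. now apply scaled_tail1_l1.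
        -- apply rho_bound; auto. lra.
      * unfold Rdiv. rewrite Rabs_mult, Rabs_inv, (Rabs_minus_sym s' s).
        apply Rle_trans with (4 * K * Rabs (s - s') + 4 * K * Rabs (s - s') * (Rabs s' / Rabs s)); [right; field; lra|].
        assert (Q : Rabs s' / Rabs s <= 1).
        { apply (Rmult_le_reg_r (Rabs s)); auto. unfold Rdiv. rewrite Rmult_assoc, Rinv_l by lra. lra. }
        assert (0 <= 4 * K * Rabs (s - s')) by (apply Rmult_le_pos; lra). nra.
Qed.

Lemma rho_lipschitz s s' v : 2 * Rabs s <= r0 -> 2 * Rabs s' <= r0 -> l1 v 1 ->
  l1 (fun i => fw i * (rho rem s v i - rho rem s' v i)) (8 * K * Rabs (s - s')).
Proof.
  intros Hs Hs' Hv. destruct (Rle_dec (Rabs s') (Rabs s)) as [L|L].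
  - now apply rho_lipschitz_ordered.
  - rewrite Rabs_minus_sym.
    apply (l1_ext (fun i => - (1) * (fw i * (rho rem s' v i - rho rem s v i)))); [intros; ring|].
    replace (8 * K * Rabs (s' - s)) with (Rabs (- (1)) * (8 * K * Rabs (s' - s))) by (rewrite Rabs_Ropp, Rabs_R1; ring).
    apply l1_scal, rho_lipschitz_ordered; auto. lra.
Qed.

End Rho.

(* The equation of index [0] determines [v 0 = Om - Om0]; those of index [i >= 1] determine [v i = x i / s]. *)
Definition nonlin (s : R) (v : nat -> R) (i : nat) : R :=
  rho rI s v i + 2 * (Om0 + v O) * rho rO s v i
  + match i with O => 0 | S _ => 2 * v O * lamO i * v i end.

(** At index 0 the coefficient of [u_0 = 1] is [lamI 0 + 2 (Om0 + v 0) lamO 0], which by [h0] is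
    [2 lamO 0] times [v 0]. So this equation is solved for the angular velocity. *)
Definition dinv (i : nat) : R :=
  match i with O => / (2 * lamO O) | S _ => / (lamI i + 2 * Om0 * lamO i) end.

Definition bmap (s : R) (v : nat -> R) (i : nat) : R := - dinv i * nonlin s v i.

Lemma dinv_bound i : Rabs (- dinv i) <= c * fw i.
Proof.
  rewrite Rabs_Ropp. destruct i; simpl; [|apply hLc].
  assert (A := hfw O). eapply Rle_trans; [exact hlamO0c|]. nra.
Qed.

Lemma bmap_l1 (y : nat -> R) M : l1 (fun i => fw i * y i) M -> l1 (fun i => - dinv i * y i) (c * M).
Proof.
  apply l1_weighted; [apply dinv_bound| |lra]. intros i. assert (A := hfw i). lra.
Qed.

Definition OmB : R := Rabs Om0 + 1.

Lemma Om_bound v r : r <= 1 -> l1 v r -> Rabs (2 * (Om0 + v O)) <= 2 * OmB.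
Proof.
  intros Hr Hv. rewrite Rabs_mult, (Rabs_pos_eq 2) by lra.
  assert (A := Rabs_triang Om0 (v O)). assert (B := l1_term _ _ O Hv). unfold OmB. lra.
Qed.

(** The remainders contribute the part of order [|s|]. The product of [v 0] and [v i] does not
    become small with [s] but is of second order in [v], and contributes the part of order [r];
    hence the ball must be small too. *)
Lemma bmap_contract s r v v' M : 2 * Rabs s <= r0 -> r <= 1 -> l1 v r -> l1 v' r ->
  l1 (fun i => v i - v' i) M ->
  l1 (fun i => bmap s v i - bmap s v' i) (c * ((2 * K + 4 * K * OmB + 8 * K) * Rabs s + 4 * c * r) * M).
Proof.
  intros Hs Hr Hv Hv' HM.
  assert (Hv1 : l1 v 1) by (eapply l1_weaken; eauto). assert (Hv1' : l1 v' 1) by (eapply l1_weaken; eauto).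
  assert (PM := l1_ge_0 _ _ HM). assert (Pr := l1_ge_0 _ _ Hv). assert (Ps := Rabs_pos s).
  rewrite Rmult_assoc.
  apply (l1_ext (fun i => - dinv i * (nonlin s v i - nonlin s v' i))); [intros; unfold bmap; ring|].
  apply bmap_l1.
  apply (l1_ext (fun i => (fw i * (rho rI s v i - rho rI s v' i)
     + 2 * (Om0 + v O) * (fw i * (rho rO s v i - rho rO s v' i)))
     + (2 * (v O - v' O) * (fw i * rho rO s v' i)
     + fw i * match i with O => 0 | S _ => 2 * lamO i * (v O * (v i - v' i) + (v O - v' O) * v' i) end))).
  - intros [|i]; unfold nonlin; ring.
  - assert (V0 := l1_term _ _ O Hv). assert (V1 := l1_term _ _ O HM). cbv beta in V1.
    assert (HA := rho_diff rI hI0 hI s v v' M Hs Hv1 Hv1' HM).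
    assert (HB := l1_scal (2 * (Om0 + v O)) _ _ (rho_diff rO hO0 hO s v v' M Hs Hv1 Hv1' HM)).
    assert (HC := l1_scal (2 * (v O - v' O)) _ _ (rho_bound rO hO0 hO s v' Hs Hv1')).
    assert (HD : l1 (fun i => fw i * match i with O => 0 | S _ => 2 * lamO i * (v O * (v i - v' i) + (v O - v' O) * v' i) end)
       (2 * c * (r * M + M * r))).
    { eapply sumle_mono; [|apply (sumle_scal (2 * c) (fun i => r * Rabs (v i - v' i) + M * Rabs (v' i)));
        [lra|apply sumle_plus; apply sumle_scal; [auto|exact HM|auto|exact Hv']]].
      assert (Pos : forall i, 0 <= r * Rabs (v i - v' i) + M * Rabs (v' i)).
      { intros i. assert (A := Rabs_pos (v i - v' i)). assert (B := Rabs_pos (v' i)). nra. }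
      intros [|i].
      - rewrite Rmult_0_r, Rabs_R0. apply Rmult_le_pos; [lra|apply Pos].
      - rewrite !Rabs_mult, (Rabs_pos_eq (fw (S i))), (Rabs_pos_eq 2) by (try assert (A := hfw (S i)); lra).
        assert (A1 := hlamO (S i)).
        assert (A2 : Rabs (v O * (v (S i) - v' (S i)) + (v O - v' O) * v' (S i)) <= r * Rabs (v (S i) - v' (S i)) + M * Rabs (v' (S i))).
        { eapply Rle_trans; [apply Rabs_triang|]. rewrite !Rabs_mult.
          apply Rplus_le_compat; apply Rmult_le_compat_r; auto; apply Rabs_pos. }
        set (y := Rabs (v O * (v (S i) - v' (S i)) + (v O - v' O) * v' (S i))) in *.
        assert (A3 : 0 <= y) by apply Rabs_pos.
        assert (A4 : 0 <= Rabs (lamO (S i))) by apply Rabs_pos. assert (A5 := hfw (S i)).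
        replace (fw (S i) * (2 * Rabs (lamO (S i)) * y)) with (2 * (fw (S i) * Rabs (lamO (S i))) * y) by ring.
        apply Rmult_le_compat; auto; [|lra]. apply Rmult_le_pos; [lra|]. apply Rmult_le_pos; lra. }
    eapply l1_weaken; [apply l1_plus; apply l1_plus; [exact HA|exact HB|exact HC|exact HD]|].
    assert (B1 := Om_bound v r Hr Hv).
    assert (B2 : Rabs (2 * (v O - v' O)) <= 2 * M) by (rewrite Rabs_mult, (Rabs_pos_eq 2); lra).
    assert (P1 : 0 <= 2 * K * Rabs s * M) by (repeat apply Rmult_le_pos; auto; lra).
    assert (P2 : 0 <= 4 * K * Rabs s) by (repeat apply Rmult_le_pos; auto; lra).
    assert (Q1 : Rabs (2 * (Om0 + v O)) * (2 * K * Rabs s * M) <= 2 * OmB * (2 * K * Rabs s * M)) by (apply Rmult_le_compat_r; auto).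
    assert (Q2 : Rabs (2 * (v O - v' O)) * (4 * K * Rabs s) <= 2 * M * (4 * K * Rabs s)) by (apply Rmult_le_compat_r; auto).
    nra.
Qed.

Lemma bmap_zero s : 2 * Rabs s <= r0 -> l1 (bmap s zeroseq) (c * ((4 * K + 8 * K * OmB) * Rabs s)).
Proof.
  intros Hs. assert (Hz : l1 zeroseq 1) by (apply zeroseq_l1; lra). assert (Ps := Rabs_pos s).
  apply bmap_l1.
  apply (l1_ext (fun i => fw i * rho rI s zeroseq i + 2 * (Om0 + zeroseq O) * (fw i * rho rO s zeroseq i))).
  - intros [|i]; unfold nonlin, zeroseq; ring.
  - eapply l1_weaken; [apply l1_plus; [|apply l1_scal]; apply rho_bound; auto|].
    assert (B1 := Om_bound zeroseq 1 (Rle_refl 1) Hz).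
    assert (P2 : 0 <= 4 * K * Rabs s) by (repeat apply Rmult_le_pos; auto; lra).
    assert (Q1 : Rabs (2 * (Om0 + zeroseq O)) * (4 * K * Rabs s) <= 2 * OmB * (4 * K * Rabs s)) by (apply Rmult_le_compat_r; auto).
    lra.
Qed.

Lemma bmap_lipschitz s s' v : 2 * Rabs s <= r0 -> 2 * Rabs s' <= r0 -> l1 v 1 ->
  l1 (fun i => bmap s v i - bmap s' v i) (c * ((8 * K + 16 * K * OmB) * Rabs (s - s'))).
Proof.
  intros Hs Hs' Hv. assert (Ps := Rabs_pos (s - s')).
  apply (l1_ext (fun i => - dinv i * (nonlin s v i - nonlin s' v i))); [intros; unfold bmap; ring|].
  apply bmap_l1.
  apply (l1_ext (fun i => fw i * (rho rI s v i - rho rI s' v i) + 2 * (Om0 + v O) * (fw i * (rho rO s v i - rho rO s' v i)))).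
  - intros [|i]; unfold nonlin; ring.
  - eapply l1_weaken; [apply l1_plus; [|apply l1_scal]; apply rho_lipschitz; auto|].
    assert (B1 := Om_bound v 1 (Rle_refl 1) Hv).
    assert (P2 : 0 <= 8 * K * Rabs (s - s')) by (repeat apply Rmult_le_pos; auto; lra).
    assert (Q1 : Rabs (2 * (Om0 + v O)) * (8 * K * Rabs (s - s')) <= 2 * OmB * (8 * K * Rabs (s - s'))) by (apply Rmult_le_compat_r; auto).
    lra.
Qed.

Lemma bmap_fixed_equation s v i : (forall i, bmap s v i = v i) ->
  lamI i * (s * tail1 v i) + rI i (fun j => s * tail1 v j)
  + 2 * (Om0 + v O) * (lamO i * (s * tail1 v i) + rO i (fun j => s * tail1 v j)) = 0.
Proof.
  intros Fv. destruct (Req_dec s 0) as [->|Hne].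
  - rewrite scaled_0, hI0, hO0. ring.
  - assert (F := Fv i). unfold bmap, nonlin, rho in F.
    destruct i as [|i]; simpl tail1; simpl dinv in F.
    + assert (E : (2 * lamO O) * v O = - (rI O (fun j => s * tail1 v j) / s + 2 * (Om0 + v O) * (rO O (fun j => s * tail1 v j) / s))).
      { rewrite <- F at 1. field. auto. }
      apply (Rmult_eq_reg_l (/ s)); [|now apply Rinv_neq_0_compat]. rewrite Rmult_0_r.
      transitivity ((lamI O + 2 * Om0 * lamO O) + ((2 * lamO O) * v O + (rI O (fun j => s * tail1 v j) / s + 2 * (Om0 + v O) * (rO O (fun j => s * tail1 v j) / s)))); [field; auto|].
      rewrite h0, E. ring.
    + assert (NL := hL i).
      assert (E : (lamI (S i) + 2 * Om0 * lamO (S i)) * v (S i) = - (rI (S i) (fun j => s * tail1 v j) / s + 2 * (Om0 + v O) * (rO (S i) (fun j => s * tail1 v j) / s) + 2 * v O * lamO (S i) * v (S i))).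
      { rewrite <- F at 1. field. auto. }
      apply (Rmult_eq_reg_l (/ s)); [|now apply Rinv_neq_0_compat]. rewrite Rmult_0_r.
      transitivity ((lamI (S i) + 2 * Om0 * lamO (S i)) * v (S i) + (rI (S i) (fun j => s * tail1 v j) / s + 2 * (Om0 + v O) * (rO (S i) (fun j => s * tail1 v j) / s) + 2 * v O * lamO (S i) * v (S i))); [field; auto|].
      rewrite E. ring.
Qed.

Theorem bifurcation_branch (r : R) : 0 < r -> r <= 1 ->
  exists a Lip (v : R -> nat -> R), 0 < a /\ 0 <= Lip /\ v 0 O = 0 /\
  forall s, Rabs s < a ->
    l1 (v s) r /\
    (forall i, lamI i * (s * tail1 (v s) i) + rI i (fun j => s * tail1 (v s) j)
       + 2 * (Om0 + v s O) * (lamO i * (s * tail1 (v s) i) + rO i (fun j => s * tail1 (v s) j)) = 0) /\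
    forall s', Rabs s' < a -> l1 (fun i => v s i - v s' i) (Lip * Rabs (s - s')).
Proof.
  intros Hr Hr1.
  (* This makes the contribution [4 c^2 rr] of the product term to the contraction constant at most
     [1 / 4]. *)
  set (rr := Rmin r (/ (16 * (c * c)))).
  assert (Hcc : 0 < c * c) by nra.
  assert (Hrr : 0 < rr) by (apply Rmin_pos; [auto|apply Rinv_0_lt_compat; lra]).
  assert (Hrr1 : rr <= r) by apply Rmin_l.
  assert (Hrr2 : c * (4 * c * rr) <= / 4).
  { assert (A : rr <= / (16 * (c * c))) by apply Rmin_r.
    replace (/ 4) with (4 * (c * c) * / (16 * (c * c))) by (field; lra). nra. }
  assert (HB : 1 <= OmB) by (unfold OmB; assert (A := Rabs_pos Om0); lra).
  (* As [1 <= OmB], the term [20 K OmB] dominates the factors of [|s|] in [bmap_contract] and in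
     [bmap_zero]; the added 1 keeps [Q] positive when [K = 0]. *)
  set (Q := c * (20 * K * OmB + 1)).
  assert (HQ : 0 < Q) by (unfold Q; assert (0 <= K * OmB) by (apply Rmult_le_pos; lra); nra).
  (* The three bounds keep [2 |s|] within [r0], bring the contraction constant to [1 / 4 + 1 / 4],
     and map the ball into itself as [rr / 2 + rr / 2]. *)
  set (a := Rmin (r0 / 2) (Rmin (/ (4 * Q)) (rr / (2 * Q)))).
  assert (Ha : 0 < a).
  { unfold a. repeat apply Rmin_pos; [lra|apply Rinv_0_lt_compat; lra|apply Rdiv_lt_0_compat; lra]. }
  assert (Ha1 : a <= r0 / 2) by apply Rmin_l.
  assert (Ha2 : Q * a <= / 4).
  { assert (A : a <= / (4 * Q)) by (eapply Rle_trans; [apply Rmin_r|apply Rmin_l]).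
    replace (/ 4) with (Q * / (4 * Q)) by (field; lra). nra. }
  assert (Ha3 : Q * a <= rr / 2).
  { assert (A : a <= rr / (2 * Q)) by (eapply Rle_trans; [apply Rmin_r|apply Rmin_r]).
    replace (rr / 2) with (Q * (rr / (2 * Q))) by (field; lra). nra. }
  assert (HKB : K <= K * OmB) by nra.
  assert (Contr : forall s v v' M, Rabs s < a -> l1 v rr -> l1 v' rr -> l1 (fun i => v i - v' i) M ->
     l1 (fun i => bmap s v i - bmap s v' i) (M * / 2)).
  { intros s v v' M Hs Hv Hv' HM. assert (PM := l1_ge_0 _ _ HM). assert (Ps := Rabs_pos s).
    eapply l1_weaken; [apply (bmap_contract s rr v v' M); auto; lra|].
    rewrite Rmult_comm. apply Rmult_le_compat_l; [auto|].
    rewrite Rmult_plus_distr_l.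
    assert (c * ((2 * K + 4 * K * OmB + 8 * K) * Rabs s) <= Q * a); [|lra].
    replace (Q * a) with (c * ((20 * K * OmB + 1) * a)) by (unfold Q; ring).
    apply Rmult_le_compat_l; [lra|].
    apply Rmult_le_compat; lra. }
  assert (Self : forall s v, Rabs s < a -> l1 v rr -> l1 (bmap s v) rr).
  { intros s v Hs Hv. assert (Ps := Rabs_pos s).
    assert (Hz : l1 zeroseq rr) by (apply zeroseq_l1; lra).
    apply (l1_ext (fun i => (bmap s v i - bmap s zeroseq i) + bmap s zeroseq i)); [intros; ring|].
    eapply l1_weaken; [apply l1_plus; [apply (Contr s v zeroseq rr); auto; now apply l1_minus_zeroseq|apply bmap_zero; lra]|].
    assert (c * ((4 * K + 8 * K * OmB) * Rabs s) <= Q * a); [|lra].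
    replace (Q * a) with (c * ((20 * K * OmB + 1) * a)) by (unfold Q; ring).
    apply Rmult_le_compat_l; [lra|].
    apply Rmult_le_compat; lra. }
  (* The condition on [s] stands inside the existential so that choice yields a function of all real
     [s]. *)
  assert (Ex : forall s, exists v, Rabs s < a -> l1 v rr /\ forall i, bmap s v i = v i).
  { intros s. destruct (Rlt_dec (Rabs s) a) as [Hs|Hs]; [|exists zeroseq; intros; contradiction].
    destruct (l1_contraction (bmap s) rr Hrr) as [v Hv].
    - intros; now apply Self.
    - intros; now apply Contr.
    - exists v. intros _. exact Hv. }
  assert (HLip : 0 <= 2 * (c * (8 * K + 16 * K * OmB))).
  { repeat apply Rmult_le_pos; lra. }
  exists a, (2 * (c * (8 * K + 16 * K * OmB))), (fun s => proj1_sig (constructive_indefinite_description _ (Ex s))).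
  assert (Hv : forall s, Rabs s < a -> l1 (proj1_sig (constructive_indefinite_description _ (Ex s))) rr /\
    forall i, bmap s (proj1_sig (constructive_indefinite_description _ (Ex s))) i = proj1_sig (constructive_indefinite_description _ (Ex s)) i).
  { intros s. apply (proj2_sig (constructive_indefinite_description _ (Ex s))). }
  repeat split; auto.
  - destruct (Hv 0) as [_ F]; [rewrite Rabs_R0; auto|].
    rewrite <- F. unfold bmap, nonlin. rewrite (rho_0 rI hI0), (rho_0 rO hO0). ring.
  - eapply l1_weaken; [apply Hv; auto|auto].
  - intros i. apply bmap_fixed_equation. now apply Hv.
  - intros s' Hs'. destruct (Hv s) as [A1 A2]; auto. destruct (Hv s') as [B1 B2]; auto.
    replace (2 * (c * (8 * K + 16 * K * OmB)) * Rabs (s - s')) with (2 * (c * ((8 * K + 16 * K * OmB) * Rabs (s - s')))) by ring.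
    apply (l1_fixed_point_perturbation (bmap s) (bmap s') rr); auto.
    apply bmap_lipschitz; try lra. eapply l1_weaken; eauto. lra.
Qed.

End Branch.

(** * Diagonal form, eigenvalues and the solution branch *)

Section Coefficients.
Context (m : nat) (kap : posreal).
Context (hm : (1 <= m)%nat).
Local Notation W := (W m kap).
Local Notation SD := (SD m kap).

Lemma fsin_bounded_linear L sg d i : bounded_linear m kap sg d L -> forall lam,
  (forall n, fsin (freq m i) (L (unit_seq n)) = if Nat.eqb n i then lam else 0) ->
  forall x M, l1 x M -> fsin (freq m i) (L x) = lam * x i.
Proof.
  intros [K [H1 H2]] lam Hu x M Hx.
  assert (HC : forall x M, l1 x M -> ccont (fun s => L x s 0)) by (intros; eapply W_ccont_s; eauto).
  apply (functional_determined (fun x => fsin (freq m i) (L x)) (2 * K) x M lam i); auto.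
  - intros y N Hy. rewrite Rmult_assoc. apply fsin_Rabs; [eapply HC; eauto|].
    intros s. exact (W_Cmod _ _ _ _ _ _ s 0 (H1 y N Hy)).
  - intros y z c N N' Hy Hz.
    rewrite (fsin_ext _ _ (fun s t => L y s t + RtoC c * L z s t)%C) by (intros; eapply H2; eauto).
    rewrite (fsin_plus _ (L y) (fun s t => RtoC c * L z s t)%C).
    + rewrite fsin_scal by (eapply HC; eauto). reflexivity.
    + eapply HC; eauto.
    + apply (ccont_scal c (fun s => L z s 0)). eapply HC; eauto.
Qed.

Definition remainder (G : vmap) (lam : nat -> R) (i : nat) (x : nat -> R) : R :=
  fsin (freq m i) (G x) - lam i * x i.

(** The derivative is linear and diagonal, so the difference of two remainders is the sine
    coefficient of the very expression that [SD] bounds; [fsin_sumle] then supplies the weight. *)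
Lemma SD_remainder sg d G G1 lam : SD sg d G G1 ->
  (forall i x M, l1 x M -> fsin (freq m i) (G1 x) = lam i * x i) ->
  exists r0 K, 0 < r0 /\ 0 <= K /\ (forall x, l1 x r0 -> W sg d (G x) K) /\
    forall r x x' M, r <= r0 -> l1 x r -> l1 x' r -> l1 (fun i => x i - x' i) M ->
      l1 (fun i => fwt m kap i * (remainder G lam i x - remainder G lam i x')) (K * r * M).
Proof.
  intros [r0 [K [Hr [HK [H1 [H2 [H3 H4]]]]]]] Hlam. exists r0, K. repeat split; auto.
  intros r x x' M Hrr Hx Hx' HM.
  assert (H := fsin_sumle _ _ _ _ _ _ hm (H4 r x x' M Hrr Hx Hx' HM)).
  eapply l1_ext; [|exact H]. intros i. cbv beta. f_equal.
  assert (C1 : ccont (fun s => G x s 0)) by (eapply W_ccont_s, H1; eapply l1_weaken; eauto).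
  assert (C2 : ccont (fun s => G x' s 0)) by (eapply W_ccont_s, H1; eapply l1_weaken; eauto).
  assert (C3 : ccont (fun s => G1 (fun i => x i - x' i)%R s 0)) by (eapply W_ccont_s, H2; eauto).
  rewrite (fsin_minus _ (fun s t => G x s t - G x' s t)%C (G1 (fun i => x i - x' i))); auto.
  2: { now apply (ccont_minus (fun s => G x s 0) (fun s => G x' s 0)). }
  rewrite (fsin_minus _ (G x) (G x')) by auto. rewrite (Hlam i _ M HM). unfold remainder. ring.
Qed.

End Coefficients.

(** Both sides are [(1 - x)^2] at [n = 2], and each step adds [(1 - x) (1 - x^n) >= (1 - x)^2] on
    the right. The lower bound must grow linearly in [n] to bound the inverse in the weighted
    norm. *)
Lemma eigenvalue_gap x n : 0 <= x < 1 -> (2 <= n)%nat ->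
  INR n * (1 - x) ^ 2 / 2 <= INR n * (1 - x) - (1 - x ^ n).
Proof.
  intros Hx Hn. induction Hn as [|n Hn IH].
  - simpl. nra.
  - rewrite S_INR. assert (P : x ^ n <= x).
    { destruct n; [lia|]. simpl. assert (0 <= x ^ n) by (apply pow_le; lra).
      assert (x ^ n <= 1). { rewrite <- (pow1 n). apply pow_incr. lra. } nra. }
    simpl (x ^ S n). nra.
Qed.

Section Solution.
Context (m : nat) (kap : posreal) (b : R).
Context (hm : (1 <= m)%nat) (hb : 0 < b) (hbk : b * (1 + kap) < 1).
Local Notation W := (W m kap).
Local Notation SD := (SD m kap).

Lemma I1_0 s t : (I1 m kap b) zeroseq s t = (RtoC (- b) * mono (-1) 0 s t)%C.
Proof.
  unfold I1. rewrite (mean_ext _ (fun s t => RtoC (- b) * mono (-1) 0 s t)%C).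
  - rewrite mean_scal_mono. reflexivity.
  - intros u. unfold integrand1. rewrite lin_zeroseq, Pt_0.
    replace (mono (-1) 0 s u) with (mono (-1) (-1) s u * mono 0 1 s u)%C by apply mono_mult.
    assert (Hb := RtoC_b_neq_0 b hb). rewrite Cconj_R, RtoC_opp. field.
    replace (b - 0)%C with (RtoC b) by ring. auto.
Qed.

(** On the disc the integrand is [b^3 tau / (1 - b^2 w tau)], a power series in [tau] without
    constant term. *)
Lemma I2_0 s t : (I2 m kap b) zeroseq s t = 0%C.
Proof.
  unfold I2.
  rewrite (mean_ext _ (fun s t => RtoC (b * b * b) * (mono 0 1 s t * kernel2 b s t))%C).
  - rewrite (mean_scal (fun _ => RtoC (b * b * b)) (fun s t => mono 0 1 s t * kernel2 b s t)%C)
      by (apply ccont_mult; [apply ccont_mono_t|eapply ccont_kernel2; eauto]).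
    change (mean (fun s t => mono 0 1 s t * kernel2 b s t)%C s t) with (kernel_moment b 1 s).
    rewrite (kernel_moment_pos m kap b) by (auto; lia). ring.
  - intros u. unfold integrand2. rewrite phi_phit_0. fold (kernel2 b s u).
    rewrite phit_0, Pt_0, Cmult_conj, Cconj_R, mono_conj_01.
    transitivity (b * b * b * (mono 0 1 s u * mono 0 (-1) s u) * (mono 0 1 s u * kernel2 b s u))%C; [ring|].
    rewrite mono_mult. simpl Z.add. rewrite mono_00, !RtoC_mult. ring.
Qed.

Definition dGI : vmap := fun x s t =>
  ((dI1 m kap x s t - dI2 m kap b x s t) * (b * mono 1 0 s t) - (RtoC (- b) * mono (-1) 0 s t) * lin (BP m kap) x s t)%C.
Definition dGO : vmap := fun x s t =>
  (Cconj (lin (Bf m kap) x s t) * (b * mono 1 0 s t) - (b * mono (-1) 0 s t) * lin (BP m kap) x s t)%C.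

Lemma SD_GI : SD 0 0 (GI m kap b) dGI.
Proof.
  assert (H1 := SD_minus _ _ _ _ _ _ _ _ (SD_mean _ _ _ 0 _ _ _ (SD_integrand1 m kap b hm hb))
    (SD_mean _ _ _ 0 _ _ _ (SD_integrand2 m kap b hm hb hbk))).
  assert (H2 := SD_mult _ _ 0 (-1) 1 0 _ _ _ _ eq_refl H1 (SD_Pw m kap b hm hb 0)).
  eapply SD_ext; [| |exact H2].
  - reflexivity.
  - intros x s t. cbv beta. fold (dI1 m kap x) (dI2 m kap b x) (I1 m kap b zeroseq) (I2 m kap b zeroseq).
    rewrite I1_0, I2_0, Pw_0. unfold dGI. ring.
Qed.

Lemma SD_GO : SD 0 0 (GO m kap b) dGO.
Proof.
  assert (H1 := SD_conj _ _ _ _ _ _ (SD_phi m kap b hm hb 0)).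
  assert (H2 := SD_mult _ _ 0 (-(1)) 1 0 _ _ _ _ eq_refl H1 (SD_Pw m kap b hm hb 0)).
  eapply SD_ext; [| |exact H2].
  - reflexivity.
  - intros x s t. cbv beta. rewrite Pw_0, phi_0, Cmult_conj, Cconj_R, mono_conj. unfold dGO. simpl Z.opp. ring.
Qed.

(** The first term comes from the variation of the tangent vector, the second from [dI2]; division
    by [om] passes from [a_{i+1}] to [x i]. *)
Definition lamI (i : nat) : R := - (b * IZR (kz m i) + b ^ (2 * freq m i + 1)) / om m kap i.
Definition lamO (i : nat) : R := b * INR (freq m i) / om m kap i.

Lemma fsin_pair (c1 c2 : R) (N : nat) (i : nat) (F : R -> R -> C) :
  (forall s, F s 0 = (RtoC c1 * mono (Z.of_nat N) 0 s 0 + RtoC c2 * mono (- Z.of_nat N) 0 s 0)%C) ->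
  (1 <= N)%nat -> (1 <= i)%nat ->
  fsin i F = if Nat.eqb N i then c1 - c2 else 0.
Proof.
  intros H HN Hi. rewrite (fsin_ext _ _ (fun s t => RtoC c1 * mono (Z.of_nat N) 0 s t + RtoC c2 * mono (- Z.of_nat N) 0 s t)%C) by auto.
  rewrite (fsin_plus _ (fun s t => RtoC c1 * mono (Z.of_nat N) 0 s t)%C (fun s t => RtoC c2 * mono (- Z.of_nat N) 0 s t)%C).
  - rewrite !fsin_scal by (apply ccont_mono_s). rewrite !fsin_mono.
    destruct (Nat.eqb_spec N i), (Z.eqb_spec (Z.of_nat N) (Z.of_nat i)), (Z.eqb_spec (Z.of_nat N) (- Z.of_nat i)),
      (Z.eqb_spec (- Z.of_nat N) (Z.of_nat i)), (Z.eqb_spec (- Z.of_nat N) (- Z.of_nat i)); try lia; ring.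
  - apply (ccont_scal c1 (fun s => mono (Z.of_nat N) 0 s 0)), ccont_mono_s.
  - apply (ccont_scal c2 (fun s => mono (- Z.of_nat N) 0 s 0)), ccont_mono_s.
Qed.

Lemma freq_eqb n i : Nat.eqb (freq m n) (freq m i) = Nat.eqb n i.
Proof.
  destruct (Nat.eqb_spec n i) as [->|Hne]; [apply Nat.eqb_refl|].
  apply Nat.eqb_neq. unfold freq. intros E. apply Nat.mul_cancel_r in E; lia.
Qed.

Lemma zb_pow s k : (zb b s ^ k)%C = (RtoC ((b * b) ^ k) * mono (Z.of_nat k) 0 s 0)%C.
Proof.
  unfold zb. rewrite Cpow_mult_l, RtoC_pow, cis_pow. f_equal. unfold mono. f_equal.
  rewrite INR_IZR_INZ. ring.
Qed.

Lemma kz_nat n : Z.of_nat (Z.to_nat (kz m n)) = kz m n.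
Proof. apply Z2Nat.id, kz_ge_0, hm. Qed.

Lemma kz_succ n : (kz m n + 1)%Z = Z.of_nat (freq m n).
Proof. unfold kz. ring. Qed.

Lemma kz_to_nat n : S (Z.to_nat (kz m n)) = freq m n.
Proof. apply Nat2Z.inj. rewrite Nat2Z.inj_succ, kz_nat, <- kz_succ. lia. Qed.

Lemma b_pow_freq n : b ^ (2 * freq m n + 1) = (b * b) ^ Z.to_nat (kz m n) * (b * b * b).
Proof.
  rewrite <- kz_to_nat. set (k := Z.to_nat (kz m n)).
  replace (2 * S k + 1)%nat with (2 * k + 3)%nat by lia.
  rewrite pow_add, pow_mult. simpl. rewrite !Rmult_1_r. ring.
Qed.

Lemma om_gt_0 i : 0 < om m kap i.
Proof. apply om_pos; auto. Qed.

Lemma fsin_dGI i x M : l1 x M -> fsin (freq m i) (dGI x) = lamI i * x i.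
Proof.
  apply (fsin_bounded_linear m kap dGI 0 0 i); [eapply SD_linear_part, SD_GI|].
  intros n. rewrite <- (freq_eqb n i).
  rewrite (fsin_pair (- (/ om m kap n * (b * b) * (b * b) ^ Z.to_nat (kz m n) * b)) (b * (IZR (kz m n) / om m kap n)) (freq m n)).
  - destruct (Nat.eqb_spec (freq m n) (freq m i)) as [E|E]; [|reflexivity].
    assert (n = i) as -> by (apply Nat.eqb_eq; rewrite <- freq_eqb; now apply Nat.eqb_eq).
    unfold lamI. rewrite b_pow_freq. field. assert (A := om_gt_0 i). lra.
  - intros s. unfold dGI.
    rewrite dI1_unit, (dI2_unit m kap b), lin_unit by auto. unfold BP.
    rewrite zb_pow, kz_nat, <- kz_succ.
    replace (mono (kz m n + 1) 0 s 0) with (mono (kz m n) 0 s 0 * mono 1 0 s 0)%C by apply mono_mult.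
    replace (mono (- (kz m n + 1)) 0 s 0) with (mono (-1) 0 s 0 * mono (- kz m n) 0 s 0)%C.
    + rewrite !RtoC_opp, !RtoC_mult. ring.
    + rewrite mono_mult. f_equal; ring.
  - now apply freq_ge_1.
  - now apply freq_ge_1.
Qed.

Lemma fsin_dGO i x M : l1 x M -> fsin (freq m i) (dGO x) = lamO i * x i.
Proof.
  apply (fsin_bounded_linear m kap dGO 0 0 i); [eapply SD_linear_part, SD_GO|].
  intros n. rewrite <- (freq_eqb n i).
  rewrite (fsin_pair (/ om m kap n * b) (- (b * (IZR (kz m n) / om m kap n))) (freq m n)).
  - destruct (Nat.eqb_spec (freq m n) (freq m i)) as [E|E]; [|reflexivity].
    assert (n = i) as -> by (apply Nat.eqb_eq; rewrite <- freq_eqb; now apply Nat.eqb_eq).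
    unfold lamO. rewrite INR_IZR_INZ, <- kz_succ, plus_IZR. field. assert (A := om_gt_0 i). lra.
  - intros s. unfold dGO. rewrite !lin_unit. unfold BP, Bf.
    rewrite Cmult_conj, Cconj_R, mono_conj, <- kz_succ.
    replace (- - kz m n)%Z with (kz m n) by ring. replace (- 0)%Z with 0%Z by ring.
    replace (mono (kz m n + 1) 0 s 0) with (mono (kz m n) 0 s 0 * mono 1 0 s 0)%C by apply mono_mult.
    replace (mono (- (kz m n + 1)) 0 s 0) with (mono (-1) 0 s 0 * mono (- kz m n) 0 s 0)%C.
    + rewrite !RtoC_opp, !RtoC_mult. ring.
    + rewrite mono_mult. f_equal; ring.
  - now apply freq_ge_1.
  - now apply freq_ge_1.
Qed.

Lemma fsin_real_const (c : R) i (F : R -> R -> C) : (forall s, F s 0 = RtoC c) -> (1 <= i)%nat -> fsin i F = 0.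
Proof.
  intros H Hi. rewrite (fsin_ext _ _ (fun s t => RtoC c * mono 0 0 s t)%C).
  - rewrite fsin_scal by apply ccont_mono_s. rewrite fsin_mono.
    destruct (Z.eqb_spec 0 (Z.of_nat i)), (Z.eqb_spec 0 (- Z.of_nat i)); try lia. ring.
  - intros. rewrite mono_00, H. ring.
Qed.

Lemma fsin_GI_0 i : fsin (freq m i) (GI m kap b zeroseq) = 0.
Proof.
  apply (fsin_real_const (- (b * b))); [|now apply freq_ge_1].
  intros s. unfold GI. rewrite I1_0, I2_0, Pw_0.
  transitivity (RtoC (- b) * b * (mono (-1) 0 s 0 * mono 1 0 s 0))%C; [ring|].
  rewrite mono_mult. simpl Z.add. rewrite mono_00, !RtoC_opp, RtoC_mult. ring.
Qed.

Lemma fsin_GO_0 i : fsin (freq m i) (GO m kap b zeroseq) = 0.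
Proof.
  apply (fsin_real_const (b * b)); [|now apply freq_ge_1].
  intros s. unfold GO. rewrite phi_0, Pw_0, Cmult_conj, Cconj_R, mono_conj. simpl Z.opp.
  transitivity (b * b * (mono (-1) 0 s 0 * mono 1 0 s 0))%C; [ring|].
  rewrite mono_mult. simpl Z.add. rewrite mono_00, RtoC_mult. ring.
Qed.

Definition Om_bif : R := (INR m - 1 + b ^ (2 * m)) / (2 * INR m).

Lemma INR_m_pos : 1 <= INR m.
Proof. apply le_INR in hm. simpl in hm. exact hm. Qed.

(** At [n = 0] the last factor is [(1 - b^(2m)) - (1 - b^(2m)) = 0], which is what determines
    [Om_bif]. For larger [n] it is the quantity of [eigenvalue_gap]. *)
Lemma eigenvalue n : lamI n + 2 * Om_bif * lamO n
  = - (b / om m kap n) * (INR (S n) * (1 - b ^ (2 * m)) - (1 - (b ^ (2 * m)) ^ S n)).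
Proof.
  assert (A := om_gt_0 n). assert (Hm := INR_m_pos).
  unfold lamI, lamO, Om_bif. unfold kz.
  rewrite minus_IZR, <- INR_IZR_INZ. unfold freq. rewrite mult_INR.
  rewrite <- pow_mult. replace (2 * m * S n)%nat with (2 * (S n * m))%nat by ring.
  rewrite pow_add, pow_1. set (y := b ^ (2 * (S n * m))). set (x := b ^ (2 * m)).
  field. lra.
Qed.

Lemma b_pow_bounds : 0 <= b ^ (2 * m) < 1.
Proof.
  assert (B := b_lt_1 kap b hb hbk). split; [apply pow_le; lra|].
  apply pow_lt_1_compat; [lra|lia].
Qed.

Theorem V_state_coefficients : exists a Lip (v : R -> nat -> R), 0 < a /\ 0 <= Lip /\ v 0 O = 0 /\
  forall s, Rabs s < a ->
    l1 (v s) (/ 2) /\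
    (forall t, Im (GI m kap b (fun j => (s * tail1 (v s) j)%R) t 0
       + RtoC (2 * (Om_bif + v s O)) * GO m kap b (fun j => (s * tail1 (v s) j)%R) t 0)%C = 0) /\
    forall s', Rabs s' < a -> l1 (fun i => v s i - v s' i) (Lip * Rabs (s - s')).
Proof.
  destruct (SD_remainder m kap hm _ _ _ _ lamI SD_GI fsin_dGI) as [r1 [K1 [Hr1 [HK1 [WI HI]]]]].
  destruct (SD_remainder m kap hm _ _ _ _ lamO SD_GO fsin_dGO) as [r2 [K2 [Hr2 [HK2 [WO HO]]]]].
  set (r0 := Rmin r1 r2). set (K := K1 + K2).
  assert (Hr0 : 0 < r0) by (apply Rmin_pos; auto).
  assert (Q1 : r0 <= r1) by apply Rmin_l. assert (Q2 : r0 <= r2) by apply Rmin_r.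
  assert (Hm := INR_m_pos). assert (Hx := b_pow_bounds). set (x := b ^ (2 * m)) in *.
  assert (Hx2 : 0 < (1 - x) ^ 2) by (apply pow_lt; lra).
  (* The summands are the bounds for [fwt i * lamO i], for the inverse of [2 * lamO 0], and for the
     inverse eigenvalues divided by [fwt]. *)
  set (c := b + fwt m kap O / (2 * b) + 2 * INR m / (b * (1 - x) ^ 2)).
  assert (Hf0 := fwt_ge_1 m kap O).
  assert (P1 : 0 < fwt m kap O / (2 * b)) by (apply Rdiv_lt_0_compat; lra).
  assert (P2 : 0 < 2 * INR m / (b * (1 - x) ^ 2)) by (apply Rdiv_lt_0_compat; [lra|apply Rmult_lt_0_compat; lra]).
  assert (Hlam : forall i, lamO i = b / fwt m kap i).
  { intros i. unfold lamO, om. assert (A := fwt_ge_1 m kap i). assert (B := freq_ge_1 m hm i). apply le_INR in B; simpl in B. field. lra. }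
  assert (HL : forall i, INR (S (S i)) * (1 - x) ^ 2 / 2 <= INR (S (S i)) * (1 - x) - (1 - x ^ S (S i))).
  { intros i. apply eigenvalue_gap; [auto|lia]. }
  assert (HL0 : forall i, 0 < INR (S (S i)) * (1 - x) ^ 2 / 2).
  { intros i. assert (A : 0 < INR (S (S i))) by (apply lt_0_INR; lia). assert (0 < INR (S (S i)) * (1 - x) ^ 2) by (apply Rmult_lt_0_compat; auto). lra. }
  assert (Hc : 0 < c) by (unfold c; lra). assert (HKK : 0 <= K) by (unfold K; lra).
  (* With radius [1 / 2] the first coefficient dominates the sum of the others, which later gives
     [f_s <> 0]. *)
  destruct (bifurcation_branch (fwt m kap) lamI lamO (remainder m (GI m kap b) lamI) (remainder m (GO m kap b) lamO) Om_bif c K r0) with (r := / 2)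
    as [a [Lip [v [Ha [HLip [Hv0 Hv]]]]]]; try lra; auto.
  - intros; apply fwt_ge_1.
  - intros i. unfold remainder. rewrite fsin_GI_0. unfold zeroseq. ring.
  - intros i. unfold remainder. rewrite fsin_GO_0. unfold zeroseq. ring.
  - intros r y y' M A1 A2 A3 A4. eapply l1_weaken; [apply (HI r y y' M); auto; lra|].
    unfold K. assert (B1 := l1_ge_0 _ _ A2). assert (B2 := l1_ge_0 _ _ A4). assert (0 <= K2 * r * M) by (repeat apply Rmult_le_pos; auto). lra.
  - intros r y y' M A1 A2 A3 A4. eapply l1_weaken; [apply (HO r y y' M); auto; lra|].
    unfold K. assert (B1 := l1_ge_0 _ _ A2). assert (B2 := l1_ge_0 _ _ A4). assert (0 <= K1 * r * M) by (repeat apply Rmult_le_pos; auto). lra.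
  - rewrite eigenvalue. fold x. simpl. ring.
  - rewrite Hlam. apply Rgt_not_eq, Rdiv_lt_0_compat; lra.
  - rewrite Hlam. replace (/ (2 * (b / fwt m kap O))) with (fwt m kap O / (2 * b)) by (field; lra).
    rewrite Rabs_pos_eq; unfold c; lra.
  - intros i. rewrite Hlam. assert (A := fwt_ge_1 m kap i).
    rewrite Rabs_pos_eq by (left; apply Rdiv_lt_0_compat; lra).
    replace (fwt m kap i * (b / fwt m kap i)) with b by (field; lra). unfold c; lra.
  - intros i. rewrite eigenvalue. fold x. assert (A := om_gt_0 (S i)).
    assert (B := HL i). assert (B' := HL0 i).
    assert (0 < b / om m kap (S i)) by (apply Rdiv_lt_0_compat; lra). nra.
  - intros i. rewrite eigenvalue. fold x. assert (A := om_gt_0 (S i)).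
    assert (B := HL i). assert (B' := HL0 i). assert (F := fwt_ge_1 m kap (S i)).
    set (y := INR (S (S i)) * (1 - x) - (1 - x ^ S (S i))) in *.
    assert (Hy : 0 < y) by lra.
    rewrite Rabs_inv, Rabs_mult, Rabs_Ropp.
    rewrite (Rabs_pos_eq y) by lra. rewrite (Rabs_pos_eq (b / om m kap (S i))) by (left; apply Rdiv_lt_0_compat; lra).
    replace (/ (b / om m kap (S i) * y)) with (om m kap (S i) / b * / y) by (field; lra).
    assert (Hn : 0 < INR (S (S i))) by (apply lt_0_INR; lia).
    apply Rle_trans with (om m kap (S i) / b * / (INR (S (S i)) * (1 - x) ^ 2 / 2)).
    + apply Rmult_le_compat_l; [left; apply Rdiv_lt_0_compat; lra|]. apply Rinv_le_contravar; auto.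
    + unfold om, freq. rewrite mult_INR.
      replace (INR (S (S i)) * INR m * fwt m kap (S i) / b * / (INR (S (S i)) * (1 - x) ^ 2 / 2))
        with (2 * INR m / (b * (1 - x) ^ 2) * fwt m kap (S i)) by (field; lra).
      apply Rmult_le_compat_r; [lra|]. unfold c. lra.
  - exists (Rmin a (r0 / 2)), Lip, v.
    split; [apply Rmin_pos; lra|]. split; [auto|]. split; [auto|].
    intros s Hs.
    assert (Hsa : Rabs s < a) by (eapply Rlt_le_trans; [exact Hs|apply Rmin_l]).
    assert (Hsr : Rabs s < r0 / 2) by (eapply Rlt_le_trans; [exact Hs|apply Rmin_r]).
    destruct (Hv s Hsa) as [V1 [V2 V3]]. split; [auto|]. split.
    + set (y := fun j => s * tail1 (v s) j). set (w := 2 * (Om_bif + v s O)).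
      assert (Hy : l1 y r0).
      { eapply l1_weaken; [apply scaled_tail1_l1; eapply l1_weaken; [exact V1|lra]|lra]. }
      assert (W1 : W 0 0 (GI m kap b y) K1) by (apply WI; eapply l1_weaken; eauto).
      assert (W2 : W 0 0 (GO m kap b y) K2) by (apply WO; eapply l1_weaken; eauto).
      intros t. refine (fsin_eq_0_Im m kap (fun s t => GI m kap b y s t + RtoC w * GO m kap b y s t)%C _ hm _ _ t).
      * apply W_plus; [exact W1|apply W_scal; exact W2].
      * intros i.
        assert (C1 : ccont (fun s => GI m kap b y s 0)) by (eapply W_ccont_s; eauto).
        assert (C2 : ccont (fun s => GO m kap b y s 0)) by (eapply W_ccont_s; eauto).
        rewrite (fsin_plus _ (GI m kap b y) (fun s t => RtoC w * GO m kap b y s t)%C); auto.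
        2: { apply (ccont_scal w (fun s => GO m kap b y s 0)), C2. }
        rewrite fsin_scal by auto. rewrite <- (V2 i). unfold remainder. fold y. unfold w.
        change (s * tail1 (v s) i) with (y i). ring.
    + intros s' Hs'. apply V3. eapply Rlt_le_trans; [exact Hs'|apply Rmin_l].
Qed.

End Solution.

(** * Estimates on powers, complex derivatives and topology of the plane *)

Lemma Cpow_le_1 (z : C) n : Cmod z <= 1 -> Cmod (z ^ n) <= 1.
Proof.
  intros H. rewrite Cmod_pow. rewrite <- (pow1 n). apply pow_incr. split; [apply Cmod_ge_0|auto].
Qed.

Lemma Cpow_lipschitz (z z' : C) n : Cmod z <= 1 -> Cmod z' <= 1 ->
  Cmod (z ^ n - z' ^ n) <= INR n * Cmod (z - z').
Proof.
  intros Hz Hz'. induction n.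
  - simpl. replace (1 - 1)%C with (RtoC 0) by ring. rewrite Cmod_0. lra.
  - rewrite S_INR, !Cpow_S.
    replace (z * z ^ n - z' * z' ^ n)%C with (z * (z ^ n - z' ^ n) + (z - z') * z' ^ n)%C by ring.
    eapply Rle_trans; [apply Cmod_triangle|]. rewrite !Cmod_mult.
    assert (A := Cpow_le_1 z' n Hz'). assert (B := Cmod_ge_0 (z ^ n - z' ^ n)).
    assert (D := Cmod_ge_0 (z - z')). assert (E := Cmod_ge_0 z). assert (F := Cmod_ge_0 (z' ^ n)). nra.
Qed.

(** The remainder at [n + 1] is [z] times the one at [n] plus [n z'^(n-1) (z - z')^2], and
    [n^2 + n <= (n + 1)^2]. *)
Lemma Cpow_taylor (z z' : C) n : Cmod z <= 1 -> Cmod z' <= 1 ->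
  Cmod (z ^ n - z' ^ n - INR n * z' ^ (n - 1) * (z - z')) <= INR n ^ 2 * Cmod (z - z') ^ 2.
Proof.
  intros Hz Hz'. induction n.
  - simpl. replace (1 - 1 - 0 * 1 * (z - z'))%C with (RtoC 0) by ring. rewrite Cmod_0. lra.
  - replace (S n - 1)%nat with n by lia.
    assert (E : (z' * (INR n * z' ^ (n - 1)) = INR n * z' ^ n)%C).
    { destruct n; [simpl; ring|]. replace (S n - 1)%nat with n by lia. rewrite (Cpow_S z' n). ring. }
    replace (z ^ S n - z' ^ S n - INR (S n) * z' ^ n * (z - z'))%C
      with (z * (z ^ n - z' ^ n - INR n * z' ^ (n - 1) * (z - z')) + (INR n * z' ^ (n - 1)) * ((z - z') * (z - z')))%C.
    + eapply Rle_trans; [apply Cmod_triangle|]. rewrite !Cmod_mult, Cmod_R, (Rabs_pos_eq (INR n)) by apply pos_INR.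
      assert (A := Cpow_le_1 z' (n - 1) Hz'). assert (B := Cmod_ge_0 (z - z')). assert (E1 := Cmod_ge_0 z).
      assert (F := Cmod_ge_0 (z' ^ (n - 1))).
      set (R := Cmod (z ^ n - z' ^ n - INR n * z' ^ (n - 1) * (z - z'))) in *.
      assert (R0 : 0 <= R) by apply Cmod_ge_0.
      rewrite S_INR. assert (N := pos_INR n). set (d := Cmod (z - z')) in *.
      assert (Cmod z * R <= INR n ^ 2 * d ^ 2) by nra.
      assert (INR n * Cmod (z' ^ (n - 1)) <= INR n * 1) by (apply Rmult_le_compat_l; auto).
      assert (0 <= d * d) by nra.
      assert (INR n * Cmod (z' ^ (n - 1)) * (d * d) <= INR n * 1 * (d * d)) by (apply Rmult_le_compat_r; auto).
      nra.
    + rewrite S_INR, RtoC_plus, !Cpow_S.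
      transitivity (z * z ^ n - z * z' ^ n - z * (INR n * z' ^ (n - 1)) * (z - z') + (z - z') * (z * (INR n * z' ^ (n - 1)) - z' * (INR n * z' ^ (n - 1))))%C; [ring|].
      rewrite E. ring.
Qed.

(* At [n = 0] the truncated exponent [n - 1 = 0] is multiplied by [INR 0 = 0]. *)
Lemma Cpow_deriv_lipschitz (z z' : C) n : Cmod z <= 1 -> Cmod z' <= 1 ->
  Cmod (INR n * z ^ (n - 1) - INR n * z' ^ (n - 1)) <= INR n ^ 2 * Cmod (z - z').
Proof.
  intros Hz Hz'.
  replace (INR n * z ^ (n - 1) - INR n * z' ^ (n - 1))%C with (INR n * (z ^ (n - 1) - z' ^ (n - 1)))%C by ring.
  rewrite Cmod_RC, Rabs_pos_eq by apply pos_INR.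
  assert (A := Cpow_lipschitz z z' (n - 1) Hz Hz'). assert (B := Cmod_ge_0 (z - z')).
  assert (N := pos_INR n).
  assert (M : INR (n - 1) <= INR n) by (apply le_INR; lia).
  assert (INR (n - 1) * Cmod (z - z') <= INR n * Cmod (z - z')) by (apply Rmult_le_compat_r; auto).
  simpl. rewrite Rmult_1_r, Rmult_assoc. apply Rmult_le_compat_l; lra.
Qed.

Lemma is_derive_C_quadratic (f : C -> C) (z l : C) K d : 0 < d ->
  (forall u, Cmod (u - z) < d -> Cmod (f u - f z - (u - z) * l) <= K * Cmod (u - z) ^ 2) ->
  is_derive (K := C_AbsRing) (V := C_NormedModule) f z l.
Proof.
  intros Hd0 H. split; [apply is_linear_scal_l|].
  intros y Hy. apply (is_filter_lim_locally_unique (V := AbsRing_NormedModule C_AbsRing)) in Hy. subst y.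
  intros eps.
  assert (HK : 0 < Rabs K + 1) by (assert (A := Rabs_pos K); lra).
  assert (Hd : 0 < Rmin d (eps / (Rabs K + 1))) by (apply Rmin_pos; [auto|]; apply Rdiv_lt_0_compat; [apply cond_pos|auto]).
  exists (mkposreal _ Hd). intros u Hu.
  change (Cmod (u - z) < Rmin d (eps / (Rabs K + 1))) in Hu.
  assert (Hu1 : Cmod (u - z) < d) by (eapply Rlt_le_trans; [exact Hu|apply Rmin_l]).
  assert (Hu2 : Cmod (u - z) < eps / (Rabs K + 1)) by (eapply Rlt_le_trans; [exact Hu|apply Rmin_r]).
  change (Cmod ((f u - f z) - ((u - z) * l)) <= eps * Cmod (u - z)).
  eapply Rle_trans; [apply H, Hu1|].
  assert (A := Cmod_ge_0 (u - z)). assert (B := Rle_abs K).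
  assert (C1 : Cmod (u - z) * (Rabs K + 1) <= eps).
  { apply Rmult_lt_compat_r with (r := Rabs K + 1) in Hu2; auto. unfold Rdiv in Hu2. rewrite Rmult_assoc, Rinv_l in Hu2 by lra. lra. }
  nra.
Qed.

Lemma continuous_on_C (T : UniformSpace) (D : T -> Prop) (f : T -> C) :
  (forall x, D x -> forall e, 0 < e -> exists d : posreal, forall y, D y -> ball x d y -> Cmod (f y - f x) < e) ->
  continuous_on D f.
Proof.
  intros H x Hx P [eps HP]. destruct (H x Hx eps (cond_pos eps)) as [d Hd].
  exists d. intros y Hy Dy. apply HP.
  assert (A := Hd y Dy Hy). split.
  - eapply Rle_lt_trans; [apply (re_le_Cmod (f y - f x))|exact A].
  - eapply Rle_lt_trans; [apply (im_le_Cmod (f y - f x))|exact A].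
Qed.

Lemma C_ball_Cmod (z y : C) d : ball z d y -> Cmod (y - z) < 2 * d.
Proof.
  intros [H1 H2]. unfold ball in H1, H2; simpl in H1, H2.
  unfold AbsRing_ball, abs, minus, plus, opp in H1, H2; simpl in H1, H2.
  eapply Rle_lt_trans; [apply Cmod_le_ReIm|]. rewrite Re_minus, Im_minus. unfold Re, Im, Rminus. lra.
Qed.

Lemma Cmod_C_ball (z y : C) d : Cmod (y - z) < d -> ball z d y.
Proof.
  intros A. split.
  - eapply Rle_lt_trans; [apply (re_le_Cmod (y - z))|exact A].
  - eapply Rle_lt_trans; [apply (im_le_Cmod (y - z))|exact A].
Qed.

Lemma continuous_on_C_inv (T : UniformSpace) (D : T -> Prop) (f : T -> C) : continuous_on D f ->
  forall x, D x -> forall e, 0 < e -> exists d : posreal, forall y, D y -> ball x d y -> Cmod (f y - f x) < e.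
Proof.
  intros H x Hx e He. assert (He2 : 0 < e / 2) by lra.
  destruct (H x Hx (ball (f x) (mkposreal _ He2))) as [d Hd]; [now exists (mkposreal _ He2)|].
  exists d. intros y Dy Hy. assert (A := C_ball_Cmod _ _ _ (Hd y Hy Dy)). simpl in A. lra.
Qed.

Lemma open_C (U : C -> Prop) : open U <-> forall z, U z -> exists d, 0 < d /\ forall y, Cmod (y - z) < d -> U y.
Proof.
  split.
  - intros H z Hz. destruct (H z Hz) as [d Hd]. exists d. split; [apply cond_pos|].
    intros y Hy. apply Hd. now apply Cmod_C_ball.
  - intros H z Hz. destruct (H z Hz) as [d [Hd Hd']].
    assert (Hd2 : 0 < d / 2) by lra. exists (mkposreal _ Hd2).
    intros y Hy. apply Hd'. apply C_ball_Cmod in Hy. simpl in Hy. lra.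
Qed.

Section PowerSum.
(** [f(w)] is the power series [psum] at [1 / w]. Two powers of [k] in the weight make both [psum]
    and [dpsum] Lipschitz on the closed unit disc, with the same constant [A]. *)
Context (a : nat -> R) (k : nat -> nat) (A : R).
Context (hA : sumle (fun i => (1 + INR (k i)) ^ 2 * Rabs (a i)) A).

Definition psum (z : C) : C := CSer (fun i => a i * z ^ k i)%C.
Definition dpsum (z : C) : C := CSer (fun i => a i * (INR (k i) * z ^ (k i - 1)))%C.

Lemma A_ge_0 : 0 <= A.
Proof. eapply sumle_ge_0; eauto. Qed.

Lemma Csumle_coeff (g : nat -> C) d : 0 <= d ->
  (forall i, Cmod (g i) <= (1 + INR (k i)) ^ 2 * d) ->
  Csumle (fun i => a i * g i)%C (A * d).
Proof.
  intros Hd Hg. eapply sumle_mono; [|rewrite Rmult_comm; apply (sumle_scal d); [auto|exact hA]].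
  intros i. simpl. rewrite Cmod_RC. assert (B := Rabs_pos (a i)). specialize (Hg i). simpl in Hg. nra.
Qed.

Lemma k_sq i : 1 <= (1 + INR (k i)) ^ 2 /\ INR (k i) <= (1 + INR (k i)) ^ 2 /\ INR (k i) ^ 2 <= (1 + INR (k i)) ^ 2.
Proof. assert (B := pos_INR (k i)). repeat split; nra. Qed.

Lemma psum_Csumle z : Cmod z <= 1 -> Csumle (fun i => a i * z ^ k i)%C A.
Proof.
  intros Hz. rewrite <- (Rmult_1_r A). apply Csumle_coeff; [lra|]. intros i.
  destruct (k_sq i) as [B _]. assert (D := Cpow_le_1 z (k i) Hz). lra.
Qed.

Lemma dpsum_Csumle z : Cmod z <= 1 -> Csumle (fun i => a i * (INR (k i) * z ^ (k i - 1)))%C A.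
Proof.
  intros Hz. rewrite <- (Rmult_1_r A). apply Csumle_coeff; [lra|]. intros i.
  destruct (k_sq i) as [_ [B _]]. assert (D := Cpow_le_1 z (k i - 1) Hz).
  rewrite Cmod_RC, Rabs_pos_eq by apply pos_INR. assert (E := pos_INR (k i)). nra.
Qed.

Lemma psum_Cmod z : Cmod z <= 1 -> Cmod (psum z) <= A.
Proof. intros Hz. apply CSer_Cmod, psum_Csumle, Hz. Qed.

Lemma dpsum_Cmod z : Cmod z <= 1 -> Cmod (dpsum z) <= A.
Proof. intros Hz. apply CSer_Cmod, dpsum_Csumle, Hz. Qed.

Lemma psum_lipschitz z z' : Cmod z <= 1 -> Cmod z' <= 1 ->
  Cmod (psum z - psum z') <= A * Cmod (z - z').
Proof.
  intros Hz Hz'. unfold psum. rewrite <- (CSer_minus _ _ _ _ (psum_Csumle z Hz) (psum_Csumle z' Hz')).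
  rewrite (CSer_ext _ (fun i => a i * (z ^ k i - z' ^ k i))%C) by (intros; ring).
  apply CSer_Cmod, Csumle_coeff; [apply Cmod_ge_0|]. intros i.
  destruct (k_sq i) as [_ [B _]]. assert (D := Cmod_ge_0 (z - z')).
  eapply Rle_trans; [now apply Cpow_lipschitz|]. now apply Rmult_le_compat_r.
Qed.

Lemma dpsum_lipschitz z z' : Cmod z <= 1 -> Cmod z' <= 1 ->
  Cmod (dpsum z - dpsum z') <= A * Cmod (z - z').
Proof.
  intros Hz Hz'. unfold dpsum. rewrite <- (CSer_minus _ _ _ _ (dpsum_Csumle z Hz) (dpsum_Csumle z' Hz')).
  rewrite (CSer_ext _ (fun i => a i * (INR (k i) * z ^ (k i - 1) - INR (k i) * z' ^ (k i - 1)))%C) by (intros; ring).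
  apply CSer_Cmod, Csumle_coeff; [apply Cmod_ge_0|]. intros i.
  destruct (k_sq i) as [_ [_ B]]. assert (D := Cmod_ge_0 (z - z')).
  eapply Rle_trans; [now apply Cpow_deriv_lipschitz|]. now apply Rmult_le_compat_r.
Qed.

Lemma psum_taylor z z' : Cmod z <= 1 -> Cmod z' <= 1 ->
  Cmod (psum z - psum z' - dpsum z' * (z - z')) <= A * Cmod (z - z') ^ 2.
Proof.
  intros Hz Hz'. unfold psum, dpsum.
  rewrite <- (CSer_minus _ _ _ _ (psum_Csumle z Hz) (psum_Csumle z' Hz')).
  rewrite (Cmult_comm (CSer _)), <- (CSer_scal (z - z') _ _ (dpsum_Csumle z' Hz')).
  rewrite <- (CSer_minus _ _ _ (Cmod (z - z') * A) (Csumle_minus _ _ _ _ (psum_Csumle z Hz) (psum_Csumle z' Hz'))).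
  - rewrite (CSer_ext _ (fun i => a i * (z ^ k i - z' ^ k i - INR (k i) * z' ^ (k i - 1) * (z - z')))%C) by (intros; ring).
    apply CSer_Cmod, Csumle_coeff; [apply pow_le, Cmod_ge_0|]. intros i.
    destruct (k_sq i) as [_ [_ B]]. assert (D := pow2_ge_0 (Cmod (z - z'))).
    eapply Rle_trans; [now apply Cpow_taylor|]. now apply Rmult_le_compat_r.
  - eapply sumle_mono; [|apply (sumle_scal (Cmod (z - z'))); [apply Cmod_ge_0|apply (dpsum_Csumle z' Hz')]].
    intros i. simpl. rewrite Cmod_mult. lra.
Qed.

Lemma psum_conj z : psum (Cconj z) = Cconj (psum z).
Proof.
  unfold psum. rewrite CSer_conj. apply CSer_ext. intros i.
  rewrite Cmult_conj, Cpow_conj. f_equal. apply Cext; simpl; ring.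
Qed.

(** * The exterior map extended to a bi-Lipschitz homeomorphism of the plane *)

(* On [|w| = 1] both branches agree, so [f] extends as [psum (refl w)], antiholomorphic
   inside the disc and holomorphic outside. *)
Definition refl (w : C) : C := if Rle_dec (Cmod w) 1 then Cconj w else (/ w)%C.

Lemma Cmod_gt_1_neq_0 (w : C) : 1 < Cmod w -> w <> 0%C.
Proof. intros H. apply Cmod_gt_0. lra. Qed.

Lemma refl_Cmod w : Cmod (refl w) <= 1.
Proof.
  unfold refl. destruct (Rle_dec (Cmod w) 1) as [H|H]; [now rewrite Cmod_conj|].
  rewrite Cmod_inv by (apply Cmod_gt_1_neq_0; lra).
  rewrite <- Rinv_1. apply Rinv_le_contravar; lra.
Qed.

Lemma refl_in w : Cmod w <= 1 -> refl w = Cconj w.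
Proof. intros H. unfold refl. destruct (Rle_dec (Cmod w) 1); [easy|contradiction]. Qed.

Lemma refl_out w : 1 < Cmod w -> refl w = (/ w)%C.
Proof. intros H. unfold refl. destruct (Rle_dec (Cmod w) 1); [lra|easy]. Qed.

(** The squares of [|conj w u - 1|] and [|w - u|] differ by [(1 - |w|^2) (1 - |u|^2)], which is at
    most 0 here. *)
Lemma refl_lipschitz_mixed w u : Cmod w <= 1 -> 1 < Cmod u -> Cmod (Cconj w - / u) <= Cmod (w - u).
Proof.
  intros Hw Hu. assert (Nu := Cmod_gt_1_neq_0 u Hu).
  replace (Cconj w - / u)%C with ((Cconj w * u - 1) * / u)%C by (field; auto).
  rewrite Cmod_mult, Cmod_inv by auto.
  assert (E : Cmod (Cconj w * u - 1) ^ 2 - Cmod (w - u) ^ 2 = (1 - Cmod w ^ 2) * (1 - Cmod u ^ 2)).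
  { rewrite !Cmod2_alt. autorewrite with reim. ring. }
  assert (A0 := Cmod_ge_0 w). assert (A1 := Cmod_ge_0 (Cconj w * u - 1)). assert (A2 := Cmod_ge_0 (w - u)).
  assert (L : Cmod (Cconj w * u - 1) <= Cmod (w - u)).
  { apply Rsqr_incr_0_var; auto. unfold Rsqr.
    assert (0 <= (1 - Cmod w ^ 2) * (Cmod u ^ 2 - 1)) by (apply Rmult_le_pos; nra). nra. }
  assert (I : / Cmod u <= 1) by (rewrite <- Rinv_1; apply Rinv_le_contravar; lra).
  assert (0 < / Cmod u) by (apply Rinv_0_lt_compat; lra). nra.
Qed.

Lemma refl_lipschitz w u : Cmod (refl w - refl u) <= Cmod (w - u).
Proof.
  destruct (Rle_lt_dec (Cmod w) 1) as [Hw|Hw], (Rle_lt_dec (Cmod u) 1) as [Hu|Hu].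
  - rewrite !refl_in by auto. rewrite <- Cminus_conj, Cmod_conj. lra.
  - rewrite refl_in, refl_out by auto. now apply refl_lipschitz_mixed.
  - rewrite refl_out, refl_in by auto. rewrite (Cmod_minus_sym (/ w)), (Cmod_minus_sym w). now apply refl_lipschitz_mixed.
  - rewrite !refl_out by auto. assert (Nu := Cmod_gt_1_neq_0 u Hu). assert (Nw := Cmod_gt_1_neq_0 w Hw).
    replace (/ w - / u)%C with ((u - w) * (/ w * / u))%C by (field; auto).
    rewrite !Cmod_mult, !Cmod_inv, (Cmod_minus_sym u) by auto.
    assert (I : / Cmod u <= 1) by (rewrite <- Rinv_1; apply Rinv_le_contravar; lra).
    assert (I' : / Cmod w <= 1) by (rewrite <- Rinv_1; apply Rinv_le_contravar; lra).
    assert (0 < / Cmod u) by (apply Rinv_0_lt_compat; lra). assert (0 < / Cmod w) by (apply Rinv_0_lt_compat; lra).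
    assert (A2 := Cmod_ge_0 (w - u)). assert (/ Cmod w * / Cmod u <= 1) by nra. nra.
Qed.

(** [hAb] gives the perturbation of [b w] at most half its Lipschitz constant; [hbA] keeps the
    closed patch inside the unit disc. *)
Context (b : R) (hb : 0 < b) (hAb : A <= b / 2) (hbA : b + A < 1).

Definition homeo (w : C) : C := (b * w + psum (refl w))%C.

Lemma psum_refl_lipschitz w u : Cmod (psum (refl w) - psum (refl u)) <= b / 2 * Cmod (w - u).
Proof.
  eapply Rle_trans; [apply psum_lipschitz; apply refl_Cmod|].
  assert (B := refl_lipschitz w u). assert (D := Cmod_ge_0 (refl w - refl u)). assert (E := A_ge_0). nra.
Qed.

Lemma homeo_lower w u : b / 2 * Cmod (w - u) <= Cmod (homeo w - homeo u).
Proof.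
  assert (B := psum_refl_lipschitz w u).
  assert (D := Cmod_minus_rev (b * (w - u)) (psum (refl u) - psum (refl w))).
  rewrite Cmod_RC, (Rabs_pos_eq b), (Cmod_minus_sym (psum (refl u))) in D by lra.
  replace (b * (w - u) - (psum (refl u) - psum (refl w)))%C with (homeo w - homeo u)%C in D by (unfold homeo; ring).
  lra.
Qed.

Lemma homeo_upper w u : Cmod (homeo w - homeo u) <= 2 * b * Cmod (w - u).
Proof.
  assert (B := psum_refl_lipschitz w u).
  replace (homeo w - homeo u)%C with (b * (w - u) + (psum (refl w) - psum (refl u)))%C by (unfold homeo; ring).
  eapply Rle_trans; [apply Cmod_triangle|]. rewrite Cmod_RC, Rabs_pos_eq by lra.
  assert (D := Cmod_ge_0 (w - u)). nra.
Qed.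

Lemma homeo_inj w u : homeo w = homeo u -> w = u.
Proof.
  intros E. apply Cminus_eq_0. assert (B := homeo_lower w u). assert (D := Cmod_ge_0 (w - u)).
  rewrite E in B. replace (homeo u - homeo u)%C with (RtoC 0) in B by ring. rewrite Cmod_0 in B. nra.
Qed.

(** A preimage of [z] is a fixed point of [T], which contracts by [1 / 2]. *)
Lemma homeo_surj z : exists w, homeo w = z.
Proof.
  set (T := fun w => (/ b * (z - psum (refl w)))%C).
  assert (Nb : RtoC b <> 0%C) by (intros E; apply RtoC_inj in E; lra).
  assert (HT : forall w u, Cmod (T w - T u) <= / 2 * Cmod (w - u)).
  { intros w u. replace (T w - T u)%C with (/ b * (psum (refl u) - psum (refl w)))%C by (unfold T; ring).
    rewrite <- RtoC_inv, Cmod_RC, Rabs_pos_eq, Cmod_minus_sym by (try (left; apply Rinv_0_lt_compat); lra).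
    assert (B := psum_refl_lipschitz w u).
    apply (Rmult_le_reg_l b); [auto|]. rewrite <- Rmult_assoc, Rinv_r by lra. lra. }
  set (u := fun n => Nat.iter n T 0%C). set (r := Cmod (u 1%nat - u O)).
  assert (Hu : forall n, Cmod (u (S n) - u n) <= r * (/ 2) ^ n).
  { induction n; [rewrite pow_O, Rmult_1_r; apply Rle_refl|].
    change (u (S (S n))) with (T (u (S n))). change (u (S n)) with (T (u n)) at 2.
    eapply Rle_trans; [apply HT|]. rewrite <- tech_pow_Rmult. lra. }
  destruct (geometric_step_limit (fun n => Re (u n)) r) as [x Hx].
  { intros n. rewrite <- Re_minus. eapply Rle_trans; [apply re_le_Cmod|apply Hu]. }
  destruct (geometric_step_limit (fun n => Im (u n)) r) as [y Hy].
  { intros n. rewrite <- Im_minus. eapply Rle_trans; [apply im_le_Cmod|apply Hu]. }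
  assert (HL : forall e, 0 < e -> exists N, forall n, (N <= n)%nat -> Cmod (u n - (x, y)) <= e).
  { intros e He.
    assert (He2 : 0 < e / 2) by lra.
    apply is_lim_seq_spec in Hx. apply is_lim_seq_spec in Hy.
    destruct (Hx (mkposreal _ He2)) as [N1 H1]. destruct (Hy (mkposreal _ He2)) as [N2 H2].
    exists (max N1 N2). intros n Hn.
    eapply Rle_trans; [apply Cmod_le_ReIm|]. rewrite Re_minus, Im_minus.
    specialize (H1 n ltac:(lia)). specialize (H2 n ltac:(lia)). simpl in H1, H2. simpl. lra. }
  exists (x, y). apply Cmod_le_eps_eq. intros e He.
  assert (Hb1 : b < 1) by (assert (B4 := A_ge_0); lra).
  destruct (HL (e / 2)) as [N HN]; [lra|].
  (* Two consecutive iterates express [z] exactly, so only their distance to the limit remains to be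
     estimated. *)
  assert (E : z = (b * u (S N) + psum (refl (u N)))%C).
  { change (u (S N)) with (T (u N)). unfold T. field. auto. }
  rewrite E. unfold homeo.
  replace (b * (x, y) + psum (refl (x, y)) - (b * u (S N) + psum (refl (u N))))%C
    with (b * ((x, y) - u (S N)) + (psum (refl (x, y)) - psum (refl (u N))))%C by ring.
  eapply Rle_trans; [apply Cmod_triangle|]. rewrite Cmod_RC, Rabs_pos_eq by lra.
  assert (B1 := HN N (le_n N)). assert (B2 := HN (S N) ltac:(lia)).
  assert (B3 := psum_refl_lipschitz (x, y) (u N)). rewrite (Cmod_minus_sym (x, y) (u N)) in B3.
  rewrite Cmod_minus_sym. assert (B4 := A_ge_0).
  assert (b * Cmod (u (S N) - (x, y)) <= 1 * (e / 2)) by (apply Rmult_le_compat; try lra; apply Cmod_ge_0).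
  assert (b / 2 * Cmod (u N - (x, y)) <= 1 * (e / 2)) by (apply Rmult_le_compat; try lra; apply Cmod_ge_0).
  lra.
Qed.

Definition homeo_inv (z : C) : C := proj1_sig (constructive_indefinite_description _ (homeo_surj z)).

Lemma homeo_homeo_inv z : homeo (homeo_inv z) = z.
Proof. unfold homeo_inv. destruct constructive_indefinite_description; auto. Qed.

Lemma homeo_inv_homeo w : homeo_inv (homeo w) = w.
Proof. apply homeo_inj, homeo_homeo_inv. Qed.

Lemma homeo_inv_lipschitz z y : Cmod (homeo_inv z - homeo_inv y) <= 2 / b * Cmod (z - y).
Proof.
  assert (B := homeo_lower (homeo_inv z) (homeo_inv y)). rewrite !homeo_homeo_inv in B.
  apply (Rmult_le_reg_l (b / 2)); [lra|]. eapply Rle_trans; [exact B|]. right. field. lra.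
Qed.

Definition patch (z : C) : Prop := exists w, Cmod w < 1 /\ z = homeo w.

Lemma patch_iff z : patch z <-> Cmod (homeo_inv z) < 1.
Proof.
  split.
  - intros [w [Hw ->]]. now rewrite homeo_inv_homeo.
  - intros H. exists (homeo_inv z). now rewrite homeo_homeo_inv.
Qed.

Lemma patch_homeo w : patch (homeo w) <-> Cmod w < 1.
Proof. now rewrite patch_iff, homeo_inv_homeo. Qed.

Lemma Cmod_homeo_inv_near z y : Cmod (homeo_inv y) <= Cmod (homeo_inv z) + 2 / b * Cmod (y - z) .
Proof.
  assert (B := homeo_inv_lipschitz y z).
  assert (D := Cmod_minus_rev (homeo_inv y) (homeo_inv z)). lra.
Qed.

Lemma two_div_b_mult d : 2 / b * (b / 2 * d) = d.
Proof. field. lra. Qed.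

Lemma homeo_inv_open_lt z c : Cmod (homeo_inv z) < c -> exists d, 0 < d /\
  forall y, Cmod (y - z) < d -> Cmod (homeo_inv y) < c.
Proof.
  intros H. exists (b / 2 * (c - Cmod (homeo_inv z))). split; [apply Rmult_lt_0_compat; lra|].
  intros y Hy. assert (B := Cmod_homeo_inv_near z y).
  assert (P : 0 < 2 / b) by (apply Rdiv_lt_0_compat; lra).
  apply (Rmult_lt_compat_l (2 / b)) in Hy; auto. rewrite two_div_b_mult in Hy. lra.
Qed.

Lemma homeo_inv_open_gt z c : c < Cmod (homeo_inv z) -> exists d, 0 < d /\
  forall y, Cmod (y - z) < d -> c < Cmod (homeo_inv y).
Proof.
  intros H. exists (b / 2 * (Cmod (homeo_inv z) - c)). split; [apply Rmult_lt_0_compat; lra|].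
  intros y Hy. assert (B := Cmod_homeo_inv_near y z). rewrite Cmod_minus_sym in B.
  assert (P : 0 < 2 / b) by (apply Rdiv_lt_0_compat; lra).
  apply (Rmult_lt_compat_l (2 / b)) in Hy; auto. rewrite two_div_b_mult in Hy. lra.
Qed.

Lemma patch_open : open patch.
Proof.
  apply open_C. intros z Hz. apply patch_iff in Hz.
  destruct (homeo_inv_open_lt z 1 Hz) as [d [Hd H]]. exists d. split; auto.
  intros y Hy. now apply patch_iff, H.
Qed.

Lemma homeo_near w e : 0 < e -> exists d, 0 < d /\ forall u, Cmod (u - w) < d -> Cmod (homeo u - homeo w) < e.
Proof.
  intros He. exists (e / (2 * b)). split; [apply Rdiv_lt_0_compat; lra|].
  intros u Hu. assert (B := homeo_upper u w).
  apply (Rmult_lt_compat_l (2 * b)) in Hu; [|lra].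
  replace (2 * b * (e / (2 * b))) with e in Hu by (field; lra). lra.
Qed.

Lemma patch_closure z : closure patch z <-> Cmod (homeo_inv z) <= 1.
Proof.
  split.
  - intros H. apply Rnot_lt_le. intros Hn. destruct (homeo_inv_open_gt z 1 Hn) as [d [Hd Hd']].
    destruct (H (mkposreal d Hd)) as [y [Py Hy]]. apply Hd' in Hy. rewrite patch_iff in Py. lra.
  - intros H eps. destruct (homeo_near (homeo_inv z) eps (cond_pos eps)) as [d [Hd Hd']].
    rewrite homeo_homeo_inv in Hd'. set (w := homeo_inv z) in *.
    set (t := Rmin (d / 2) (/ 2)).
    assert (Ht : 0 < t) by (apply Rmin_pos; lra). assert (Ht1 : t <= / 2) by apply Rmin_r.
    assert (Ht2 : t <= d / 2) by apply Rmin_l. assert (W0 := Cmod_ge_0 w).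
    exists (homeo (RtoC (1 - t) * w)). split.
    + apply patch_homeo. rewrite Cmod_RC, Rabs_pos_eq by lra. nra.
    + apply Hd'. replace (RtoC (1 - t) * w - w)%C with (RtoC (- t) * w)%C by (rewrite RtoC_minus, RtoC_opp; ring).
      rewrite Cmod_RC, Rabs_Ropp, Rabs_pos_eq by lra. nra.
Qed.

Lemma patch_boundary z : boundary patch z <-> Cmod (homeo_inv z) = 1.
Proof.
  unfold boundary. rewrite patch_closure. split.
  - intros [H1 H2]. apply Rle_antisym; auto. apply Rnot_lt_le. intros Hn.
    destruct (homeo_inv_open_lt z 1 Hn) as [d [Hd Hd']].
    destruct (H2 (mkposreal d Hd)) as [y [Py Hy]]. apply Py, patch_iff, Hd', Hy.
  - intros H. split; [lra|]. intros eps. exists z. split.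
    + rewrite patch_iff. lra.
    + replace (z - z)%C with (RtoC 0) by ring. rewrite Cmod_0. apply cond_pos.
Qed.

Lemma homeo_circle w : Cmod w = 1 -> homeo w = (b * w + psum (Cconj w))%C.
Proof. intros H. unfold homeo. rewrite refl_in by lra. reflexivity. Qed.

Lemma patch_boundary_param z : boundary patch z <-> exists w : C, Cmod w = 1 /\ z = (b * w + psum (Cconj w))%C.
Proof.
  rewrite patch_boundary. split.
  - intros H. exists (homeo_inv z). split; auto. rewrite <- homeo_circle by auto. now rewrite homeo_homeo_inv.
  - intros [w [Hw ->]]. rewrite <- homeo_circle by auto. now rewrite homeo_inv_homeo.
Qed.

Lemma patch_closure_in_disc z : closure patch z -> Cmod z < 1.
Proof.
  rewrite patch_closure. intros H. rewrite <- (homeo_homeo_inv z).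
  unfold homeo. eapply Rle_lt_trans; [apply Cmod_triangle|].
  rewrite Cmod_RC, Rabs_pos_eq by lra. assert (B := psum_Cmod _ (refl_Cmod (homeo_inv z))).
  assert (D := Cmod_ge_0 (homeo_inv z)). nra.
Qed.

Lemma segment_disc (w1 w2 : C) t : 0 <= t <= 1 -> Cmod w1 < 1 -> Cmod w2 < 1 ->
  Cmod (w1 + RtoC t * (w2 - w1)) < 1.
Proof.
  intros Ht H1 H2. replace (w1 + RtoC t * (w2 - w1))%C with (RtoC (1 - t) * w1 + RtoC t * w2)%C by (rewrite RtoC_minus; ring).
  eapply Rle_lt_trans; [apply Cmod_triangle|]. rewrite !Cmod_RC, !Rabs_pos_eq by lra.
  assert (A0 := Cmod_ge_0 w1). assert (A1 := Cmod_ge_0 w2).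
  destruct (Req_dec t 0) as [->|]; nra.
Qed.

(* A path in the patch from [U] to [V] must meet [U] and [V] at once, at the last time spent in [U]. *)
Lemma patch_connected : connected patch.
Proof.
  intros U V HU HV Hcov [z1 [P1 U1]] [z2 [P2 V2]].
  rewrite open_C in HU, HV.
  set (w1 := homeo_inv z1). set (w2 := homeo_inv z2).
  set (g := fun t : R => homeo (w1 + RtoC t * (w2 - w1))).
  assert (Hg : forall t, 0 <= t <= 1 -> patch (g t)).
  { intros t Ht. unfold g. apply patch_homeo. apply segment_disc; [auto|now apply patch_iff|now apply patch_iff]. }
  assert (g0 : g 0 = z1).
  { unfold g. replace (w1 + 0 * (w2 - w1))%C with w1 by ring. apply homeo_homeo_inv. }
  assert (g1 : g 1 = z2).
  { unfold g. replace (w1 + 1 * (w2 - w1))%C with w2 by ring. apply homeo_homeo_inv. }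
  assert (Hc : forall t e, 0 < e -> exists d, 0 < d /\ forall u, Rabs (u - t) < d -> Cmod (g u - g t) < e).
  { intros t e He. destruct (homeo_near (w1 + RtoC t * (w2 - w1)) e He) as [d [Hd Hd']].
    exists (d / (Cmod (w2 - w1) + 1)). assert (L := Cmod_ge_0 (w2 - w1)).
    split; [apply Rdiv_lt_0_compat; lra|]. intros u Hu. apply Hd'.
    replace (w1 + RtoC u * (w2 - w1) - (w1 + RtoC t * (w2 - w1)))%C with (RtoC (u - t) * (w2 - w1))%C by (rewrite RtoC_minus; ring).
    rewrite Cmod_RC. apply (Rmult_lt_compat_r (Cmod (w2 - w1) + 1)) in Hu; [|lra].
    unfold Rdiv in Hu. rewrite Rmult_assoc, Rinv_l, Rmult_1_r in Hu by lra.
    assert (B := Rabs_pos (u - t)). nra. }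
  destruct (completeness (fun t => 0 <= t <= 1 /\ U (g t))) as [c [Hc1 Hc2]].
  { exists 1. intros t [Ht _]. lra. }
  { exists 0. rewrite g0. split; [lra|auto]. }
  assert (C0 : 0 <= c) by (apply Hc1; rewrite g0; split; [lra|auto]).
  assert (C1 : c <= 1) by (apply Hc2; intros t [Ht _]; lra).
  destruct (Hcov (g c) (Hg c (conj C0 C1))) as [Uc|Vc].
  - destruct (Req_dec c 1) as [->|Hne].
    + exists z2. rewrite <- g1 at 2. auto.
    + exfalso. destruct (HU (g c) Uc) as [e [He HUe]]. destruct (Hc c e He) as [d [Hd Hd']].
      set (t := Rmin (c + d / 2) 1).
      assert (Ht : c < t) by (apply Rmin_glb_lt; lra).
      assert (Ht1 : t <= 1) by apply Rmin_r. assert (Ht2 : t <= c + d / 2) by apply Rmin_l.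
      assert (B : t <= c); [|lra]. apply Hc1. split; [lra|].
      apply HUe, Hd'. rewrite Rabs_pos_eq; lra.
  - destruct (HV (g c) Vc) as [e [He HVe]]. destruct (Hc c e He) as [d [Hd Hd']].
    assert (Ex : exists t, (0 <= t <= 1 /\ U (g t)) /\ c - d < t).
    { apply Classical_Prop.NNPP. intros Hn. assert (B : c <= c - d); [|lra].
      apply Hc2. intros t Ht. apply Rnot_lt_le. intros L. apply Hn. exists t. auto. }
    destruct Ex as [t [[Ht Ut] Htd]]. assert (Htc : t <= c) by (apply Hc1; auto).
    exists (g t). split; [auto|]. split; [auto|]. apply HVe, Hd'.
    rewrite Rabs_minus_sym, Rabs_pos_eq; lra.
Qed.

Lemma patch_domain : is_domain patch.
Proof.
  split; [|split; [apply patch_open|apply patch_connected]].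
  exists (homeo 0%C). apply patch_homeo. rewrite Cmod_0. lra.
Qed.

(** A loop is carried to the unit disc by [homeo_inv], shrunk radially to 0 and carried back. *)
Lemma patch_simply_connected : simply_connected patch.
Proof.
  split; [apply patch_connected|]. intros g [Hc [Hin Hloop]].
  exists (fun p => homeo (RtoC (1 - snd p) * homeo_inv (g (fst p)))), (homeo 0%C).
  assert (Hc' := continuous_on_C_inv _ _ _ Hc).
  repeat split.
  - apply continuous_on_C. intros [t u] [Ht Hu] e He. simpl in Ht, Hu.
    destruct (homeo_near (RtoC (1 - u) * homeo_inv (g t)) e He) as [d [Hd Hd']].
    assert (Hd1 : 0 < b / 2 * (d / 2)) by (apply Rmult_lt_0_compat; lra).
    destruct (Hc' t Ht _ Hd1) as [d1 Hd1'].
    assert (Hm : 0 < Rmin d1 (d / 2)) by (apply Rmin_pos; [apply cond_pos|lra]).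
    exists (mkposreal _ Hm). intros [t' u'] [Ht' Hu'] [B1 B2]. simpl in *. apply Hd'.
    assert (L1 := Rmin_l d1 (d / 2)). assert (L2 := Rmin_r d1 (d / 2)).
    assert (G := Hd1' t' Ht' (ball_le t _ _ L1 t' B1)).
    apply (Rmult_lt_compat_l (2 / b)) in G; [|apply Rdiv_lt_0_compat; lra]. rewrite two_div_b_mult in G.
    assert (I := homeo_inv_lipschitz (g t') (g t)).
    assert (P := Hin t Ht). rewrite patch_iff in P.
    change (Rabs (u' - u) < Rmin d1 (d / 2)) in B2.
    replace (RtoC (1 - u') * homeo_inv (g t') - RtoC (1 - u) * homeo_inv (g t))%C
      with (RtoC (1 - u') * (homeo_inv (g t') - homeo_inv (g t)) + RtoC (- (u' - u)) * homeo_inv (g t))%C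
      by (rewrite RtoC_opp, !RtoC_minus; ring).
    eapply Rle_lt_trans; [apply Cmod_triangle|]. rewrite !Cmod_RC, Rabs_Ropp.
    unfold unit_interval in Hu'. rewrite (Rabs_pos_eq (1 - u')) by lra.
    assert (X0 := Cmod_ge_0 (homeo_inv (g t') - homeo_inv (g t))). assert (X1 := Cmod_ge_0 (homeo_inv (g t))).
    assert (X2 := Rabs_pos (u' - u)). nra.
  - intros [t u] [Ht Hu]. simpl in *. apply patch_homeo. rewrite Cmod_RC.
    unfold unit_interval in Hu. rewrite Rabs_pos_eq by lra.
    assert (P := Hin t Ht). rewrite patch_iff in P. assert (X1 := Cmod_ge_0 (homeo_inv (g t))). nra.
  - intros u _. simpl. now rewrite Hloop.
  - intros t _. simpl. rewrite Rminus_0_r, Cmult_1_l. apply homeo_homeo_inv.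
  - intros t _. simpl. rewrite Rminus_diag, Cmult_0_l. reflexivity.
Qed.

Lemma homeo_holomorphic w : 1 < Cmod w ->
  ex_derive (K := C_AbsRing) (V := C_NormedModule) homeo w.
Proof.
  intros Hw. assert (Nw := Cmod_gt_1_neq_0 w Hw).
  exists (b - dpsum (/ w) * (/ w * / w))%C.
  (* The radius [Cmod w - 1] keeps [u] outside the closed disc, where [refl] is inversion. The two
     copies of [A] bound the Taylor error of [psum] and the second-order error of inversion. *)
  apply (is_derive_C_quadratic _ _ _ (2 * A) (Cmod w - 1)); [lra|].
  intros u Hu.
  assert (Hu1 : 1 < Cmod u) by (assert (D := Cmod_minus_rev w u); rewrite Cmod_minus_sym in D; lra).
  assert (Nu := Cmod_gt_1_neq_0 u Hu1).
  unfold homeo. rewrite !refl_out by auto.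
  assert (Iw : Cmod (/ w) <= 1) by (rewrite <- (refl_out w Hw); apply refl_Cmod).
  assert (Iu : Cmod (/ u) <= 1) by (rewrite <- (refl_out u Hu1); apply refl_Cmod).
  assert (E : (/ u - / w)%C = (- (u - w) * (/ u * / w))%C) by (field; auto).
  replace (b * u + psum (/ u) - (b * w + psum (/ w)) - (u - w) * (b - dpsum (/ w) * (/ w * / w)))%C
    with ((psum (/ u) - psum (/ w) - dpsum (/ w) * (/ u - / w)) + dpsum (/ w) * ((u - w) * (u - w) * (/ w * / w * / u)))%C
    by (field; auto).
  eapply Rle_trans; [apply Cmod_triangle|].
  assert (T := psum_taylor _ _ Iu Iw). assert (Dp := dpsum_Cmod _ Iw).
  rewrite E in T at 2. rewrite !Cmod_mult, Cmod_opp in T. rewrite !Cmod_mult.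
  set (d := Cmod (u - w)) in *. assert (d0 : 0 <= d) by apply Cmod_ge_0.
  set (p := Cmod (/ u)) in *. set (q := Cmod (/ w)) in *.
  assert (p0 : 0 <= p) by apply Cmod_ge_0. assert (q0 : 0 <= q) by apply Cmod_ge_0.
  assert (D0 := Cmod_ge_0 (dpsum (/ w))). assert (B4 := A_ge_0).
  assert (pq : 0 <= p * q <= 1) by nra.
  assert (X1 : (d * (p * q)) ^ 2 <= d ^ 2).
  { rewrite Rpow_mult_distr. assert ((p * q) ^ 2 <= 1) by nra. assert (0 <= d ^ 2) by (apply pow2_ge_0). nra. }
  assert (X2 : 0 <= q * q * p <= 1) by (split; [repeat apply Rmult_le_pos; auto|nra]).
  assert (X3 : d * d * (q * q * p) <= d ^ 2) by nra.
  assert (X4 : Cmod (dpsum (/ w)) * (d * d * (q * q * p)) <= A * d ^ 2).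
  { apply Rmult_le_compat; auto. apply Rmult_le_pos; [nra|lra]. }
  assert (X5 : A * (d * (p * q)) ^ 2 <= A * d ^ 2) by (apply Rmult_le_compat_l; auto).
  lra.
Qed.

Lemma patch_exterior (f : C -> C) : (forall w, Cmod w = 1 -> f w = homeo w) ->
  extends_conformally_onto_exterior f patch.
Proof.
  intros Hf. exists homeo. repeat split.
  - intros w Hw. now rewrite Hf.
  - apply continuous_on_C. intros w _ e He. destruct (homeo_near w e He) as [d [Hd Hd']].
    assert (Hd2 : 0 < d / 2) by lra. exists (mkposreal _ Hd2).
    intros y _ Hy. apply Hd'. apply C_ball_Cmod in Hy. simpl in Hy. lra.
  - apply homeo_holomorphic.
  - intros w1 w2 _ _. apply homeo_inj.
  - intros H. rewrite patch_closure in H. exists (homeo_inv z). rewrite homeo_homeo_inv. split; auto. lra.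
  - intros [w [Hw ->]]. rewrite patch_closure, homeo_inv_homeo. lra.
Qed.

Lemma refl_conj w : refl (Cconj w) = Cconj (refl w).
Proof.
  unfold refl. rewrite Cmod_conj. destruct (Rle_dec (Cmod w) 1); [easy|].
  rewrite Cinv_conj; [easy|]. apply Cmod_gt_1_neq_0. lra.
Qed.

Lemma homeo_conj w : homeo (Cconj w) = Cconj (homeo w).
Proof.
  unfold homeo. rewrite refl_conj, psum_conj, Cplus_conj, Cmult_conj. f_equal. f_equal. apply Cext; simpl; ring.
Qed.

Lemma patch_conj z : patch z <-> patch (Cconj z).
Proof.
  assert (H : forall z, patch z -> patch (Cconj z)).
  { intros y Hy. rewrite <- (homeo_homeo_inv y), <- homeo_conj. apply patch_homeo. rewrite Cmod_conj. now apply patch_iff. }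
  split; [apply H|]. intros Hz. rewrite <- (Cconj_conj z). now apply H.
Qed.

(** The hypothesis gives [e^{-itk} = e^{it}] for every exponent, so [homeo] commutes with the
    rotation. *)
Lemma patch_rotation t : (forall i, (cis t ^ S (k i))%C = 1%C) -> forall z, patch z <-> patch (cis t * z).
Proof.
  intros Hk.
  assert (Hr : forall w, homeo (cis t * w) = (cis t * homeo w)%C).
  { intros w. assert (R1 : refl (cis t * w) = (cis (- t) * refl w)%C).
    { unfold refl. rewrite Cmod_mult, Cmod_cis, Rmult_1_l. destruct (Rle_dec (Cmod w) 1) as [|Hn].
      - now rewrite Cmult_conj, cis_opp.
      - rewrite <- Cinv_cis. assert (Nw : w <> 0%C) by (apply Cmod_gt_1_neq_0; lra). field. split; [auto|apply cis_neq_0]. }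
    unfold homeo. rewrite R1.
    assert (P : psum (cis (- t) * refl w) = (cis t * psum (refl w))%C).
    { unfold psum. rewrite <- (CSer_scal (cis t) _ _ (psum_Csumle _ (refl_Cmod w))).
      apply CSer_ext. intros i. rewrite Cpow_mult_l.
      assert (Q : (cis (- t) ^ k i)%C = cis t).
      { rewrite <- (Cmult_1_r (cis (- t) ^ k i)), <- (Hk i), Cpow_S.
        transitivity (cis t * (cis (- t) ^ k i * cis t ^ k i))%C; [ring|].
        rewrite <- Cpow_mult_l, cis_opp_mult, Cpow_1_l. ring. }
      rewrite Q. ring. }
    rewrite P. ring. }
  intros z. assert (E : (cis t * z)%C = homeo (cis t * homeo_inv z)) by (rewrite Hr, homeo_homeo_inv; reflexivity).
  rewrite E, patch_homeo, Cmod_mult, Cmod_cis, Rmult_1_l. apply patch_iff.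
Qed.

End PowerSum.

(** * Derivatives of complex curves and integrals of logarithmic derivatives *)

Definition dC (f : R -> C) (t : R) (l : C) : Prop :=
  is_derive (fun u => Re (f u)) t (Re l) /\ is_derive (fun u => Im (f u)) t (Im l).

Lemma is_derive_R_eps (f : R -> R) t l : is_derive f t l <->
  forall e, 0 < e -> exists d, 0 < d /\ forall u, Rabs (u - t) < d -> Rabs (f u - f t - (u - t) * l) <= e * Rabs (u - t).
Proof.
  split.
  - intros [_ H] e He. destruct (H t (fun P HP => HP) (mkposreal e He)) as [d Hd].
    exists d. split; [apply cond_pos|]. intros u Hu. exact (Hd u Hu).
  - intros H. split; [apply is_linear_scal_l|].
    intros y Hy. apply (is_filter_lim_locally_unique (V := R_NormedModule)) in Hy. subst y.
    intros eps. destruct (H eps (cond_pos eps)) as [d [Hd Hd']].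
    exists (mkposreal d Hd). intros u Hu. exact (Hd' u Hu).
Qed.

Lemma dC_is_derive f t l : dC f t l -> is_derive (V := C_R_NormedModule) f t l.
Proof.
  intros [H1 H2]. rewrite is_derive_R_eps in H1, H2.
  split; [apply is_linear_scal_l|].
  intros y Hy. apply (is_filter_lim_locally_unique (V := R_NormedModule)) in Hy. subst y.
  intros eps. assert (He : 0 < eps / 2) by (assert (A := cond_pos eps); lra).
  destruct (H1 _ He) as [d1 [Hd1 E1]]. destruct (H2 _ He) as [d2 [Hd2 E2]].
  exists (mkposreal _ (Rmin_pos _ _ Hd1 Hd2)). intros u Hu.
  change (Rabs (u - t) < Rmin d1 d2) in Hu.
  change (norm (K := R_AbsRing) (V := C_R_NormedModule) (minus (minus (f u) (f t)) (scal (minus u t) l)) <= eps * Rabs (u - t)).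
  rewrite <- Cmod_norm.
  replace (minus (minus (f u) (f t)) (scal (minus u t) l)) with (f u - f t - RtoC (u - t) * l)%C.
  - assert (L1 := E1 u (Rlt_le_trans _ _ _ Hu (Rmin_l _ _))).
    assert (L2 := E2 u (Rlt_le_trans _ _ _ Hu (Rmin_r _ _))).
    eapply Rle_trans; [apply Cmod_le_ReIm|]. autorewrite with reim.
    replace (Re (f u) - Re (f t) - ((u - t) * Re l - 0 * Im l)) with (Re (f u) - Re (f t) - (u - t) * Re l) by ring.
    replace (Im (f u) - Im (f t) - ((u - t) * Im l + 0 * Re l)) with (Im (f u) - Im (f t) - (u - t) * Im l) by ring.
    lra.
  - apply Cext; unfold minus, plus, opp, scal; simpl; unfold prod_plus, prod_opp, prod_scal; simpl;
      unfold scal, mult, plus, opp; simpl; unfold Re, Im, mult; simpl; ring.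
Qed.

Lemma dC_quadratic f t l K : (forall u, Cmod (f u - f t - RtoC (u - t) * l) <= K * (u - t) ^ 2) -> dC f t l.
Proof.
  intros H.
  assert (HK : 0 < Rabs K + 1) by (assert (A := Rabs_pos K); lra).
  assert (Q : forall u e, 0 < e -> Rabs (u - t) < e / (Rabs K + 1) -> Cmod (f u - f t - RtoC (u - t) * l) <= e * Rabs (u - t)).
  { intros u e He Hu. eapply Rle_trans; [apply H|].
    assert (A := Rabs_pos (u - t)). rewrite <- (pow2_abs (u - t)). assert (B := Rle_abs K).
    apply Rmult_lt_compat_r with (r := Rabs K + 1) in Hu; auto. unfold Rdiv in Hu. rewrite Rmult_assoc, Rinv_l in Hu by lra. nra. }
  split; apply is_derive_R_eps; intros e He; exists (e / (Rabs K + 1)); (split; [apply Rdiv_lt_0_compat; auto|]);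
    intros u Hu; specialize (Q u e He Hu).
  - replace (Re (f u) - Re (f t) - (u - t) * Re l) with (Re (f u - f t - RtoC (u - t) * l)%C) by (autorewrite with reim; ring).
    eapply Rle_trans; [apply re_le_Cmod|exact Q].
  - replace (Im (f u) - Im (f t) - (u - t) * Im l) with (Im (f u - f t - RtoC (u - t) * l)%C) by (autorewrite with reim; ring).
    eapply Rle_trans; [apply im_le_Cmod|exact Q].
Qed.

Lemma dC_continuous f t l : dC f t l -> continuous f t.
Proof.
  intros [H1 H2]. apply continuous_C_of_R.
  - apply (ex_derive_continuous (V := R_NormedModule) (fun u => Re (f u))). now exists (Re l).
  - apply (ex_derive_continuous (V := R_NormedModule) (fun u => Im (f u))). now exists (Im l).
Qed.

Lemma dC_mult f g t df dg : dC f t df -> dC g t dg ->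
  dC (fun u => f u * g u)%C t (df * g t + f t * dg)%C.
Proof.
  intros [F1 F2] [G1 G2]. split; autorewrite with reim.
  - apply (is_derive_ext (fun u => Re (f u) * Re (g u) - Im (f u) * Im (g u))); [intros; now autorewrite with reim|].
    evar_last.
    + apply (is_derive_minus (fun u => Re (f u) * Re (g u)) (fun u => Im (f u) * Im (g u)));
        (apply (is_derive_mult (K := R_AbsRing)); [eassumption|eassumption|intros; apply Rmult_comm]).
    + unfold minus, plus, opp, mult; simpl. ring.
  - apply (is_derive_ext (fun u => Re (f u) * Im (g u) + Im (f u) * Re (g u))); [intros; now autorewrite with reim|].
    evar_last.
    + apply (is_derive_plus (fun u => Re (f u) * Im (g u)) (fun u => Im (f u) * Re (g u)));
        (apply (is_derive_mult (K := R_AbsRing)); [eassumption|eassumption|intros; apply Rmult_comm]).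
    + unfold plus, mult; simpl. ring.
Qed.

Lemma ReIm_sq_pos (z : C) : z <> 0%C -> 0 < Re z * Re z + Im z * Im z.
Proof.
  intros H. apply Cmod_gt_0 in H. assert (E := Cmod2_alt z). assert (0 < Cmod z ^ 2) by (apply pow_lt; auto). nra.
Qed.

Lemma Re_inv (z : C) : z <> 0%C -> Re (/ z)%C = Re z / (Re z * Re z + Im z * Im z).
Proof. intros _. unfold Cinv, Re, Im. simpl. f_equal. ring. Qed.

Lemma Im_inv (z : C) : z <> 0%C -> Im (/ z)%C = - Im z / (Re z * Re z + Im z * Im z).
Proof. intros _. unfold Cinv, Re, Im. simpl. f_equal. ring. Qed.

Lemma dC_inv (f : R -> C) t df : (forall u, f u <> 0%C) -> dC f t df ->
  dC (fun u => / f u)%C t (- (df * (/ f t * / f t)))%C.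
Proof.
  intros Hf [F1 F2].
  assert (P := ReIm_sq_pos _ (Hf t)).
  assert (E1 : is_derive (fun u => Re (f u) * Re (f u) + Im (f u) * Im (f u)) t (2 * Re df * Re (f t) + 2 * Im df * Im (f t))).
  { evar_last.
    - apply (is_derive_plus (fun u => Re (f u) * Re (f u)) (fun u => Im (f u) * Im (f u)));
        (apply (is_derive_mult (K := R_AbsRing)); [eassumption|eassumption|intros; apply Rmult_comm]).
    - unfold plus, mult; simpl. ring. }
  split.
  - apply (is_derive_ext (fun u => Re (f u) / (Re (f u) * Re (f u) + Im (f u) * Im (f u)))); [intros; now rewrite Re_inv|].
    evar_last.
    + apply is_derive_div; [exact F1|exact E1|lra].
    + autorewrite with reim. rewrite Re_inv, Im_inv by auto. field. nra.
  - apply (is_derive_ext (fun u => - Im (f u) / (Re (f u) * Re (f u) + Im (f u) * Im (f u)))); [intros; now rewrite Im_inv|].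
    evar_last.
    + apply is_derive_div; [apply (is_derive_opp (fun u => Im (f u))); exact F2|exact E1|lra].
    + change (opp (Im df)) with (- Im df). autorewrite with reim. rewrite Re_inv, Im_inv by auto. field. nra.
Qed.

(* [F' / F] is the derivative of the principal logarithm of [F]. *)
Lemma is_RInt_log_derivative (F dF : R -> C) :
  (forall t, dC F t (dF t)) -> ccont dF -> (forall t, 0 < Re (F t)) -> F (2 * PI) = F 0 ->
  ccont (fun t => dF t * / F t)%C /\ CInt (fun t => dF t * / F t)%C = 0%C.
Proof.
  intros HF Hc Hpos Hper.
  assert (NZ : forall t, F t <> 0%C).
  { intros t E. assert (A := Hpos t). rewrite E in A. simpl in A. lra. }
  assert (CF : ccont F).
  { intros t. exact (dC_continuous _ _ _ (HF t)). }
  assert (Hcont : ccont (fun t => dF t * / F t)%C).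
  { intros t. apply continuous_C_mult; [apply Hc|].
    exact (dC_continuous _ _ _ (dC_inv F t (dF t) NZ (HF t))). }
  split; auto.
  assert (L1 : forall t, is_derive (fun u => / 2 * ln (Re (F u) * Re (F u) + Im (F u) * Im (F u))) t (Re (dF t * / F t)%C)).
  { intros t. destruct (HF t) as [F1 F2]. assert (P := ReIm_sq_pos _ (NZ t)).
    evar_last.
    - apply is_derive_scal. apply (is_derive_comp ln); [apply is_derive_ln; exact P|].
      apply (is_derive_plus (fun u => Re (F u) * Re (F u)) (fun u => Im (F u) * Im (F u)));
        (apply (is_derive_mult (K := R_AbsRing)); [eassumption|eassumption|intros; apply Rmult_comm]).
    - rewrite Re_mult, Re_inv, Im_inv by auto. unfold scal, plus, mult; simpl. unfold mult; simpl. field. lra. }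
  (* In the half plane of positive real part this arctangent is the argument. *)
  assert (L2 : forall t, is_derive (fun u => atan (Im (F u) / Re (F u))) t (Im (dF t * / F t)%C)).
  { intros t. destruct (HF t) as [F1 F2]. assert (P := ReIm_sq_pos _ (NZ t)). assert (Q := Hpos t).
    evar_last.
    - apply (is_derive_comp atan); [apply is_derive_atan|]. apply is_derive_div; [exact F2|exact F1|lra].
    - rewrite Im_mult, Re_inv, Im_inv by auto.
      unfold scal; simpl. unfold mult; simpl. unfold Rsqr. field. repeat split; nra. }
  apply Cext; unfold CInt, Re at 1, Im at 1; simpl; apply is_RInt_unique.
  - evar_last.
    + apply (is_RInt_derive (V := R_CompleteNormedModule) (fun u => / 2 * ln (Re (F u) * Re (F u) + Im (F u) * Im (F u)))).
      * intros; apply L1.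
      * intros t _. apply (continuous_Re (fun t => dF t * / F t)%C), Hcont.
    + simpl. rewrite Hper. unfold minus, plus, opp; simpl. ring.
  - evar_last.
    + apply (is_RInt_derive (V := R_CompleteNormedModule) (fun u => atan (Im (F u) / Re (F u)))).
      * intros; apply L2.
      * intros t _. apply (continuous_Im (fun t => dF t * / F t)%C), Hcont.
    + simpl. rewrite Hper. unfold minus, plus, opp; simpl. ring.
Qed.

Lemma RtoC_m1 : RtoC (-1) = (- (1))%C.
Proof. apply Cext; simpl; lra. Qed.

(** The mean value theorem for [cos u] and [sin u - u] produces the factors [sin c] and [cos c - 1],
    each bounded by [|c| <= |t|]. *)
Lemma cis_taylor_0 t : Cmod (cis t - 1 - RtoC t * Ci) <= 2 * t ^ 2.
Proof.
  assert (B : forall c, Rmin 0 t <= c <= Rmax 0 t -> Rabs c <= Rabs t).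
  { intros c. unfold Rmin, Rmax. destruct (Rle_dec 0 t); intros Hc.
    - rewrite !Rabs_pos_eq; lra.
    - rewrite !Rabs_left1; lra. }
  assert (K : forall c, Rabs (cos c - 1) <= Rabs c /\ Rabs (sin c) <= Rabs c).
  { intros c. assert (H := Cmod_one_minus_cis c). split.
    - eapply Rle_trans; [apply (re_le_Cmod (cis c - 1))|exact H].
    - replace (sin c) with (Im (cis c - 1)%C) by (autorewrite with reim; ring).
      eapply Rle_trans; [apply im_le_Cmod|exact H]. }
  destruct (MVT_gen cos 0 t (fun c => - sin c)) as [c1 [Hc1 E1]].
  { intros; apply is_derive_cos. }
  { intros; apply continuity_cos. }
  destruct (MVT_gen (fun u => sin u - u) 0 t (fun c => cos c - 1)) as [c2 [Hc2 E2]].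
  { intros. apply (is_derive_minus sin (fun u => u)); [apply is_derive_sin|apply (is_derive_id (K := R_AbsRing))]. }
  { intros. apply continuity_pt_minus; [apply continuity_sin|apply derivable_continuous_pt, derivable_pt_id]. }
  rewrite cos_0 in E1. rewrite sin_0 in E2.
  eapply Rle_trans; [apply Cmod_le_ReIm|]. autorewrite with reim.
  replace (cos t - 1 - (t * 0 - 0 * 1)) with (- sin c1 * (t - 0)) by (rewrite <- E1; ring).
  replace (sin t - 0 - (t * 1 + 0 * 0)) with ((cos c2 - 1) * (t - 0)) by (rewrite <- E2; ring).
  rewrite !Rabs_mult, Rabs_Ropp, Rminus_0_r.
  destruct (K c1) as [_ K1]. destruct (K c2) as [K2 _].
  assert (B1 := B c1 Hc1). assert (B2 := B c2 Hc2). rewrite <- (pow2_abs t).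
  assert (P := Rabs_pos t). nra.
Qed.

Lemma cis_taylor a t u : (a = 1 \/ a = - 1) ->
  Cmod (cis (a * u) - cis (a * t) - RtoC (u - t) * (a * Ci * cis (a * t))) <= 2 * (u - t) ^ 2.
Proof.
  intros Ha.
  replace (cis (a * u) - cis (a * t) - RtoC (u - t) * (a * Ci * cis (a * t)))%C
    with (cis (a * t) * (cis (a * (u - t)) - 1 - RtoC (a * (u - t)) * Ci))%C.
  - rewrite Cmod_mult, Cmod_cis, Rmult_1_l. eapply Rle_trans; [apply cis_taylor_0|].
    rewrite Rpow_mult_distr. destruct Ha as [->| ->]; right; ring.
  - transitivity (cis (a * t) * cis (a * (u - t)) - cis (a * t) - RtoC (a * (u - t)) * Ci * cis (a * t))%C; [ring|].
    rewrite <- cis_plus, RtoC_mult. replace (a * t + a * (u - t)) with (a * u) by ring. ring.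
Qed.

Lemma dC_cis_affine a t : (a = 1 \/ a = - 1) -> dC (fun u => cis (a * u)) t (a * Ci * cis (a * t))%C.
Proof. intros Ha. apply (dC_quadratic _ _ _ 2). intros u. now apply cis_taylor. Qed.

(** * The boundary curve of the patch and its orientation *)

Section Curve.
Context (a : nat -> R) (k : nat -> nat) (A : R).
Context (hA : sumle (fun i => (1 + INR (k i)) ^ 2 * Rabs (a i)) A).
Context (b : R) (hb : 0 < b) (hAb : A <= b / 2) (hbA : b + A < 1).
Local Notation psum := (psum a k).
Local Notation dpsum := (dpsum a k).
Local Notation homeo_inv := (homeo_inv a k A hA b hb hAb hbA).
Local Notation patch := (patch a k b).

(** The trace of [f] on the circle as a function of the angle, since [1 / w = e^{-it}] there. *)
Definition pcirc (t : R) : C := psum (cis (- t)).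
Definition dpcirc (t : R) : C := (- Ci * (cis (- t) * dpsum (cis (- t))))%C.

Definition curve (t : R) : C := (b * cis t + pcirc t)%C.
Definition dcurve (t : R) : C := (Ci * (b * cis t - cis (- t) * dpsum (cis (- t))))%C.

Lemma Cmod_cis_le t : Cmod (cis t) <= 1.
Proof. rewrite Cmod_cis. lra. Qed.

Lemma curve_homeo t : curve t = homeo a k b (cis t).
Proof. rewrite homeo_circle by apply Cmod_cis. unfold curve, pcirc. now rewrite cis_opp. Qed.

Lemma Cmod_cis_opp_minus u t : Cmod (cis (- u) - cis (- t)) <= Rabs (u - t).
Proof.
  eapply Rle_trans; [apply Cmod_cis_minus|]. rewrite <- Rabs_Ropp. right. f_equal. ring.
Qed.

Lemma dC_pcirc t : dC pcirc t (dpcirc t).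
Proof.
  apply (dC_quadratic _ _ _ (A + A * 2)). intros u. unfold pcirc, dpcirc.
  set (z := cis (- t)). set (y := cis (- u)).
  replace (psum y - psum z - RtoC (u - t) * (- Ci * (z * dpsum z)))%C
    with ((psum y - psum z - dpsum z * (y - z)) + dpsum z * (y - z - RtoC (u - t) * (- Ci * z)))%C by ring.
  eapply Rle_trans; [apply Cmod_triangle|]. rewrite Cmod_mult.
  assert (T := psum_taylor a k A hA y z (Cmod_cis_le _) (Cmod_cis_le _)).
  assert (D := dpsum_Cmod a k A hA z (Cmod_cis_le _)).
  assert (E := Cmod_cis_opp_minus u t). fold z y in E.
  assert (F := cis_taylor (- 1) t u (or_intror eq_refl)).
  replace (- 1 * u) with (- u) in F by ring. replace (- 1 * t) with (- t) in F by ring. fold z y in F.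
  rewrite RtoC_m1 in F. replace (- (1) * Ci * z)%C with (- Ci * z)%C in F by ring.
  assert (PA := A_ge_0 a k A hA). assert (P1 := Cmod_ge_0 (y - z)).
  assert (P2 := Cmod_ge_0 (y - z - RtoC (u - t) * (- Ci * z))). assert (P3 := Cmod_ge_0 (dpsum z)).
  rewrite <- (pow2_abs (u - t)) in *.
  assert (Cmod (y - z) ^ 2 <= Rabs (u - t) ^ 2) by (apply pow_incr; lra).
  assert (A * Cmod (y - z) ^ 2 <= A * Rabs (u - t) ^ 2) by (apply Rmult_le_compat_l; auto).
  assert (Cmod (dpsum z) * Cmod (y - z - RtoC (u - t) * (- Ci * z)) <= A * (2 * Rabs (u - t) ^ 2)) by (apply Rmult_le_compat; auto).
  lra.
Qed.

Lemma dC_curve t : dC curve t (dcurve t).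
Proof.
  destruct (dC_pcirc t) as [P1 P2].
  destruct (dC_cis_affine 1 t (or_introl eq_refl)) as [Q1 Q2].
  assert (E : forall u, cis (1 * u) = cis u) by (intros; f_equal; ring). rewrite E in Q1, Q2.
  split.
  - apply (is_derive_ext (fun u => b * Re (cis (1 * u)) + Re (pcirc u))).
    + intros u. unfold curve. rewrite E. autorewrite with reim. eqR. ring.
    + evar_last; [apply (is_derive_plus (fun u => b * Re (cis (1 * u))) (fun u => Re (pcirc u))); [apply is_derive_scal; exact Q1|exact P1]|].
      change (b * Re (1 * Ci * cis t)%C + Re (dpcirc t) = Re (dcurve t)).
      unfold dcurve, dpcirc. autorewrite with reim. ring.
  - apply (is_derive_ext (fun u => b * Im (cis (1 * u)) + Im (pcirc u))).
    + intros u. unfold curve. rewrite E. autorewrite with reim. eqR. ring.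
    + evar_last; [apply (is_derive_plus (fun u => b * Im (cis (1 * u))) (fun u => Im (pcirc u))); [apply is_derive_scal; exact Q2|exact P2]|].
      change (b * Im (1 * Ci * cis t)%C + Im (dpcirc t) = Im (dcurve t)).
      unfold dcurve, dpcirc. autorewrite with reim. ring.
Qed.

Lemma dpcirc_lipschitz u t : Cmod (dpcirc u - dpcirc t) <= 2 * A * Rabs (u - t).
Proof.
  unfold dpcirc. set (z := cis (- t)). set (y := cis (- u)).
  replace (- Ci * (y * dpsum y) - - Ci * (z * dpsum z))%C with (- Ci * (y * (dpsum y - dpsum z) + (y - z) * dpsum z))%C by ring.
  rewrite Cmod_mult, Cmod_opp, Cmod_Ci, Rmult_1_l.
  eapply Rle_trans; [apply Cmod_triangle|]. rewrite !Cmod_mult. unfold y at 1. rewrite Cmod_cis, Rmult_1_l.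
  assert (T := dpsum_lipschitz a k A hA y z (Cmod_cis_le _) (Cmod_cis_le _)).
  assert (D := dpsum_Cmod a k A hA z (Cmod_cis_le _)).
  assert (E := Cmod_cis_opp_minus u t). fold z y in E.
  assert (PA := A_ge_0 a k A hA). assert (P1 := Cmod_ge_0 (y - z)). assert (P3 := Cmod_ge_0 (dpsum z)).
  nra.
Qed.

Lemma continuous_lipschitz (f : R -> C) K : (forall u t, Cmod (f u - f t) <= K * Rabs (u - t)) -> ccont f.
Proof.
  intros H t. apply continuous_C_eps. intros e He.
  assert (HK : 0 < Rabs K + 1) by (assert (B := Rabs_pos K); lra).
  exists (e / (Rabs K + 1)). split; [apply Rdiv_lt_0_compat; auto|]. intros u Hu.
  eapply Rle_lt_trans; [apply H|]. assert (B := Rle_abs K). assert (P := Rabs_pos (u - t)).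
  apply (Rmult_lt_compat_r (Rabs K + 1)) in Hu; auto.
  unfold Rdiv in Hu. rewrite Rmult_assoc, Rinv_l, Rmult_1_r in Hu by lra. nra.
Qed.

Lemma dcurve_eq t : dcurve t = (Ci * b * cis t + dpcirc t)%C.
Proof. unfold dcurve, dpcirc. ring. Qed.

Lemma ccont_dcurve : ccont dcurve.
Proof.
  intros t. apply (continuous_ext (fun t => Ci * b * cis t + dpcirc t)%C); [intros; symmetry; apply dcurve_eq|].
  apply continuous_C_plus.
  - apply (ccont_scal (Ci * b)%C cis). intros u. apply continuous_cis.
  - apply (continuous_lipschitz dpcirc (2 * A)). intros; apply dpcirc_lipschitz.
Qed.

Lemma dcurve_neq_0 t : dcurve t <> 0%C.
Proof.
  apply Cmod_gt_0. unfold dcurve. rewrite Cmod_mult, Cmod_Ci, Rmult_1_l.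
  assert (D := Cmod_minus_rev (b * cis t) (cis (- t) * dpsum (cis (- t)))).
  rewrite Cmod_RC, Cmod_mult, !Cmod_cis, Rabs_pos_eq in D by lra.
  assert (E := dpsum_Cmod a k A hA (cis (- t)) (Cmod_cis_le _)). lra.
Qed.

Lemma curve_period t : curve (t + 2 * PI) = curve t.
Proof. rewrite !curve_homeo. now rewrite cis_period. Qed.

Lemma patch_Jordan : C1_Jordan_param curve dcurve (boundary patch).
Proof.
  split; [|split; [|split; [|split; [|split; [|intros z; split]]]]].
  - intros t. apply dC_is_derive, dC_curve.
  - apply ccont_dcurve.
  - apply dcurve_neq_0.
  - apply curve_period.
  - intros t u Ht Hu. rewrite !curve_homeo. intros E. apply (homeo_inj a k A hA b hb hAb) in E. now apply cis_inj.
  - intros H. apply (patch_boundary_param a k A hA b hb hAb hbA) in H. destruct H as [w [Hw ->]].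
    destruct (unit_circle_cis w Hw) as [t ->]. exists t. unfold curve, pcirc. now rewrite cis_opp.
  - intros [t ->]. apply (patch_boundary_param a k A hA b hb hAb hbA). exists (cis t). split; [apply Cmod_cis|].
    unfold curve, pcirc. now rewrite cis_opp.
Qed.

Lemma contour_int_CInt (F : C -> C) : ccont (fun t => F (curve t) * dcurve t)%C ->
  contour_int curve dcurve F = CInt (fun t => F (curve t) * dcurve t)%C.
Proof. intros H. exact (is_RInt_unique (V := C_R_CompleteNormedModule) _ _ _ _ (is_RInt_CInt _ H)). Qed.

Lemma Re_pos_near_1 (z : C) : Cmod (z - 1) < 1 -> 0 < Re z.
Proof.
  intros H. assert (B := re_le_Cmod (z - 1)). rewrite Re_minus, Re_RtoC in B.
  assert (D := Rle_abs (- (Re z - 1))). rewrite Rabs_Ropp in D. lra.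
Qed.

(* Factor [curve - z = b e^{it} (1 - w0 e^{-it}) q] with [|q - 1| <= 1/2]: only [e^{it}] winds. *)
Lemma patch_oriented : positively_oriented curve dcurve patch.
Proof.
  intros z Hz. set (w0 := homeo_inv z). assert (Hw0 : Cmod w0 < 1) by now apply patch_iff.
  assert (Ez : z = homeo a k b w0) by (unfold w0; now rewrite homeo_homeo_inv).
  assert (Nb : RtoC b <> 0%C) by (intros E; apply RtoC_inj in E; lra).
  set (P := fun t => (1 - w0 * cis (- t))%C). set (dP := fun t => (Ci * w0 * cis (- t))%C).
  assert (HP1 : forall t, Cmod (P t - 1) < 1).
  { intros t. unfold P. replace (1 - w0 * cis (- t) - 1)%C with (- (w0 * cis (- t)))%C by ring.
    rewrite Cmod_opp, Cmod_mult, Cmod_cis. lra. }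
  assert (NP : forall t, P t <> 0%C).
  { intros t E. assert (H := Re_pos_near_1 _ (HP1 t)). rewrite E in H. simpl in H. lra. }
  assert (DP : forall t, dC P t (dP t)).
  { intros t. apply (dC_quadratic _ _ _ 2). intros u. unfold P, dP.
    replace (1 - w0 * cis (- u) - (1 - w0 * cis (- t)) - RtoC (u - t) * (Ci * w0 * cis (- t)))%C
      with (- (w0 * (cis (-1 * u) - cis (-1 * t) - RtoC (u - t) * (RtoC (-1) * Ci * cis (-1 * t)))))%C.
    - rewrite Cmod_opp, Cmod_mult. assert (F := cis_taylor (-1) t u (or_intror eq_refl)).
      assert (G := Cmod_ge_0 w0).
      assert (H := Cmod_ge_0 (cis (-1 * u) - cis (-1 * t) - RtoC (u - t) * (RtoC (-1) * Ci * cis (-1 * t)))). nra.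
    - replace (-1 * u) with (- u) by ring. replace (-1 * t) with (- t) by ring.
      rewrite RtoC_m1. ring. }
  assert (CdP : ccont dP).
  { apply (continuous_lipschitz dP 1). intros u t. unfold dP.
    replace (Ci * w0 * cis (- u) - Ci * w0 * cis (- t))%C with (Ci * w0 * (cis (- u) - cis (- t)))%C by ring.
    rewrite !Cmod_mult, Cmod_Ci. assert (E := Cmod_cis_opp_minus u t).
    assert (G := Cmod_ge_0 w0). assert (H := Cmod_ge_0 (cis (- u) - cis (- t))). nra. }
  assert (EP : forall t, (cis t * P t = cis t - w0)%C).
  { intros t. unfold P. transitivity (cis t - w0 * (cis (- t) * cis t))%C; [ring|]. rewrite cis_opp_mult. ring. }
  assert (Np : forall t, (cis t - w0)%C <> 0%C).
  { intros t. rewrite <- EP. intros E. apply (NP t).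
    transitivity (cis (- t) * cis t * P t)%C; [rewrite cis_opp_mult; ring|].
    rewrite <- Cmult_assoc, E. ring. }
  set (V := fun t => (/ (b * (cis t - w0)))%C).
  assert (NV : forall t, (b * (cis t - w0))%C <> 0%C).
  { intros t E. apply (Np t). transitivity (/ b * (b * (cis t - w0)))%C; [field; auto|]. rewrite E. ring. }
  assert (DB : forall t, dC (fun u => b * (cis u - w0))%C t (b * (Ci * cis t))%C).
  { intros t. apply (dC_quadratic _ _ _ (b * 2)). intros u.
    replace (b * (cis u - w0) - b * (cis t - w0) - RtoC (u - t) * (b * (Ci * cis t)))%C
      with (b * (cis (1 * u) - cis (1 * t) - RtoC (u - t) * (1 * Ci * cis (1 * t))))%C by (rewrite !Rmult_1_l; ring).
    rewrite Cmod_RC, Rabs_pos_eq, Rmult_assoc by lra. apply Rmult_le_compat_l; [lra|].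
    now apply cis_taylor; left. }
  assert (DV := fun t => dC_inv _ t _ NV (DB t)).
  assert (Dc : forall t, dC (fun u => curve u - z)%C t (dcurve t)).
  { intros t. destruct (dC_curve t) as [D1 D2]. split.
    - evar_last; [apply (is_derive_minus (fun u => Re (curve u)) (fun _ => Re z)); [exact D1|apply is_derive_const]|]. unfold minus, plus, opp, zero; simpl. ring.
    - evar_last; [apply (is_derive_minus (fun u => Im (curve u)) (fun _ => Im z)); [exact D2|apply is_derive_const]|]. unfold minus, plus, opp, zero; simpl. ring. }
  set (Q := fun t => ((curve t - z) * V t)%C).
  set (dQ := fun t => (dcurve t * V t + (curve t - z) * - (b * (Ci * cis t) * (V t * V t)))%C).
  assert (DQ : forall t, dC Q t (dQ t)) by (intros t; exact (dC_mult _ _ t _ _ (Dc t) (DV t))).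
  assert (CV : ccont V).
  { intros t. exact (dC_continuous _ _ _ (DV t)). }
  assert (Cc : ccont (fun t => curve t - z)%C).
  { intros t. exact (dC_continuous _ _ _ (Dc t)). }
  assert (CdQ : ccont dQ).
  { intros t. unfold dQ. apply continuous_C_plus; apply continuous_C_mult; auto; [apply ccont_dcurve|].
    apply (continuous_opp (V := C_R_NormedModule) (fun t => b * (Ci * cis t) * (V t * V t))%C).
    apply continuous_C_mult; [|apply continuous_C_mult; auto].
    apply (ccont_scal b (fun t => Ci * cis t)%C). apply (ccont_scal Ci cis). intros u; apply continuous_cis. }
  assert (HQ1 : forall t, Cmod (Q t - 1) < 1).
  { intros t. unfold Q, V.
    (* Since [z = homeo w0], the linear parts cancel and what remains is controlled by the Lipschitz
       constant [b / 2] of the perturbation. *)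
    replace ((curve t - z) * / (b * (cis t - w0)) - 1)%C
      with ((psum (refl (cis t)) - psum (refl w0)) * / (b * (cis t - w0)))%C.
    - rewrite Cmod_mult, Cmod_inv by apply NV.
      assert (L := psum_refl_lipschitz a k A hA b hb hAb (cis t) w0).
      rewrite Cmod_RC, (Rabs_pos_eq b) by lra.
      assert (G : 0 < Cmod (cis t - w0)) by (apply Cmod_gt_0, Np).
      apply Rle_lt_trans with (b / 2 * Cmod (cis t - w0) * / (b * Cmod (cis t - w0))).
      + apply Rmult_le_compat_r; [left; apply Rinv_0_lt_compat, Rmult_lt_0_compat; lra|exact L].
      + replace (b / 2 * Cmod (cis t - w0) * / (b * Cmod (cis t - w0))) with (/ 2) by (field; lra). lra.
    - rewrite curve_homeo, Ez. unfold homeo. field. split; [apply Np|auto]. }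
  assert (NQ : forall t, Q t <> 0%C).
  { intros t E. assert (H := Re_pos_near_1 _ (HQ1 t)). rewrite E in H. simpl in H. lra. }
  assert (per : cis (2 * PI) = cis 0) by (rewrite <- (Rplus_0_l (2 * PI)); apply cis_period).
  destruct (is_RInt_log_derivative P dP DP CdP (fun t => Re_pos_near_1 _ (HP1 t))) as [CP IP].
  { unfold P. rewrite !cis_opp, per. reflexivity. }
  destruct (is_RInt_log_derivative Q dQ DQ CdQ (fun t => Re_pos_near_1 _ (HQ1 t))) as [CQ IQ].
  { unfold Q, V. rewrite !curve_homeo, per. reflexivity. }
  assert (Ncz : forall t, (curve t - z)%C <> 0%C).
  { intros t E. apply (NQ t). unfold Q. rewrite E. ring. }
  (* The logarithmic derivative of the product [b e^{it} P Q]: the last two summands integrate to 0,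
     and [Ci] alone yields the index 1. *)
  assert (E : forall t, (/ (curve t - z) * dcurve t = (Ci + dP t * / P t) + dQ t * / Q t)%C).
  { intros t. unfold dQ, Q, V.
    assert (EPt : P t = (cis (- t) * (cis t - w0))%C).
    { rewrite <- EP. transitivity (cis (- t) * cis t * P t)%C; [rewrite cis_opp_mult; ring|ring]. }
    rewrite EPt. unfold dP.
    assert (Nc := cis_neq_0 (- t)). assert (Ncz' := Ncz t). assert (Npt := Np t).
    transitivity (Ci + Ci * w0 * / (cis t - w0) + (dcurve t * / (curve t - z) - Ci * cis t * / (cis t - w0)))%C.
    - field. split; auto.
    - field. repeat split; auto. }
  assert (Ccont : ccont (fun t => (Ci + dP t * / P t) + dQ t * / Q t)%C).
  { intros t. apply continuous_C_plus; auto. apply continuous_C_plus; auto. apply continuous_const. }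
  rewrite contour_int_CInt.
  2: { intros t. eapply continuous_ext; [intros u; symmetry; apply E|apply Ccont]. }
  rewrite (CInt_ext _ _ (fun t _ => E t)).
  rewrite (CInt_plus (fun t => Ci + dP t * / P t)%C (fun t => dQ t * / Q t)%C).
  - rewrite (CInt_plus (fun _ => Ci) (fun t => dP t * / P t)%C).
    + rewrite IP, IQ, CInt_const.
      assert (NPI : RtoC PI <> 0%C) by (intros F; apply RtoC_inj in F; assert (G := PI_RGT_0); lra).
      assert (NCi : Ci <> 0%C) by (intros F; apply (f_equal Im) in F; simpl in F; lra).
      field. split; auto.
    + apply ccont_const.
    + auto.
  - intros t. apply continuous_C_plus; [apply continuous_const|auto].
  - auto.
Qed.

End Curve.

(** At [t = s] the Cauchy quotient is [0 / 0] and need not agree with its continuous extension [G].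
    Splitting at [s] turns the exceptional value into an endpoint. *)
Lemma is_RInt_except (f G : R -> C) s : 0 <= s <= 2 * PI -> ccont G ->
  (forall t, 0 < t < 2 * PI -> t <> s -> f t = G t) ->
  is_RInt (V := C_R_NormedModule) f 0 (2 * PI) (CInt G).
Proof.
  intros Hs HG H.
  assert (Ex : forall a b, ex_RInt (V := C_R_NormedModule) G a b).
  { intros a b. apply (ex_RInt_continuous (V := C_R_CompleteNormedModule)). intros; apply HG. }
  destruct (Ex 0 s) as [l1 H1]. destruct (Ex s (2 * PI)) as [l2 H2].
  assert (E : CInt G = plus l1 l2).
  { assert (A := is_RInt_Chasles _ _ _ _ _ _ H1 H2).
    apply (is_RInt_unique (V := C_R_CompleteNormedModule)) in A.
    rewrite <- A. symmetry. exact (is_RInt_unique (V := C_R_CompleteNormedModule) _ _ _ _ (is_RInt_CInt _ HG)). }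
  rewrite E. apply (is_RInt_Chasles _ _ s).
  - eapply is_RInt_ext; [|exact H1]. intros t. rewrite Rmin_left, Rmax_right by lra.
    intros Ht. symmetry. apply H; lra.
  - eapply is_RInt_ext; [|exact H2]. intros t. rewrite Rmin_left, Rmax_right by lra.
    intros Ht. symmetry. apply H; lra.
Qed.

Lemma Lub_Rbar_bounded (E : R -> Prop) M x0 : E x0 -> (forall x, E x -> x <= M) ->
  exists l : R, Lub_Rbar E = Finite l /\ l <= M.
Proof.
  intros Hx HM. destruct (Lub_Rbar_correct E) as [H1 H2].
  assert (H3 := H1 _ Hx). assert (H4 := H2 (Finite M) (fun x Ex => HM x Ex)).
  destruct (Lub_Rbar E) as [l| |]; simpl in *; try contradiction. now exists l.
Qed.

(** * The Hoelder norm of the perturbation *)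

Section Norm.
Context (a : nat -> R) (k : nat -> nat) (A : R).
Context (hA : sumle (fun i => (1 + INR (k i)) ^ 2 * Rabs (a i)) A).

Lemma circle_deriv_psum (g : C -> C) t : (forall u, g (cis u) = pcirc a k u) ->
  circle_deriv g t = dpcirc a k t.
Proof.
  intros Hg. destruct (dC_pcirc a k A hA t) as [D1 D2]. apply Cext; unfold circle_deriv; simpl.
  - rewrite (Derive_ext _ (fun u => Re (pcirc a k u))) by (intros; now rewrite Hg). now apply is_derive_unique.
  - rewrite (Derive_ext _ (fun u => Im (pcirc a k u))) by (intros; now rewrite Hg). now apply is_derive_unique.
Qed.

(** The Hoelder quotient is taken over chords, so the Lipschitz bound in the angle would not do. *)
Lemma dpcirc_lipschitz_circle u t : Cmod (dpcirc a k u - dpcirc a k t) <= 2 * A * Cmod (cis u - cis t).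
Proof.
  unfold dpcirc. set (z := cis (- t)). set (y := cis (- u)).
  replace (- Ci * (y * dpsum a k y) - - Ci * (z * dpsum a k z))%C
    with (- Ci * (y * (dpsum a k y - dpsum a k z) + (y - z) * dpsum a k z))%C by ring.
  rewrite Cmod_mult, Cmod_opp, Cmod_Ci, Rmult_1_l.
  eapply Rle_trans; [apply Cmod_triangle|]. rewrite !Cmod_mult. unfold y at 1. rewrite Cmod_cis, Rmult_1_l.
  assert (T := dpsum_lipschitz a k A hA y z (Cmod_cis_le _) (Cmod_cis_le _)).
  assert (D := dpsum_Cmod a k A hA z (Cmod_cis_le _)).
  assert (E : Cmod (y - z) = Cmod (cis u - cis t)).
  { unfold y, z. rewrite !cis_opp, <- Cminus_conj, Cmod_conj. reflexivity. }
  rewrite E in *. assert (P1 := Cmod_ge_0 (cis u - cis t)). nra.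
Qed.

(** The quotient is [c^(1 - alpha)], at most 1 for [c < 1] and at most [c] otherwise; 2 is the
    largest chord of the circle. *)
Lemma Rpower_ratio c alpha : 0 < alpha < 1 -> 0 < c <= 2 -> c / Rpower c alpha <= 2.
Proof.
  intros Ha Hc. assert (P : 0 < Rpower c alpha) by apply exp_pos.
  apply (Rmult_le_reg_r (Rpower c alpha)); auto. unfold Rdiv. rewrite Rmult_assoc, Rinv_l, Rmult_1_r by lra.
  destruct (Rle_lt_dec 1 c) as [H1|H1].
  - assert (1 <= Rpower c alpha); [|lra].
    rewrite <- (Rpower_O c) by lra. apply Rle_Rpower; lra.
  - assert (c <= Rpower c alpha); [|lra].
    unfold Rpower. rewrite <- (exp_ln c) at 1 by lra.
    assert (L : ln c <= 0) by (rewrite <- ln_1; left; apply ln_increasing; lra).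
    destruct (Req_dec (ln c) (alpha * ln c)) as [E|]; [rewrite <- E; lra|]. left. apply exp_increasing. nra.
Qed.

(** The three suprema are at most [A], [A] and [4 A]. A sample value of each is exhibited because
    the supremum of an empty set would not be finite. *)
Lemma C1alpha_norm_psum alpha (g : C -> C) : 0 < alpha < 1 -> (forall u, g (cis u) = pcirc a k u) ->
  exists l : R, C1alpha_norm alpha g = Finite l /\ l <= 6 * A.
Proof.
  intros Ha Hg. unfold C1alpha_norm.
  destruct (Lub_Rbar_bounded (fun x => exists t, x = Cmod (g (cis t))) A (Cmod (g (cis 0)))) as [l1 [E1 B1]].
  { now exists 0. }
  { intros x [t ->]. rewrite Hg. apply (psum_Cmod a k A hA), Cmod_cis_le. }
  destruct (Lub_Rbar_bounded (fun x => exists t, x = Cmod (circle_deriv g t)) A (Cmod (circle_deriv g 0))) as [l2 [E2 B2]].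
  { now exists 0. }
  { intros x [t ->]. rewrite circle_deriv_psum by auto. unfold dpcirc.
    rewrite !Cmod_mult, Cmod_opp, Cmod_Ci, Cmod_cis, !Rmult_1_l. apply (dpsum_Cmod a k A hA), Cmod_cis_le. }
  destruct (Lub_Rbar_bounded (fun x => exists t u, cis t <> cis u /\
       x = Cmod (circle_deriv g t - circle_deriv g u) / Rpower (Cmod (cis t - cis u)) alpha) (4 * A)
       (Cmod (circle_deriv g 0 - circle_deriv g PI) / Rpower (Cmod (cis 0 - cis PI)) alpha)) as [l3 [E3 B3]].
  { exists 0, PI. split; auto. intros E. apply (f_equal Re) in E. rewrite !Re_cis, cos_0, cos_PI in E. lra. }
  { intros x [t [u [Hne ->]]]. rewrite !circle_deriv_psum by auto.
    assert (D := dpcirc_lipschitz_circle t u). set (c := Cmod (cis t - cis u)) in *.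
    assert (Hc0 : 0 < c) by (apply Cmod_gt_0; intros E; apply Hne; replace (cis t) with (cis t - cis u + cis u)%C by ring; rewrite E; ring).
    assert (Hc2 : c <= 2) by (unfold c; eapply Rle_trans; [apply Cmod_minus_triangle|]; rewrite !Cmod_cis; lra).
    assert (R2 := Rpower_ratio c alpha Ha (conj Hc0 Hc2)). assert (P : 0 < Rpower c alpha) by apply exp_pos.
    assert (PA := A_ge_0 a k A hA).
    apply Rle_trans with (2 * A * (c / Rpower c alpha)).
    - unfold Rdiv. rewrite <- Rmult_assoc. apply Rmult_le_compat_r; [left; now apply Rinv_0_lt_compat|exact D].
    - replace (4 * A) with (2 * A * 2) by ring. apply Rmult_le_compat_l; lra. }
  rewrite E1, E2, E3. exists (l1 + l2 + l3). split; [reflexivity|lra].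
Qed.

End Norm.

(** * From series coefficients to the boundary equation *)

Section Link.
Context (m : nat) (kap : posreal) (hm : (1 <= m)%nat).

Definition kexp (i : nat) : nat := (S i * m - 1)%nat.
Definition acoef (x : nat -> R) (i : nat) : R := / om m kap i * x i.

Lemma S_kexp i : S (kexp i) = freq m i.
Proof. unfold kexp. assert (A := freq_ge_1 m hm i). unfold freq in *. lia. Qed.

Lemma kz_kexp i : (kz m) i = Z.of_nat (kexp i).
Proof. unfold kz. rewrite <- S_kexp. lia. Qed.

(** Here [1 + kexp i] is [N = freq m i], and [N^2 / om = N / (1 + kap N) <= 1 / kap]. *)
Lemma acoef_sumle x del : l1 x del -> sumle (fun i => (1 + INR (kexp i)) ^ 2 * Rabs (acoef x i)) (/ kap * del).
Proof.
  intros Hx. assert (Hk := cond_pos kap).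
  eapply sumle_mono; [|apply (sumle_scal (/ kap)); [left; now apply Rinv_0_lt_compat|exact Hx]].
  intros i. simpl. unfold acoef. rewrite Rabs_mult, (Rabs_pos_eq (/ om m kap i)) by now apply om_inv_pos.
  replace (1 + INR (kexp i)) with (INR (freq m i)) by (rewrite <- S_kexp, S_INR; ring).
  rewrite Rmult_1_r, <- Rmult_assoc. apply Rmult_le_compat_r; [apply Rabs_pos|].
  unfold om, fwt. assert (B := freq_ge_1 m hm i). apply le_INR in B. simpl in B. set (N := INR (freq m i)) in *.
  assert (P : 0 < 1 + kap * N) by nra.
  apply (Rmult_le_reg_r (N * (1 + kap * N))); [nra|]. rewrite Rmult_assoc, Rinv_l by nra.
  apply (Rmult_le_reg_l kap); auto.
  transitivity (kap * (N * N)); [right; ring|].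
  replace (kap * (/ kap * (N * (1 + kap * N)))) with (N * (1 + kap * N)) by (field; lra). nra.
Qed.

Lemma mono_neg_l k s t : mono (- Z.of_nat k) 0 s t = (cis (- s) ^ k)%C.
Proof. unfold mono. rewrite cis_pow. f_equal. rewrite opp_IZR, <- INR_IZR_INZ. ring. Qed.

Lemma mono_neg_r k s t : mono 0 (- Z.of_nat k) s t = (cis (- t) ^ k)%C.
Proof. unfold mono. rewrite cis_pow. f_equal. rewrite opp_IZR, <- INR_IZR_INZ. ring. Qed.

Lemma lin_Bf x s t : lin (Bf m kap) x s t = psum (acoef x) kexp (cis (- s)).
Proof.
  unfold lin, psum. apply CSer_ext. intros i. unfold Bf, acoef.
  rewrite kz_kexp, mono_neg_l, RtoC_mult. ring.
Qed.

Lemma lin_Bft x s t : lin (Bft m kap) x s t = psum (acoef x) kexp (cis (- t)).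
Proof.
  unfold lin, psum. apply CSer_ext. intros i. unfold Bft, acoef.
  rewrite kz_kexp, mono_neg_r, RtoC_mult. ring.
Qed.

Lemma Cpow_pred_mult (z : C) k : (z * (INR k * z ^ (k - 1)) = INR k * z ^ k)%C.
Proof. destruct k; [simpl; ring|]. replace (S k - 1)%nat with k by lia. rewrite (Cpow_S z k). ring. Qed.

Lemma lin_BP x del s t : l1 x del -> lin (BP m kap) x s t = (cis (- s) * dpsum (acoef x) kexp (cis (- s)))%C.
Proof.
  intros Hx. unfold lin, dpsum.
  rewrite <- (CSer_scal _ _ _ (dpsum_Csumle _ _ _ (acoef_sumle x del Hx) _ (Cmod_cis_le (- s)))).
  apply CSer_ext. intros i. unfold BP, acoef, Rdiv.
  rewrite kz_kexp, mono_neg_l, !RtoC_mult, <- INR_IZR_INZ.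
  transitivity (/ om m kap i * x i * (INR (kexp i) * cis (- s) ^ kexp i))%C; [rewrite RtoC_inv by (apply Rgt_not_eq, om_pos, hm); ring|].
  rewrite <- Cpow_pred_mult, RtoC_inv by (apply Rgt_not_eq, om_pos, hm). ring.
Qed.

Lemma lin_BPt x del s t : l1 x del -> lin (BPt m kap) x s t = (cis (- t) * dpsum (acoef x) kexp (cis (- t)))%C.
Proof.
  intros Hx. rewrite <- (lin_BP x del t 0 Hx). unfold lin. apply CSer_ext. intros i. unfold BP, BPt.
  rewrite !kz_kexp, mono_neg_l, mono_neg_r. reflexivity.
Qed.

Context (b : R) (hb : 0 < b) (hbk : b * (1 + kap) < 1).

Local Notation cur x := (curve (acoef x) kexp b).
Local Notation dcur x := (dcurve (acoef x) kexp b).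

Lemma phi_curve x s t : phi m kap b x s t = cur x s.
Proof. unfold phi, curve, pcirc. rewrite lin_Bf, mono_10. reflexivity. Qed.

Lemma mono_01 s t : mono 0 1 s t = cis t.
Proof. unfold mono. f_equal. ring. Qed.

Lemma phit_curve x s t : phit m kap b x s t = cur x t.
Proof. unfold phit, curve, pcirc. rewrite lin_Bft, mono_01. reflexivity. Qed.

Lemma Pw_dcurve x del s t : l1 x del -> (Ci * Pw m kap b x s t)%C = dcur x s.
Proof. intros Hx. unfold Pw, dcurve. rewrite (lin_BP x del) by auto. rewrite mono_10. reflexivity. Qed.

Lemma Pt_dcurve x del s t : l1 x del -> (Ci * Pt m kap b x s t)%C = dcur x t.
Proof. intros Hx. unfold Pt, dcurve. rewrite (lin_BPt x del) by auto. rewrite mono_01. reflexivity. Qed.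

(** With [u j = w^{-j} tau^{-(k-j)}], the factor [w - tau] turns the summand of index [j] into
    [u j - u (j + 1)]. *)
Lemma BD_telescope i s t :
  ((cis s - cis t) * BD m kap i s t = / om m kap i * (cis (- t) ^ kexp i - cis (- s) ^ kexp i))%C.
Proof.
  unfold BD. rewrite kz_kexp, Nat2Z.id. set (k := kexp i).
  set (u := (fun j => cis (- s) ^ j * cis (- t) ^ (k - j))%C).
  rewrite <- csum_scal.
  rewrite (csum_ext _ (fun j => - RtoC (/ om m kap i) * (u (S j) - u j))%C).
  - rewrite csum_scal, csum_telescope. unfold u. rewrite Nat.sub_diag, Nat.sub_0_r. simpl.
    rewrite RtoC_inv by (apply Rgt_not_eq, om_pos, hm). ring.
  - intros j Hj.
    assert (E : mono (- Z.of_nat (S j)) (Z.of_nat j - Z.of_nat k) s t = (cis (- s) ^ S j * cis (- t) ^ (k - j))%C).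
    { replace (Z.of_nat j - Z.of_nat k)%Z with (- Z.of_nat (k - j))%Z by lia.
      rewrite mono_split, mono_neg_l, mono_neg_r. reflexivity. }
    rewrite E. unfold u. replace (k - j)%nat with (S (k - S j)) by lia. rewrite !Cpow_S.
    transitivity (RtoC (/ om m kap i) * (cis (- s) ^ j * cis (- t) ^ (k - S j)) * ((cis (- s) * cis s) * cis (- t) - (cis (- t) * cis t) * cis (- s)))%C; [ring|].
    rewrite !cis_opp_mult. ring.
Qed.

Lemma psum_difference x del s t : l1 x del ->
  (psum (acoef x) kexp (cis (- s)) - psum (acoef x) kexp (cis (- t)) = - (cis s - cis t) * lin (BD m kap) x s t)%C.
Proof.
  intros Hx. assert (HA := acoef_sumle x del Hx). unfold psum, lin.
  rewrite <- (CSer_minus _ _ _ _ (psum_Csumle _ _ _ HA _ (Cmod_cis_le (- s))) (psum_Csumle _ _ _ HA _ (Cmod_cis_le (- t)))).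
  assert (HB : Csumle (fun n => x n * BD m kap n s t)%C del).
  { eapply sumle_mono; [|exact Hx]. intros i. rewrite Cmod_RC.
    assert (B := W_Cmod _ _ _ _ _ _ s t (W_BD m kap hm i)). assert (D := Rabs_pos (x i)). nra. }
  rewrite <- (CSer_scal _ _ _ HB). apply CSer_ext. intros i.
  transitivity (- x i * ((cis s - cis t) * BD m kap i s t))%C; [|ring].
  rewrite BD_telescope. unfold acoef. rewrite RtoC_mult, RtoC_inv by (apply Rgt_not_eq, om_pos, hm). ring.
Qed.

Lemma curve_difference x del s t : l1 x del ->
  (cur x s - cur x t = (cis s - cis t) * (b - lin (BD m kap) x s t))%C.
Proof.
  intros Hx. unfold curve, pcirc.
  transitivity (b * (cis s - cis t) + (psum (acoef x) kexp (cis (- s)) - psum (acoef x) kexp (cis (- t))))%C; [ring|].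
  rewrite (psum_difference x del) by auto. ring.
Qed.

Lemma mono_m1m1 s t : mono (-1) (-1) s t = (cis (- s) * cis (- t))%C.
Proof. unfold mono. rewrite <- cis_plus. f_equal. ring. Qed.

Lemma cauchy_integrand1 x s t : l1 x (b / 2) -> cis s <> cis t ->
  ((Cconj (cur x s) - Cconj (cur x t)) / (cur x s - cur x t) * dcur x t = Ci * integrand1 m kap b x s t)%C.
Proof.
  intros Hx Hne. rewrite <- (Pt_dcurve x (b / 2) s t Hx).
  rewrite <- Cminus_conj, (curve_difference x (b / 2)) by auto.
  rewrite Cmult_conj, !Cminus_conj, Cconj_R, <- !cis_opp.
  destruct (bD_inv m kap b hm hb x Hx) as [_ NZ]. specialize (NZ s t).
  assert (Nst : (cis s - cis t)%C <> 0%C).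
  { intros E. apply Hne. replace (cis s) with (cis s - cis t + cis t)%C by ring. rewrite E. ring. }
  unfold integrand1. rewrite mono_m1m1.
  (* On the circle [1 / w - 1 / tau = - (w - tau) / (w tau)], so numerator and denominator share the
     factor [w - tau], and [- mono (-1) (-1)] is left over. *)
  assert (E : (cis (- s) - cis (- t) = - (cis s - cis t) * (cis (- s) * cis (- t)))%C).
  { transitivity (- ((cis (- s) * cis s) * cis (- t) - (cis (- t) * cis t) * cis (- s)))%C; [rewrite !cis_opp_mult; ring|ring]. }
  rewrite E. field. split; auto.
Qed.

Lemma cauchy_integrand2 x s t : l1 x (b / 2) ->
  ((Cmod (cur x t) ^ 2)%R / (1 - cur x s * cur x t) * dcur x t = Ci * integrand2 m kap b x s t)%C.
Proof.
  intros Hx. rewrite <- (Pt_dcurve x (b / 2) s t Hx). unfold integrand2.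
  rewrite phit_curve, phi_curve, Cmod2_conj. unfold Cdiv. ring.
Qed.

Lemma integrands_ccont : exists r, 0 < r /\ forall x s, l1 x r ->
  ccont (integrand1 m kap b x s) /\ ccont (integrand2 m kap b x s).
Proof.
  destruct (SD_integrand1 m kap b hm hb) as [r1 [K1 [Hr1 [_ [H1 _]]]]].
  destruct (SD_integrand2 m kap b hm hb hbk) as [r2 [K2 [Hr2 [_ [H2 _]]]]].
  exists (Rmin r1 r2). split; [apply Rmin_pos; auto|]. intros x s Hx. split.
  - eapply W_ccont_t, H1. eapply l1_weaken; [exact Hx|apply Rmin_l].
  - eapply W_ccont_t, H2. eapply l1_weaken; [exact Hx|apply Rmin_r].
Qed.

Lemma two_pi_i_factor (z : C) : (/ (2 * Ci * PI) * (Ci * z) = / (2 * PI) * z)%C.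
Proof.
  assert (NPI : RtoC PI <> 0%C) by (intros F; apply RtoC_inj in F; assert (G := PI_RGT_0); lra).
  assert (NCi : Ci <> 0%C) by (intros F; apply (f_equal Im) in F; simpl in F; lra).
  field. split; auto.
Qed.

(** Within one period [t = s] is the only interior parameter at which the Cauchy quotient
    degenerates; other parameters are reached by periodicity in [boundary_equation]. *)
Lemma boundary_field_eq x Om s : l1 x (b / 2) -> 0 <= s < 2 * PI ->
  ccont (integrand1 m kap b x s) -> ccont (integrand2 m kap b x s) ->
  boundary_field Om (cur x) (dcur x) (cur x s)
  = (2 * Om * Cconj (phi m kap b x s 0) + I1 m kap b x s 0 - I2 m kap b x s 0)%C.
Proof.
  intros Hx Hs C1 C2. unfold boundary_field, contour_int. rewrite phi_curve.
  assert (E1 : is_RInt (V := C_R_NormedModule) (fun t => (Cconj (cur x s) - Cconj (cur x t)) / (cur x s - cur x t) * dcur x t)%C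
    0 (2 * PI) (CInt (fun t => Ci * integrand1 m kap b x s t)%C)).
  { apply (is_RInt_except _ _ s); [lra|now apply ccont_scal|]. intros t Ht Hts.
    apply cauchy_integrand1; auto. intros E. apply Hts. symmetry. apply cis_inj; auto; lra. }
  assert (E2 : is_RInt (V := C_R_NormedModule) (fun t => (Cmod (cur x t) ^ 2)%R / (1 - cur x s * cur x t) * dcur x t)%C
    0 (2 * PI) (CInt (fun t => Ci * integrand2 m kap b x s t)%C)).
  { apply (is_RInt_except _ _ s); [lra|now apply ccont_scal|]. intros t Ht Hts. now apply cauchy_integrand2. }
  rewrite (is_RInt_unique (V := C_R_CompleteNormedModule) _ _ _ _ E1).
  rewrite (is_RInt_unique (V := C_R_CompleteNormedModule) _ _ _ _ E2).
  rewrite !CInt_scal, !two_pi_i_factor by auto. reflexivity.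
Qed.

Lemma curve_period_Z x s p : cur x (s + IZR p * (2 * PI)) = cur x s.
Proof. unfold curve, pcirc. rewrite !cis_opp, cis_period_Z. reflexivity. Qed.

Lemma dcurve_period_Z x s p : dcur x (s + IZR p * (2 * PI)) = dcur x s.
Proof. unfold dcurve. rewrite !cis_opp, cis_period_Z. reflexivity. Qed.

Lemma boundary_equation x Om : l1 x (b / 2) ->
  (forall s, ccont (integrand1 m kap b x s) /\ ccont (integrand2 m kap b x s)) ->
  (forall s, Im (GI m kap b x s 0 + RtoC (2 * Om) * GO m kap b x s 0)%C = 0) ->
  forall t, Re (boundary_field Om (cur x) (dcur x) (cur x t) * dcur x t)%C = 0.
Proof.
  intros Hx Hc H t. destruct (angle_mod t) as [s [Hs [p ->]]].
  rewrite curve_period_Z, dcurve_period_Z.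
  destruct (Hc s) as [C1 C2]. rewrite boundary_field_eq by auto.
  rewrite <- (Pw_dcurve x (b / 2) s 0 Hx).
  (* The tangent vector is [i Pw], and the real part of [i z] is [- Im z]. *)
  transitivity (- Im (GI m kap b x s 0 + RtoC (2 * Om) * GO m kap b x s 0)%C).
  - unfold GI, GO. rewrite RtoC_mult.
    set (ph := Cconj (phi m kap b x s 0)). set (i1 := I1 m kap b x s 0). set (i2 := I2 m kap b x s 0).
    set (P := Pw m kap b x s 0). autorewrite with reim. ring.
  - rewrite H. ring.
Qed.

End Link.

(** * The bifurcating curve of V-states *)

Theorem theorem1 (b : R) (m : nat) (alpha : R)
    (hb : 0 < b < 1) (hm : (1 <= m)%nat) (halpha : 0 < alpha < 1) :
  exists (a : R) (Omega : R -> R) (f : R -> C -> C) (D : R -> C -> Prop)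
         (coef : R -> nat -> R),
    0 < a /\
    Omega 0 = (INR m - 1 + b ^ (2 * m)) / (2 * INR m) /\
    (forall w : C, Cmod w = 1 -> f 0 w = 0%C) /\
    (forall s, - a < s < a -> continuous Omega s) /\
    (forall s, - a < s < a -> C1alpha alpha (f s)) /\
    (forall s0, - a < s0 < a -> forall eps : posreal,
       locally s0 (fun s =>
         Rbar_lt (C1alpha_norm alpha (fun w => (f s w - f s0 w)%C)) eps)) /\
    (forall s, - a < s < a -> s <> 0 ->
       exists w : C, Cmod w = 1 /\ f s w <> 0%C) /\
    (* index [n] carries the coefficient [a_{n+1}(s)] *)
    (forall s, - a < s < a -> forall w : C, Cmod w = 1 ->
       is_series (V := C_R_NormedModule)
         (fun n => (coef s n * Cpow (Cconj w) (S n * m - 1))%C) (f s w)) /\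
    (forall s, - a < s < a ->
       is_domain (D s) /\
       simply_connected (D s) /\
       (forall z, closure (D s) z -> Cmod z < 1) /\
       (forall z, boundary (D s) z <->
          exists w : C, Cmod w = 1 /\ z = (b * w + f s w)%C) /\
       extends_conformally_onto_exterior (fun w => (b * w + f s w)%C) (D s) /\
       fold_symmetric m (D s) /\
       V_state (Omega s) (D s)).
Proof.
  (* This value puts [b (1 + kap)] at [(1 + b) / 2], the midpoint between [b] and 1. *)
  assert (Hkap : 0 < (1 - b) / (2 * b)) by (apply Rdiv_lt_0_compat; lra).
  set (kap := mkposreal _ Hkap).
  assert (hb0 : 0 < b) by lra.
  assert (hbk : b * (1 + kap) < 1).
  { simpl. replace (b * (1 + (1 - b) / (2 * b))) with ((1 + b) / 2) by (field; lra). lra. }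
  destruct (V_state_coefficients m kap b hm hb0 hbk) as [a0 [Lip [v [Ha0 [HLip [Hv0 Hv]]]]]].
  destruct (integrands_ccont m kap hm b hb0 hbk) as [r1 [Hr1 Hcc]].
  (* The first bound makes the exterior map a homeomorphism of the plane, the second gives
     [b + A <= (1 + b) / 2 < 1]. *)
  set (A := Rmin (b / 2) ((1 - b) / 2)).
  assert (HA : 0 < A) by (apply Rmin_pos; lra).
  assert (HA1 : A <= b / 2) by apply Rmin_l. assert (HA2 : A <= (1 - b) / 2) by apply Rmin_r.
  assert (Hk0 := cond_pos kap).
  (* The l1 size of [x s] must give the weighted bound [A] through [acoef_sumle], stay within
     [b / 2] for the Cauchy quotient, and stay within [r1] for continuity of the integrands. *)
  set (del := Rmin (kap * A) (Rmin (b / 2) r1)).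
  assert (Hdel : 0 < del) by (apply Rmin_pos; [nra|apply Rmin_pos; lra]).
  assert (Hdel1 : del <= kap * A) by apply Rmin_l.
  assert (Hdel2 : del <= b / 2) by (eapply Rle_trans; [apply Rmin_r|apply Rmin_l]).
  assert (Hdel3 : del <= r1) by (eapply Rle_trans; [apply Rmin_r|apply Rmin_r]).
  (* [x s] has l1 norm at most [2 |s|]. *)
  set (a := Rmin a0 (del / 2)).
  assert (Ha : 0 < a) by (apply Rmin_pos; lra).
  assert (Haa : a <= a0) by apply Rmin_l. assert (Had : a <= del / 2) by apply Rmin_r.
  set (x := fun s j => s * tail1 (v s) j).
  assert (Habs : forall s, - a < s < a -> Rabs s < a) by (intros s Hs; apply Rabs_def1; lra).
  assert (Hvs : forall s, - a < s < a -> l1 (v s) (/ 2)).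
  { intros s Hs. apply Hv. specialize (Habs s Hs). lra. }
  assert (Hx : forall s, - a < s < a -> l1 (x s) del).
  { intros s Hs. specialize (Habs s Hs). eapply l1_weaken.
    - apply scaled_tail1_l1. eapply l1_weaken; [apply Hvs; auto|lra].
    - lra. }
  assert (HxA : forall s, - a < s < a -> sumle (fun i => (1 + INR (kexp m i)) ^ 2 * Rabs (acoef m kap (x s) i)) A).
  { intros s Hs. eapply sumle_weaken; [apply acoef_sumle; [exact hm|apply Hx; auto]|].
    apply (Rmult_le_reg_l kap); auto. rewrite <- Rmult_assoc, Rinv_r by lra. lra. }
  assert (HxL : forall s s', - a < s < a -> - a < s' < a ->
    l1 (fun i => x s i - x s' i) ((2 + a * Lip) * Rabs (s - s'))).
  { intros s s' Hs Hs'. assert (Bs := Habs s Hs). assert (Bs' := Habs s' Hs').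
    apply (l1_ext (fun i => (s - s') * tail1 (v s) i + s' * (tail1 (v s) i - tail1 (v s') i))); [intros; unfold x; ring|].
    assert (P := Rabs_pos (s - s')). assert (P' := Rabs_pos s').
    eapply l1_weaken; [apply l1_plus; apply l1_scal; [apply tail1_l1, Hvs, Hs|apply tail1_diff, (Hv s); lra]|].
    assert (0 <= Lip * Rabs (s - s')) by (apply Rmult_le_pos; auto). nra. }
  assert (HxLA : forall s s', - a < s < a -> - a < s' < a ->
    sumle (fun i => (1 + INR (kexp m i)) ^ 2 * Rabs (acoef m kap (x s) i - acoef m kap (x s') i)) (/ kap * ((2 + a * Lip) * Rabs (s - s')))).
  { intros s s' Hs Hs'. eapply sumle_mono; [|apply acoef_sumle; [exact hm|apply (HxL s s'); auto]].
    intros i. right. unfold acoef. f_equal. f_equal. ring. }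
  set (f := fun s w => psum (acoef m kap (x s)) (kexp m) (Cconj w)).
  assert (Hf : forall s u, f s (cis u) = pcirc (acoef m kap (x s)) (kexp m) u).
  { intros s u. unfold f, pcirc. now rewrite cis_opp. }
  exists a, (fun s => Om_bif m b + v s O), f, (fun s => patch (acoef m kap (x s)) (kexp m) b), (fun s => acoef m kap (x s)).
  split; [auto|]. split; [rewrite Hv0; unfold Om_bif; ring|].
  split; [|split; [|split; [|split; [|split; [|split]]]]].
  - intros w _. unfold f, psum. rewrite (CSer_finite _ O); [reflexivity|]. intros i _. unfold acoef, x.
    rewrite Rmult_0_l, Rmult_0_r. ring.
  - intros s Hs P [eps HP].
    (* The first bound keeps [s'] in the interval where the branch is Lipschitz; the 1 added to
       [Lip] avoids a division by 0. *)
    assert (He : 0 < Rmin (a - Rabs s) (eps / (Lip + 1))).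
    { specialize (Habs s Hs). apply Rmin_pos; [lra|]. apply Rdiv_lt_0_compat; [apply cond_pos|lra]. }
    exists (mkposreal _ He). intros s' Hs'. apply HP.
    change (Rabs (s' - s) < Rmin (a - Rabs s) (eps / (Lip + 1))) in Hs'.
    change (Rabs ((Om_bif m b + v s' O) - (Om_bif m b + v s O)) < eps).
    replace ((Om_bif m b + v s' O) - (Om_bif m b + v s O)) with (v s' O - v s O) by ring.
    assert (B1 : Rabs (s' - s) < a - Rabs s) by (eapply Rlt_le_trans; [exact Hs'|apply Rmin_l]).
    assert (B2 : Rabs (s' - s) < eps / (Lip + 1)) by (eapply Rlt_le_trans; [exact Hs'|apply Rmin_r]).
    assert (B3 : Rabs s' < a) by (assert (B := Rabs_triang_inv s' s); lra).
    assert (B4 := Habs s Hs).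
    destruct (Hv s') as [_ [_ HL]]; [lra|].
    assert (B5 := l1_term _ _ O (HL s ltac:(lra))). cbv beta in B5.
    eapply Rle_lt_trans; [exact B5|].
    apply (Rmult_lt_compat_r (Lip + 1)) in B2; [|lra].
    unfold Rdiv in B2. rewrite Rmult_assoc, Rinv_l, Rmult_1_r in B2 by lra.
    assert (P0 := Rabs_pos (s' - s)). nra.
  - intros s Hs. split.
    + intros t. exists (dpcirc (acoef m kap (x s)) (kexp m) t).
      apply (is_derive_ext (pcirc (acoef m kap (x s)) (kexp m))); [intros; symmetry; apply Hf|].
      apply dC_is_derive, (dC_pcirc _ _ A), HxA, Hs.
    + destruct (C1alpha_norm_psum _ _ A (HxA s Hs) alpha (f s) halpha (Hf s)) as [l [E _]]. rewrite E. reflexivity.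
  - intros s0 Hs0 eps.
    set (L := 6 * (/ kap * (2 + a * Lip)) + 1).
    assert (HaL : 0 <= a * Lip) by (apply Rmult_le_pos; lra).
    assert (Hik : 0 < / kap) by now apply Rinv_0_lt_compat.
    assert (HL : 0 < L) by (unfold L; nra).
    assert (He : 0 < Rmin (a - Rabs s0) (eps / L)).
    { specialize (Habs s0 Hs0). apply Rmin_pos; [lra|]. apply Rdiv_lt_0_compat; [apply cond_pos|lra]. }
    exists (mkposreal _ He). intros s Hs'.
    change (Rabs (s - s0) < Rmin (a - Rabs s0) (eps / L)) in Hs'.
    assert (B1 : Rabs (s - s0) < a - Rabs s0) by (eapply Rlt_le_trans; [exact Hs'|apply Rmin_l]).
    assert (B2 : Rabs (s - s0) < eps / L) by (eapply Rlt_le_trans; [exact Hs'|apply Rmin_r]).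
    assert (Hs : - a < s < a) by (assert (B := Rabs_triang_inv s s0); assert (B' : Rabs s < a) by lra; apply Rabs_def2 in B'; lra).
    destruct (C1alpha_norm_psum (fun i => acoef m kap (x s) i - acoef m kap (x s0) i) (kexp m) _
      (HxLA s s0 Hs Hs0) alpha (fun w => (f s w - f s0 w)%C) halpha) as [l [E Bl]].
    { intros u. rewrite !Hf. unfold pcirc, psum.
      rewrite <- (CSer_minus _ _ _ _ (psum_Csumle _ _ _ (HxA s Hs) _ (Cmod_cis_le (- u))) (psum_Csumle _ _ _ (HxA s0 Hs0) _ (Cmod_cis_le (- u)))).
      apply CSer_ext. intros i. rewrite RtoC_minus. ring. }
    rewrite E. simpl.
    apply (Rmult_lt_compat_r L) in B2; auto. unfold Rdiv in B2. rewrite Rmult_assoc, Rinv_l, Rmult_1_r in B2 by lra.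
    assert (P0 := Rabs_pos (s - s0)). unfold L in B2. nra.
  (* At [w = 1] the value of [f s] is the sum of the coefficients. The first is [s / om 0], and the
     others add up to at most half of it in modulus, since [v s] has l1 norm at most [1 / 2] and
     [om] is smallest at 0. *)
  - intros s Hs Hne. exists 1%C. split; [apply Cmod_1|].
    assert (Hp := Rabs_pos_lt s Hne). assert (Hom := om_pos m kap hm).
    assert (E1 : f s 1%C = CSer (fun i => RtoC (acoef m kap (x s) i))).
    { unfold f, psum. apply CSer_ext. intros i.
      replace (Cconj 1) with (RtoC 1) by (apply Cext; simpl; ring). rewrite Cpow_1_l. ring. }
    assert (S1 : Csumle (fun i => RtoC (acoef m kap (x s) i)) A).
    { eapply sumle_mono; [|apply (psum_Csumle _ _ _ (HxA s Hs) 1%C); rewrite Cmod_1; lra].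
      intros i. cbv beta. rewrite Cpow_1_l, Cmult_1_r. lra. }
    assert (S0 : l1 (unit_seq O) 1) by apply unit_seq_l1.
    assert (S2 : Csumle (fun i => RtoC (acoef m kap (x s) O * unit_seq O i)) (Rabs (acoef m kap (x s) O) * 1)).
    { eapply sumle_mono; [|apply (l1_scal (acoef m kap (x s) O) _ _ S0)]. intros i. rewrite Cmod_R. lra. }
    assert (S3 : Csumle (fun i => RtoC (acoef m kap (x s) i) - RtoC (acoef m kap (x s) O * unit_seq O i))%C (Rabs s / om m kap O * / 2)).
    { eapply sumle_mono; [|apply (sumle_scal (Rabs s / om m kap O)); [left; apply Rdiv_lt_0_compat; auto|apply (Hvs s Hs)]].
      intros i. cbv beta. rewrite <- RtoC_minus, Cmod_R. destruct i as [|i].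
      - unfold unit_seq. simpl. rewrite Rmult_1_r, Rminus_diag, Rabs_R0.
        apply Rmult_le_pos; [left; apply Rdiv_lt_0_compat; auto|apply Rabs_pos].
      - unfold unit_seq. simpl Nat.eqb. rewrite Rmult_0_r, Rminus_0_r. unfold acoef, x. simpl tail1.
        rewrite !Rabs_mult, (Rabs_pos_eq (/ om m kap (S i))) by (left; apply Rinv_0_lt_compat; auto).
        assert (I : / om m kap (S i) <= / om m kap O).
        { apply Rinv_le_contravar; auto. unfold om.
          assert (F : INR (freq m O) <= INR (freq m (S i))) by (apply le_INR; unfold freq; nia).
          assert (F0 : 0 <= INR (freq m O)) by apply pos_INR.
          assert (F1 := fwt_ge_1 m kap O). apply Rmult_le_compat; try lra.
          unfold fwt. apply Rplus_le_compat_l. apply Rmult_le_compat_l; lra. }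
        assert (Q : 0 <= Rabs s * Rabs (v s (S i))) by (apply Rmult_le_pos; apply Rabs_pos).
        unfold Rdiv. nra. }
    intros E. rewrite E1 in E.
    assert (E2 := CSer_minus _ _ _ _ S1 S2). rewrite E in E2.
    assert (E3 : CSer (fun i => RtoC (acoef m kap (x s) O * unit_seq O i)) = RtoC (acoef m kap (x s) O)).
    { rewrite (CSer_finite _ 1%nat).
      - simpl. unfold unit_seq. simpl. rewrite Rmult_1_r. ring.
      - intros i Hi. unfold unit_seq. destruct i; [lia|]. simpl. now rewrite Rmult_0_r. }
    rewrite E3 in E2. assert (B := CSer_Cmod _ _ S3). rewrite E2 in B.
    replace (0 - RtoC (acoef m kap (x s) O))%C with (- RtoC (acoef m kap (x s) O))%C in B by ring.
    rewrite Cmod_opp, Cmod_R in B. unfold acoef, x in B. simpl tail1 in B.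
    rewrite Rmult_1_r, Rabs_mult, (Rabs_pos_eq (/ om m kap O)) in B by (left; apply Rinv_0_lt_compat; auto).
    assert (0 < / om m kap O * Rabs s) by (apply Rmult_lt_0_compat; auto; apply Rinv_0_lt_compat; auto).
    unfold Rdiv in B. lra.
  - intros s Hs w Hw. unfold f, psum. eapply CSer_is_series, psum_Csumle; [apply HxA, Hs|]. rewrite Cmod_conj. lra.
  - intros s Hs. assert (hA := HxA s Hs). assert (hbA : b + A < 1) by lra.
    assert (Pdom := patch_domain _ _ _ hA b hb0 HA1 hbA).
    assert (Pcl := patch_closure_in_disc _ _ _ hA b hb0 HA1 hbA).
    split; [exact Pdom|].
    split; [apply (patch_simply_connected _ _ _ hA b hb0 HA1 hbA)|].
    split; [exact Pcl|].
    split; [intros z; apply (patch_boundary_param _ _ _ hA b hb0 HA1 hbA)|].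
    split; [|split].
    + apply (patch_exterior _ _ _ hA b hb0 HA1 hbA). intros w Hw. unfold f. symmetry. now apply homeo_circle.
    + refine (patch_rotation _ _ _ hA b hb0 HA1 hbA (2 * PI / INR m) _). intros i. rewrite S_kexp by auto. rewrite cis_pow.
      assert (Nm : INR m <> 0) by (apply not_0_INR; lia).
      replace (INR (freq m i) * (2 * PI / INR m)) with (0 + INR (S i) * (2 * PI)).
      * rewrite cis_period_nat. apply cis_0.
      * unfold freq. rewrite mult_INR. field. auto.
    + split; [exact Pdom|]. split; [exact Pcl|]. split; [apply (patch_conj _ _ _ hA b hb0 HA1 hbA)|].
      exists (curve (acoef m kap (x s)) (kexp m) b), (dcurve (acoef m kap (x s)) (kexp m) b).
      split; [apply (patch_Jordan _ _ _ hA b hb0 HA1 hbA)|].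
      split; [apply (patch_oriented _ _ _ hA b hb0 HA1 hbA)|].
      apply (boundary_equation m kap hm b hb0).
      * eapply l1_weaken; [apply Hx, Hs|exact Hdel2].
      * intros t. apply Hcc. eapply l1_weaken; [apply Hx, Hs|exact Hdel3].
      * apply (Hv s). specialize (Habs s Hs). lra.
Qed.
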